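(* Let $\mathcal M_N:=M_N\otimes L^{\infty-}(\Omega)$ be the algebra of $N\times N$ random matrices whose entries have moments of all orders. Define rescaled correlation functions $\tilde\varphi^{(N)}=(\tilde\varphi^{(N)}_n)_{n\in\mathbb N}$ on $\mathcal M_N$ by $$\tilde\varphi^{(N)}_n(D_1,\dots,D_n):=k_n\bigl(\mathrm{Tr}(D_1),\dots,\mathrm{Tr}(D_n)\bigr)\cdot N^{n-2}\qquad(D_1,\dots,D_n\in\mathcal M_N).$$ Assume that for each $N\in\mathbb N$ we have subalgebras $\mathcal A_N,\mathcal B_N\subset\mathcal M_N$ such that (1) $\mathcal A_N$ is a unitarily invariant ensemble; (2) $\mathcal A_N$ and $\mathcal B_N$ are independent. Let $(A_i^{(N)})_{i\in I}$ be a family of elements of $(\mathcal A_N,\tilde\varphi^{(N)})$ which has a limit distribution of all orders, and let $(B_j^{(N)})_{j\in J}$ be a family of elements of $(\mathcal B_N,\tilde\varphi^{(N)})$ which has a limit distribution of all orders. Then the families $\{A_i^{(N)}\mid i\in I\}$ and $\{B_j^{(N)}\mid j\in J\}$ are asymptotically free of all orders.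
   Context: $k_n$ is the $n$-th classical cumulant (an $n$-linear functional), $\mathrm{Tr}$ the unnormalized trace. $\mathcal A_N$ is a unitarily invariant ensemble if for all $A_1,\dots,A_n\in\mathcal A_N$ and every unitary $N\times N$ matrix $U$, the joint distribution of all entries of $A_1,\dots,A_n$ equals that of $UA_1U^*,\dots,UA_nU^*$. Independence of $\mathcal A_N$ and $\mathcal B_N$ means that the entries of the elements of $\mathcal A_N$ are independent from the entries of the elements of $\mathcal B_N$. Partitioned permutations: permutations are composed right to left; $\mathcal P(n)$ is the lattice of partitions of $[1,n]$ ordered by refinement ($\mathcal V\le\mathcal W$ iff each block of $\mathcal V$ lies in a block of $\mathcal W$), $\vee$ the join, $1_n$ the one-block partition; for $\pi\in S_n$, $|\pi|=n-\#\{\text{cycles of }\pi\}$, and $0_\pi$ is the partition into cycles; $|\mathcal V|=n-\#\mathcal V$. $\mathcal{PS}(n)$ is the set of pairs $(\mathcal V,\pi)$ with $\pi\in S_n$, $\mathcal V\in\mathcal P(n)$, $\mathcal V\ge0_\pi$; $\mathcal{PS}=\bigcup_n\mathcal{PS}(n)$; $|(\mathcal V,\pi)|=2|\mathcal V|-|\pi|$; $(\mathcal V,\pi)\cdot(\mathcal W,\sigma)=(\mathcal V\vee\mathcal W,\pi\sigma)$ if $|(\mathcal V,\pi)|+|(\mathcal W,\sigma)|=|(\mathcal V\vee\mathcal W,\pi\sigma)|$, and $0$ otherwise. Convolution of functions on $\mathcal{PS}$: $(f*g)(\mathcal U,\gamma)=\sum_{(\mathcal V,\pi)\cdot(\mathcal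 W,\sigma)=(\mathcal U,\gamma)}f(\mathcal V,\pi)g(\mathcal W,\sigma)$. $\zeta(\mathcal V,\pi)=1$ if $\mathcal V=0_\pi$, else $0$; $\delta(\mathcal V,\pi)=1$ if $\pi$ is the identity and $\mathcal V$ is the partition into singletons, else $0$; $\mu$ is the inverse: $\zeta*\mu=\delta=\mu*\zeta$. A higher order probability space (HOPS) $(\mathcal A,\varphi)$ is a unital complex algebra $\mathcal A$ with maps $\varphi_n:\mathcal A^n\to\mathbb C$ ($n\in\mathbb N$) that are linear and tracial in each argument, symmetric in the $n$ arguments, with $\varphi_1(1)=1$ and $\varphi_n(1,a_2,\dots,a_n)=0$ for $n\ge2$. Set $\varphi(1_n,\pi)[a_1,\dots,a_n]=\varphi_r(a|_{c_1},\dots,a|_{c_r})$, where $c_1,\dots,c_r$ are the cycles of $\pi$ and $a|_c=a_{i_1}\cdots a_{i_k}$ for $c=(i_1,\dots,i_k)$, and $\varphi(\mathcal V,\pi)[a_1,\dots,a_n]=\prod_{V\in\mathcal V}\varphi(1_V,\pi|_V)[(a_i)_{i\in V}]$. The free cumulants are $\kappa(\mathcal U,\gamma)[a_1,\dots,a_n]=\sum_{(\mathcal V,\pi)\cdot(\mathcal W,\sigma)=(\mathcal U,\gamma)}\varphi(\mathcal V,\pi)[a_1,\dots,a_n]\,\mu(\mathcal W,\sigma)$. Subsets $(\mathcal X_i)_i$ of $\mathcal A$ are free of all orders if $\kappa(1_n,\pi)[a_1,\dots,a_n]=0$ for all $n\ge2$, all $\pi\in S_n$ and all $a_k\in\mathcal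 X_{i(k)}$ such that $i(p)\ne i(q)$ for some $p,q$. Given HOPSs $(\mathcal A_N,\varphi^{(N)})$ and $(\mathcal A,\varphi)$, a family $(a_i^{(N)})_{i}$ in $\mathcal A_N$ converges to $(a_i)_i$ in $\mathcal A$ if $\lim_N\varphi_n^{(N)}(p_1((a_i^{(N)})_i),\dots,p_n((a_i^{(N)})_i))=\varphi_n(p_1((a_i)_i),\dots,p_n((a_i)_i))$ for all $n$ and all non-commutative polynomials $p_1,\dots,p_n$. A sequence of families has a limit distribution of all orders if it converges to some family in some HOPS. Families indexed by disjoint sets $I_1,\dots,I_k$ are asymptotically free of all orders if the union family (indexed by $I_1\cup\dots\cup I_k$) converges to a family $(a_i)$ in some HOPS $(\mathcal A,\varphi)$ in which the sets $\{a_i\mid i\in I_1\},\dots,\{a_i\mid i\in I_k\}$ are free of all orders. *)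

(* Defs.v *)
From HB Require Import structures.
From mathcomp Require Import all_boot all_order all_algebra all_fingroup.
From mathcomp Require Import complex.

Set Implicit Arguments.
Unset Strict Implicit.
Unset Printing Implicit Defensive.
Import Order.TTheory GRing.Theory Num.Theory.
Local Open Scope ring_scope.

Definition finer (T : finType) (P Q : {set {set T}}) : bool :=
  [forall A in P, exists B in Q, A \subset B].

(* The join in the lattice of partitions: its blocks are the classes of the
   transitive closure of "in a common block of P or in a common block of Q". *)
Definition pjoin (T : finType) (P Q : {set {set T}}) : {set {set T}} :=
  equivalence_partition
    (connect (fun x y => (y \in pblock P x) || (y \in pblock Q x)))
    [set: T].

Definition is_pperm n (x : {set {set 'I_n}} * 'S_n) : bool :=
  partition x.1 [set: 'I_n] && finer (porbits x.2) x.1.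

Definition pperm n := {x : {set {set 'I_n}} * 'S_n | is_pperm x}.
HB.instance Definition _ n := Finite.on (pperm n).

Definition pp_part n (x : pperm n) : {set {set 'I_n}} := (val x).1.
Definition pp_perm n (x : pperm n) : 'S_n := (val x).2.

(* (1_n, s), which requires n > 0 since set0 is not a block. *)
Lemma pp_full_subproof n (s : 'S_n.+1) :
  is_pperm ([set [set: 'I_n.+1]], s).
Proof.
apply/andP; split => /=; last first.
  apply/forall_inP => A _; apply/exists_inP.
  by exists [set: 'I_n.+1]; rewrite ?inE ?subsetT.
apply/and3P; split.
- by rewrite /cover big_set1.
- exact: trivIset1.
- by rewrite inE eq_sym -subset0; apply/subsetPn; exists ord0; rewrite inE.
Qed.
Definition pp_full n (s : 'S_n.+1) : pperm n.+1 :=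
  @exist _ (@is_pperm n.+1) _ (pp_full_subproof s).

Definition pp_len n (x : pperm n) : int :=
  2 * (n%:Z - #|pp_part x|%:Z) - (n%:Z - #|porbits (pp_perm x)|%:Z).

(* x . y = z; the product is 0 when no z satisfies this. Permutations are
   composed right to left, whereas (s * t)%g is "s, then t" in MathComp. *)
Definition pp_mul n (x y z : pperm n) : bool :=
  [&& pp_part z == pjoin (pp_part x) (pp_part y),
      pp_perm z == (pp_perm y * pp_perm x)%g &
      pp_len x + pp_len y == pp_len z].

Section Convolution.
Variables (C : comNzRingType) (n : nat).
Implicit Types f g : pperm n -> C.

Definition pp_conv f g (z : pperm n) : C :=
  \sum_(x : pperm n) \sum_(y : pperm n | pp_mul x y z) f x * g y.

Definition pp_zeta (x : pperm n) : C := (pp_part x == porbits (pp_perm x))%:R.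

Definition pp_delta (x : pperm n) : C :=
  ((pp_perm x == 1%g) &&
   (pp_part x == [set [set i] | i in [set: 'I_n]]))%:R.
End Convolution.

From mathcomp Require Import all_classical all_reals all_analysis.
Import numFieldNormedType.Exports.

Definition is_moebius (C : comNzRingType) n (mu : pperm n -> C) : Prop :=
  pp_conv (@pp_zeta C n) mu = @pp_delta C n /\
  pp_conv mu (@pp_zeta C n) = @pp_delta C n.

(* The inverse exists and is unique, so xget selects it. *)
Definition pp_moebius (C : comNzRingType) n : pperm n -> C :=
  xget (fun=> 0) (@is_moebius C n).

Section HOPS.
Variables (C : comNzRingType) (A : algType C).
(* phi [:: a_1; ...; a_n] stands for phi_n(a_1, ..., a_n), n >= 1; the value
   phi [::] is irrelevant. *)
Variable phi : seq A -> C.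

Record is_hops : Prop := IsHops {
  hops_linear : forall s1 s2 (c : C) x y,
    phi (s1 ++ (c *: x + y) :: s2) =
    c * phi (s1 ++ x :: s2) + phi (s1 ++ y :: s2);
  hops_tracial : forall s1 s2 x y,
    phi (s1 ++ (x * y) :: s2) = phi (s1 ++ (y * x) :: s2);
  hops_symmetric : forall s t, perm_eq s t -> phi s = phi t;
  hops_unit : phi [:: 1] = 1;
  hops_unit0 : forall s, s <> [::] -> phi (1 :: s) = 0 }.

(* phi(V, s)[a]: one factor for each block B, whose arguments are the products
   a_{i_1} ... a_{i_k} along the cycles (i_1, ..., i_k) of s contained in B;
   froots picks one starting point i_1 in each cycle. *)
Definition phi_pp n (x : pperm n) (a : 'I_n -> A) : C :=
  \prod_(B in pp_part x)
    phi [seq \prod_(j <- fingraph.orbit (pp_perm x) i) a j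
        | i <- enum B & i \in froots (pp_perm x)].

Definition kappa n (z : pperm n) (a : 'I_n -> A) : C :=
  pp_conv (fun x => phi_pp x a) (@pp_moebius C n) z.

Definition free_all_orders (K : Type) (X : K -> set A) : Prop :=
  forall n (s : 'S_n.+2) (a : 'I_n.+2 -> A) (k : 'I_n.+2 -> K),
    (forall i, X (k i) (a i)) -> (exists p q, k p <> k q) ->
    kappa (pp_full s) a = 0.
End HOPS.

(* A non-commutative polynomial in variables indexed by I, as a list of
   coefficients and words (the empty word being the constant monomial). *)
Definition ncpoly (C I : Type) := seq (C * seq I).

Definition nc_eval (C : comNzRingType) (A : algType C) (I : Type) (a : I -> A)
    (p : ncpoly C I) : A :=
  \sum_(m <- p) m.1 *: \prod_(i <- m.2) a i.

Section Limits.
Local Open Scope classical_set_scope.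
Variables (R : realType) (A : nat -> algType R[i]).
Variable phi : forall N, seq (A N) -> R[i].

(* The prelimit functionals phi N only enter through their values: they need
   not satisfy the axioms of is_hops on the whole ambient algebra A N. *)
Definition converges_to (I : Type) (a : forall N, I -> A N)
    (B : algType R[i]) (psi : seq B -> R[i]) (b : I -> B) : Prop :=
  forall ps : seq (ncpoly R[i] I), ps <> [::] ->
    (fun N => phi [seq nc_eval (a N) p | p <- ps] : R[i]^o) @ \oo -->
    (psi [seq nc_eval b p | p <- ps] : R[i]^o).

Definition has_limit_distribution (I : Type) (a : forall N, I -> A N) : Prop :=
  exists (B : algType R[i]) (psi : seq B -> R[i]) (b : I -> B),
    is_hops psi /\ converges_to a psi b.

Definition asymptotically_free (I J : Type)
    (a : forall N, I -> A N) (b : forall N, J -> A N) : Prop :=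
  exists (B : algType R[i]) (psi : seq B -> R[i]) (c : I + J -> B),
    [/\ is_hops psi,
        converges_to
          (fun N x => match x with inl i => a N i | inr j => b N j end) psi c &
        free_all_orders psi
          (fun k : bool => if k then range (c \o inl) else range (c \o inr))].
End Limits.

Section FunctionAlgebra.
Variables (C : comNzRingType) (T : pointedType) (A : algType C).

Let fct_scalerAl (c : C) (f g : T -> A) : c *: (f * g) = (c *: f) * g.
Proof. by apply/funext => w; apply: scalerAl. Qed.
HB.instance Definition _ := GRing.Lmodule_isLalgebra.Build C (T -> A) fct_scalerAl.

Let fct_scalerAr (c : C) (f g : T -> A) : c *: (f * g) = f * (c *: g).
Proof. by apply/funext => w; apply: scalerAr. Qed.
HB.instance Definition _ := GRing.Lalgebra_isAlgebra.Build C (T -> A) fct_scalerAr.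
End FunctionAlgebra.

Section RandomMatrices.
Local Open Scope classical_set_scope.
Local Open Scope complex_scope.
Variables (R : realType) (d : measure_display) (T : measurableType d).
Variable P : probability T R.

(* R[i] carries no measurable structure: its Borel sets are those of R * R. *)
Definition borelC : set (set R[i]) :=
  [set Z | measurable [set xy : R * R | Z (xy.1 +i* xy.2)]].

Definition expectationC (X : T -> R[i]) : R[i] :=
  fine 'E_P[fun w => complex.Re (X w)] +i* fine 'E_P[fun w => complex.Im (X w)].

(* k_n(X_1, ..., X_n), from the Moebius inversion of
   E[X_1 ... X_n] = \sum_Q \prod_(V in Q) k_#|V|(X_i, i in V). *)
Definition cumulant (X : seq (T -> R[i])) : R[i] :=
  \sum_(Q : {set {set 'I_(size X)}} | finset.partition Q finset.setT)
    (-1) ^+ #|Q|.-1 * (#|Q|.-1)`!%:R *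
    \prod_(V in Q) expectationC (fun w => \prod_(i in V) nth (cst 0) X i w).

(* Functions rather than almost-everywhere classes. *)
Definition Linfty_minus : set (T -> R[i]) :=
  [set X | forall p : R, 1 <= p ->
     (fun w => complex.Re (X w)) \in Lfun P p%:E /\
     (fun w => complex.Im (X w)) \in Lfun P p%:E].

Section FixedSize.
(* Matrices have size N.+1: the N-th term of a sequence of ensembles is the
   one of dimension N + 1. Random matrices form an algebra for the pointwise
   operations. *)
Variable N : nat.

Definition moment_mx : set (T -> 'M[R[i]]_N.+1) :=
  [set D | forall i j, Linfty_minus (fun w => D w i j)].

Definition rescaled_cumulant (D : seq (T -> 'M[R[i]]_N.+1)) : R[i] :=
  cumulant [seq (fun w => \tr (X w)) | X <- D] *
  N.+1%:R ^ ((size D)%:Z - 2).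

(* Unital: phi_1(e) = 1 forces the unit e of a subalgebra to be 1. *)
Definition mx_subalgebra (S : set (T -> 'M[R[i]]_N.+1)) : Prop :=
  S `<=` moment_mx /\ GRing.subalg_closed [in S].

Definition mxs_measurable n : set (set ('I_n -> 'M[R[i]]_N.+1)) :=
  <<s [set Z | exists k i j B, borelC B /\
         Z = [set M : 'I_n -> 'M[R[i]]_N.+1 | B (M k i j)]] >>.

Definition unitarily_invariant (S : set (T -> 'M[R[i]]_N.+1)) : Prop :=
  forall n (A : 'I_n -> T -> 'M[R[i]]_N.+1), (forall k, S (A k)) ->
  forall U : 'M[R[i]]_N.+1, U \is unitarymx ->
  forall Z, mxs_measurable Z ->
    P [set w | Z (fun k => A k w)] =
    P [set w | Z (fun k => U *m A k w *m (U ^t*)%sesqui)].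

Definition entries_sigma (S : set (T -> 'M[R[i]]_N.+1)) : set (set T) :=
  <<s [set E | exists A i j B,
         [/\ S A, borelC B & E = [set w | B (A w i j)]]] >>.

Definition independent_ensembles (S1 S2 : set (T -> 'M[R[i]]_N.+1)) : Prop :=
  forall E F, entries_sigma S1 E -> entries_sigma S2 F ->
    P (E `&` F) = (P E * P F)%E.
End FixedSize.
End RandomMatrices.

(* Main.v *)
(* All estimates are made for the unrescaled moments
   f_U(i, j) = \prod_(B in U) E[\prod_(k in B) A_k (i_k, j_k)], U a partition of [1, n].
   - Unitary invariance says that E[\bigotimes_k A_k] commutes with U^(\otimes n)
     for every unitary U, hence with g^(\otimes n) for every matrix g. When n <= N
     this makes f_U(i, j) a combination of the products of the deltas
     [i_k = j_(rho k)], with coefficients c_U(rho) read off from f_U, so that no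
     Weingarten calculus is needed.
   - With the independence of the two ensembles, Moebius inversion over partitions
     gives an exact identity at finite N:
       phi_(AB)(z) = \sum_(x y = z) N^(|z| - |x| - |y|) k_N(x) phi_B(y),
     where k_N depends on the A_k only. Here the product x y of two partitioned
     permutations is always defined, and |z| <= |x| + |y|.
   - For B = 1 this is a system for k_N whose limit is triangular and invertible.
     So k_N converges to some k with k * zeta = phi_A and phi_(AB) = k * phi_B in
     the limit; if zeta has the inverse mu, then k = phi_A * mu is the cumulant of
     A and kappa_(AB) = kappa_A * kappa_B.
   - Each letter of the union family is a product A_k B_k with A_k = 1 or B_k = 1.
     A cumulant with an entry 1 vanishes unless that point is a singleton block, so
     that (1_n, s) is never the product of two contributing terms when letters of
     both kinds occur: mixed cumulants vanish.
   - The limit space is made of the sequences of matrices p(A^(N), B^(N)), p a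
     non-commutative polynomial, and the limits exist by reduction to words. *)

Require Import Defs.
From HB Require Import structures.
From mathcomp Require Import all_boot all_order all_algebra all_fingroup.
From mathcomp Require Import complex.
From mathcomp Require Import zify ring.

Set Implicit Arguments.
Unset Strict Implicit.
Unset Printing Implicit Defensive.
Import Order.TTheory GRing.Theory Num.Theory.

(** * Partitions and partitioned permutations *)

(** Moments are multiplicative over the blocks of U and cumulants are not. The identities between
    cumulants are therefore compared after summation over all partitions finer than U, and
    [moebius_unique] removes the sum. Under this summation a product of two functions of U becomes a
    sum over joins, because the join of V and W refines U iff both do: this is where the product of
    partitioned permutations comes from. The exponent |z| - |x| - |y| is what the normalization in
    [rescaled_cumulant] leaves over. The passage from unitary to arbitrary g is made for the sake of
    singular matrices: a coordinate projection detects the index patterns with nonzero moment, and a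
    matrix sending e_k to the basis vector of index j_k replaces arbitrary column indices by
    distinct ones. Both need n distinct basis vectors, whence [n <= N.+1]. The rule for an argument
    1 is exact at every finite size: after rescaling, cutting its point out of a cycle changes
    nothing. It then passes to the limits. *)

Section Partitions.
Variable T : finType.

Definition eqv (P : {set {set T}}) (x y : T) := y \in pblock P x.

Definition part := {P : {set {set T}} | partition P [set: T]}.
HB.instance Definition _ := Finite.on part.

Definition blocks (V : part) : {set {set T}} := sval V.
Coercion blocks : part >-> set_of.
Implicit Types U V W X : part.

Lemma part_partition V : partition V [set: T]. Proof. exact: valP V. Qed.

Lemma part_triv V : trivIset V.
Proof. by case/and3P: (part_partition V). Qed.

Lemma part_cover V x : x \in cover V.
Proof. by rewrite (cover_partition (part_partition V)) inE. Qed.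

Lemma eqv_refl V x : eqv V x x.
Proof. by rewrite /eqv mem_pblock part_cover. Qed.

Lemma eqv_pblock V x y : eqv V x y = (pblock V x == pblock V y).
Proof. by rewrite eq_pblock ?part_cover ?part_triv. Qed.

Lemma eqv_sym V x y : eqv V x y = eqv V y x.
Proof. by rewrite !eqv_pblock eq_sym. Qed.

Lemma eqv_trans V y x z : eqv V x y -> eqv V y z -> eqv V x z.
Proof. by rewrite !eqv_pblock => /eqP->. Qed.

Lemma eqv_block V B x y : B \in blocks V -> x \in B -> eqv V x y = (y \in B).
Proof. by move=> VB Bx; rewrite /eqv (def_pblock (part_triv V) VB Bx). Qed.

Lemma pblock_part V x : pblock V x \in blocks V.
Proof. by rewrite pblock_mem ?part_cover. Qed.

Lemma part_block V B : B \in blocks V -> exists x, B = pblock V x.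
Proof.
move=> VB; have /set0Pn[x Bx] : B != set0.
  by apply: contraTneq VB => ->; case/and3P: (part_partition V).
by exists x; rewrite (def_pblock (part_triv V) VB Bx).
Qed.

Lemma eqv_inj V W : eqv V =2 eqv W -> V = W.
Proof.
move=> e; apply: val_inj; change (blocks V = blocks W).
rewrite -(equivalence_partition_pblock (part_partition V)).
rewrite -(equivalence_partition_pblock (part_partition W)).
apply: eq_in_imset => x _; apply/setP=> y.
by rewrite !inE; have := e x y; rewrite /eqv => ->.
Qed.

Lemma partition_discrete : partition [set [set x] | x in [set: T]] [set: T].
Proof.
have e : equivalence_partition eq_op [set: T] = [set [set x] | x in [set: T]].
  by apply: eq_in_imset => x _; apply/setP=> y; rewrite !inE eq_sym.
rewrite -e; apply: equivalence_partitionP => x y z _ _ _.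
by split=> // /eqP->.
Qed.

Definition part_discrete : part :=
  @exist _ (fun P => partition P [set: T]) _ partition_discrete.

(* Sealed by a sigma type, like [pj], [pmeet], [isolate] and [pcyc] below, so
   that conversion does not evaluate concrete partitions. *)
Lemma mkpart_subproof (R : rel T) :
  {V : part | equivalence_rel R -> blocks V = equivalence_partition R [set: T]}.
Proof.
exists (insubd part_discrete (equivalence_partition R [set: T])) => eR.
by apply: insubdK; apply: equivalence_partitionP => x y z _ _ _; apply: eR.
Qed.

Definition mkpart (R : rel T) : part := sval (mkpart_subproof R).

Lemma mkpartE (R : rel T) : equivalence_rel R ->
  blocks (mkpart R) = equivalence_partition R [set: T].
Proof. exact: (svalP (mkpart_subproof R)). Qed.

Lemma eqv_mkpart (R : rel T) : equivalence_rel R -> eqv (blocks (mkpart R)) =2 R.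
Proof.
move=> eR x y; rewrite /eqv mkpartE//.
by rewrite (@pblock_equivalence_partition _ R) ?inE// => ? ? ? _ _ _; apply: eR.
Qed.

Lemma finerP V W :
  reflect (forall x y, eqv V x y -> eqv W x y) (finer V W).
Proof.
apply: (iffP forall_inP) => [fVW x y Vxy|VW A VA].
  have /exists_inP[B WB /subsetP sB] := fVW _ (pblock_part V x).
  by rewrite (eqv_block y WB) ?sB // mem_pblock part_cover.
have [x ->] := part_block VA.
apply/exists_inP; exists (pblock W x); first exact: pblock_part.
by apply/subsetP => y; apply: VW.
Qed.

Lemma finer_refl V : finer V V.
Proof. exact/finerP. Qed.

Lemma finer_trans W V U :
  finer V W -> finer W U -> finer V U.
Proof. by move=> /finerP h1 /finerP h2; apply/finerP=> x y /h1/h2. Qed.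

Lemma finer_anti V W : finer V W -> finer W V -> V = W.
Proof.
move=> /finerP h1 /finerP h2; apply: eqv_inj => x y.
by apply/idP/idP => [/h1|/h2].
Qed.

Lemma pjoin_equivalence V W : equivalence_rel
  (connect (fun x y => (y \in pblock V x) || (y \in pblock W x))).
Proof.
set r := (X in connect X).
have sr : connect_sym r.
  apply: sym_connect_sym => x y; rewrite /r.
  by have := eqv_sym V x y; have := eqv_sym W x y; rewrite /eqv => -> ->.
move=> x y z; split=> [|xy]; first exact: connect0.
by rewrite (same_connect sr xy).
Qed.

Lemma pj_subproof V W : {U : part | U = 
  mkpart (connect (fun x y => (y \in pblock V x) || (y \in pblock W x)))}.
Proof. by eexists. Qed.

Definition pj V W : part := sval (pj_subproof V W).

Lemma pjE V W : pj V W = 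
  mkpart (connect (fun x y => (y \in pblock V x) || (y \in pblock W x))).
Proof. exact: (svalP (pj_subproof V W)). Qed.

Lemma val_pj V W : blocks (pj V W) = pjoin V W.
Proof. by rewrite pjE mkpartE //; apply: pjoin_equivalence. Qed.

Lemma eqv_pj V W : eqv (blocks (pj V W)) =2
  connect (fun x y => eqv V x y || eqv W x y).
Proof. by move=> x y; rewrite pjE eqv_mkpart //; apply: pjoin_equivalence. Qed.

Lemma finer_pj V W U :
  finer (blocks (pj V W)) U = finer V U && finer W U.
Proof.
apply/finerP/andP => [h|[/finerP h1 /finerP h2] x y].
  by split; apply/finerP => x y xy; apply: h; rewrite eqv_pj connect1 // xy ?orbT.
rewrite eqv_pj => /connectP[p]; elim: p x => [|z p IH] x /=.
  by move=> _ ->; apply: eqv_refl.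
case/andP=> xz zp ey; apply: eqv_trans (IH _ zp ey).
by case/orP: xz => [/h1|/h2].
Qed.

Lemma finer_pjl V W : finer V (blocks (pj V W)).
Proof. by have := finer_refl (pj V W); rewrite finer_pj => /andP[]. Qed.
Lemma finer_pjr V W : finer W (blocks (pj V W)).
Proof. by have := finer_refl (pj V W); rewrite finer_pj => /andP[]. Qed.

(** A partition is determined by its upper bounds; the identities for [pj] thus reduce to Boolean
    ones through [finer_pj]. *)
Lemma part_ext V W :
  (forall U, finer V U = finer W U) -> V = W.
Proof.
by move=> e; apply: finer_anti; [rewrite e|rewrite -e]; apply: finer_refl.
Qed.

Lemma pjC V W : pj V W = pj W V.
Proof. by apply: part_ext => U; rewrite !finer_pj andbC. Qed.
Lemma pjA V W X : pj V (pj W X) = pj (pj V W) X.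
Proof. by apply: part_ext => U; rewrite !finer_pj andbA. Qed.
Lemma pj_idl V W : finer V W -> pj V W = W.
Proof.
move=> h; apply: part_ext => U; rewrite finer_pj andb_idl //.
exact: finer_trans.
Qed.

Lemma pmeet_equivalence V W :
  equivalence_rel (fun x y => eqv V x y && eqv W x y).
Proof.
move=> x y z; split=> [|/andP[]]; first by rewrite !eqv_refl.
by rewrite !eqv_pblock => /eqP-> /eqP->.
Qed.

Lemma pmeet_subproof V W : {U : part | U = mkpart (fun x y => eqv V x y && eqv W x y)}.
Proof. by eexists. Qed.

Definition pmeet V W : part := sval (pmeet_subproof V W).

Lemma pmeetE V W : pmeet V W = mkpart (fun x y => eqv V x y && eqv W x y).
Proof. exact: (svalP (pmeet_subproof V W)). Qed.

Lemma eqv_pmeet V W x y :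
  eqv (blocks (pmeet V W)) x y = eqv V x y && eqv W x y.
Proof. by rewrite pmeetE eqv_mkpart //; apply: pmeet_equivalence. Qed.

Lemma finer_pmeet V W U :
  finer U (blocks (pmeet V W)) = finer U V && finer U W.
Proof.
apply/finerP/andP => [h|[/finerP h1 /finerP h2] x y xy].
  by split; apply/finerP => x y /h; rewrite eqv_pmeet => /andP[].
by rewrite eqv_pmeet h1 ?h2.
Qed.

Lemma finer_pmeetl V W : finer (pmeet V W) V.
Proof. by have := finer_refl (pmeet V W); rewrite [finer _ (pmeet _ _)]finer_pmeet => /andP[]. Qed.
Lemma finer_pmeetr V W : finer (pmeet V W) W.
Proof. by have := finer_refl (pmeet V W); rewrite [finer _ (pmeet _ _)]finer_pmeet => /andP[]. Qed.

(* The two blocks are {k} and T \ {k}: V refines this partition iff {k} is a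
   block of V. *)
Lemma isolate_subproof (k : T) : {U : part | U = mkpart (fun x y => (x == k) == (y == k))}.
Proof. by eexists. Qed.

Definition isolate (k : T) : part := sval (isolate_subproof k).

Lemma isolateE (k : T) : isolate k = mkpart (fun x y => (x == k) == (y == k)).
Proof. exact: (svalP (isolate_subproof k)). Qed.

Lemma eqv_isolate k x y : eqv (blocks (isolate k)) x y = ((x == k) == (y == k)).
Proof. by rewrite isolateE eqv_mkpart // => a b c; split=> // /eqP->. Qed.

Definition lone k V := finer V (blocks (isolate k)).

Lemma loneP k V : reflect (forall m, eqv V k m -> m = k) (lone k V).
Proof.
apply: (iffP (finerP _ _)) => [h m /h|h x y xy]; rewrite eqv_isolate.
  by rewrite eqxx => /eqP /esym/eqP.
have [xk|xk] := eqVneq x k; first by rewrite xk in xy; rewrite (h _ xy) eqxx.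
have [yk|//] := eqVneq y k.
by rewrite yk eqv_sym in xy; rewrite (h _ xy) eqxx in xk.
Qed.

Lemma lone_pj k V W : lone k (pj V W) = lone k V && lone k W.
Proof. exact: finer_pj. Qed.

Definition nblocks V := #|blocks V|.

(** Sending a block of V to the block of W that contains it maps onto the blocks of W. *)
Lemma finer_card V W : finer V W -> nblocks W <= nblocks V.
Proof.
rewrite /nblocks => /finerP h.
pose f (A : {set T}) := if [pick x in A] is Some x then pblock W x else set0.
suff s : blocks W \subset [set f A | A in blocks V].
  by apply: leq_trans (subset_leq_card s) (leq_imset_card _ _).
apply/subsetP => B WB; have [x eB] := part_block WB.
apply/imsetP; exists (pblock V x); first exact: pblock_part.
rewrite /f; case: pickP => [y /= xy|/(_ x)]; last first.
  by have := eqv_refl V x; rewrite /eqv => ->.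
by have := h _ _ xy; rewrite eB eqv_pblock => /eqP.
Qed.

Lemma pcyc_subproof (s : {perm T}) : {U : part | U = mkpart (fun x y => y \in porbit s x)}.
Proof. by eexists. Qed.

Definition pcyc (s : {perm T}) : part := sval (pcyc_subproof s).

Lemma pcycE (s : {perm T}) : pcyc s = mkpart (fun x y => y \in porbit s x).
Proof. exact: (svalP (pcyc_subproof s)). Qed.

Lemma porbit_equivalence (s : {perm T}) :
  equivalence_rel (fun x y => y \in porbit s x).
Proof.
move=> x y z; rewrite porbit_id; split=> // xy.
by move: xy; rewrite -!(eq_porbit_mem s) ![_ == porbit s x]eq_sym => /eqP->; rewrite eq_sym.
Qed.

Lemma val_pcyc (s : {perm T}) : blocks (pcyc s) = porbits s.
Proof.
rewrite pcycE mkpartE; last exact: porbit_equivalence.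
apply/setP=> A; apply/imsetP/imsetP => -[x _ ->]; exists x => //;
  by apply/setP=> y; rewrite !inE.
Qed.

Lemma eqv_pcyc (s : {perm T}) x y : eqv (blocks (pcyc s)) x y = (y \in porbit s x).
Proof. by rewrite pcycE eqv_mkpart //; apply: porbit_equivalence. Qed.

Lemma finer_pcycP (s : {perm T}) V :
  reflect (forall x, eqv V x (s x)) (finer (blocks (pcyc s)) V).
Proof.
apply: (iffP (finerP _ _)) => [h x|h x y].
  by apply: h; rewrite eqv_pcyc (mem_porbit s 1).
rewrite eqv_pcyc => /porbitP[i ->]; elim: i => [|i IH].
  by rewrite expg0 perm1 eqv_refl.
by rewrite expgSr permM; apply: eqv_trans IH (h _).
Qed.

(** For x != y the cycles of [tperm x y] form an atom of the partition lattice; merging two blocks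
    is the join with such an atom. *)
Lemma finer_tperm x y V : finer (blocks (pcyc (tperm x y))) V = eqv V x y.
Proof.
apply/finer_pcycP/idP => [/(_ x)|h z]; first by rewrite tpermL.
case: tpermP => [->|->|_ _] //; [by rewrite eqv_sym|exact: eqv_refl].
Qed.

Lemma finer_pcycM (s t : {perm T}) V : finer (blocks (pcyc s)) V ->
  finer (blocks (pcyc t)) V -> finer (blocks (pcyc (s * t)%g)) V.
Proof.
move=> /finer_pcycP h1 /finer_pcycP h2; apply/finer_pcycP => x.
by rewrite permM; apply: eqv_trans (h1 x) (h2 _).
Qed.

Lemma pcycV (s : {perm T}) : pcyc s^-1 = pcyc s.
Proof. by apply: eqv_inj => x y; rewrite !eqv_pcyc porbitV. Qed.

Lemma finer_pcyc1 V : finer (blocks (pcyc 1)) V.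
Proof. by apply/finer_pcycP => x; rewrite perm1 eqv_refl. Qed.

Lemma card_pcyc1 : nblocks (pcyc 1) = #|T|.
Proof.
rewrite /nblocks val_pcyc card_imset ?cardT // => x y /setP/(_ y).
by rewrite porbit_id => /porbitP[i ->]; rewrite expg1n perm1.
Qed.

Lemma merge_partition V x y : ~~ eqv V x y ->
  partition ((pblock V x :|: pblock V y) |: ((blocks V :\ pblock V x) :\ pblock V y)) [set: T].
Proof.
move=> nxy; set A := pblock V x; set B := pblock V y.
have VA : A \in blocks V by apply: pblock_part.
have VB : B \in blocks V :\ A by rewrite !inE pblock_part andbT eq_sym -eqv_pblock.
have p2 := partitionD1 (partitionD1 (part_partition V) VA) VB.
have := partitionU1 (B := A :|: B) p2.
rewrite (_ : (A :|: B) :|: _ = [set: T]); last first.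
  by apply/setP => z; rewrite !inE; case: (z \in A); case: (z \in B).
apply; first by apply/set0Pn; exists x; rewrite inE; apply/orP; left; apply: eqv_refl.
by rewrite -setI_eq0; apply/eqP/setP => z; rewrite !inE;
  case: (z \in A); case: (z \in B).
Qed.

Lemma blocks_merge V x y : ~~ eqv V x y -> blocks (pj V (pcyc (tperm x y))) =
  (pblock V x :|: pblock V y) |: ((blocks V :\ pblock V x) :\ pblock V y).
Proof.
move=> /merge_partition p; set A := pblock V x in p *; set B := pblock V y in p *.
pose W : part := @exist _ (fun P => partition P [set: T]) _ p.
rewrite -[RHS]/(blocks W); congr blocks.
have WAB : A :|: B \in blocks W by apply: setU11.
apply: finer_anti.
  rewrite finer_pj finer_tperm; apply/andP; split.
    apply/forall_inP => C VC; apply/exists_inP.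
    have [->|nA] := eqVneq C A; first by exists (A :|: B); rewrite ?subsetUl.
    have [->|nB] := eqVneq C B; first by exists (A :|: B); rewrite ?subsetUr.
    by exists C; rewrite ?subxx // /= !inE nA nB VC orbT.
  rewrite (eqv_block _ WAB); first by rewrite inE [_ \in B]eqv_refl orbT.
  by rewrite inE [_ \in A]eqv_refl.
set J := pj _ _.
have VJ : finer V J := finer_pjl _ _.
have xyJ : eqv J x y by rewrite -finer_tperm finer_pjr.
apply/forall_inP => C; rewrite !inE => /orP[/eqP->|/and3P[_ _ VC]]; last first.
  by move/forall_inP: VJ; apply.
apply/exists_inP; exists (pblock J x); first exact: pblock_part.
move/finerP: VJ => VJ.
apply/subsetP => z; rewrite inE => /orP[/VJ//|/VJ]; exact: eqv_trans.
Qed.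

Lemma merge_notin V x y :
  pblock V x :|: pblock V y \notin (blocks V :\ pblock V x) :\ pblock V y.
Proof.
apply/negP; rewrite !inE => /and3P[_ /eqP nA VAB]; apply: nA.
by rewrite -(def_pblock (part_triv V) VAB (x := x)) // inE [_ \in pblock V x]eqv_refl.
Qed.

Lemma card_merge V x y :
  nblocks V = (nblocks (pj V (pcyc (tperm x y))) + nat_of_bool (~~ eqv V x y))%N.
Proof.
have [xy|nxy] /= := boolP (eqv V x y).
  by rewrite addn0 pjC pj_idl // finer_tperm.
rewrite /nblocks blocks_merge // cardsU1 merge_notin add1n (cardsD1 (pblock V x)).
rewrite pblock_part (cardsD1 (pblock V y) (blocks V :\ _)) !inE pblock_part.
by rewrite eq_sym -eqv_pblock nxy addn1.
Qed.

Lemma eqv_merge V x y a b : eqv (blocks (pj V (pcyc (tperm x y)))) a b =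
  eqv V a b || (eqv V x a || eqv V y a) && (eqv V x b || eqv V y b).
Proof.
set J := pj _ _; have /finerP VJ : finer V J := finer_pjl _ _.
have xyJ : eqv J x y by rewrite -finer_tperm finer_pjr.
pose S a := eqv V x a || eqv V y a.
have SJ c : S c -> eqv J x c.
  by case/orP=> [/VJ//|/VJ]; apply: eqv_trans.
have VS c c' : eqv V c c' -> S c = S c'.
  by rewrite /S !eqv_pblock => /eqP->.
apply/idP/orP => [|[/VJ//|/andP[/SJ h1 /SJ h2]]]; last first.
  by apply: eqv_trans h2; rewrite eqv_sym.
have eR : equivalence_rel (fun a b => eqv V a b || S a && S b).
  apply/equivalence_relP; split=> [c|c c' h d]; first by rewrite eqv_refl.
  case/orP: h => [h|/andP[s s']]; last first.
    have [_|nS] := boolP (S d); rewrite ?s ?s' ?andbF ?orbT ?orbF //.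
    have n e : S e -> eqv V e d = false by move=> Se; apply: contraNF nS => /VS <-.
    by rewrite !n.
  by rewrite (VS _ _ h) !eqv_pblock (eqP (etrans (esym (eqv_pblock V c c')) h)).
pose U := mkpart (fun a b => eqv V a b || S a && S b).
have /finerP JU : finer J (blocks U).
  rewrite finer_pj finer_tperm eqv_mkpart // /S !eqv_refl orbT orbT.
  by apply/andP; split=> //; apply/finerP => c d cd; rewrite eqv_mkpart // cd.
by move/JU; rewrite eqv_mkpart // => /orP.
Qed.

(* Enlarge X to W one merge at a time: each costs at most one block of the join. *)
Lemma card_pj_mono V X W : finer X W ->
  nblocks (pj V X) + nblocks W <= nblocks (pj V W) + nblocks X.
Proof.
have [m hm] := ubnP (nblocks X - nblocks W); elim: m X hm => // m IH X hm XW.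
have le := finer_card XW.
have [WX|] := boolP (finer W X); first by rewrite (finer_anti XW WX).
rewrite /finer negb_forall_in => /exists_inP[B WB nB].
have [x eB] := part_block WB.
have : ~~ (B \subset pblock X x).
  by apply: contra nB => h; apply/exists_inP; exists (pblock X x) => //;
    apply: pblock_part.
move=> /subsetPn[y By nxy].
have xy : eqv W x y by rewrite /eqv -eB.
pose X' := pj X (pcyc (tperm x y)).
have X'W : finer X' W by rewrite finer_pj XW finer_tperm.
have c := card_merge X x y; rewrite [eqv _ _ _](negbTE nxy) /= -/X' in c.
have := card_merge (pj V X) x y; rewrite -pjA -/X' => c2.
have le2 := finer_card X'W.
have le' : nblocks X' - nblocks W < m. clear -hm c le le2. lia.
have := IH _ le' X'W.
move=> IH'; have := leq_b1 (~~ eqv (blocks (pj V X)) x y); clear -c c2 IH'; lia.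
Qed.

(* The triangle inequality for the length of partitioned permutations, by
   removing from s a transposition at a time. *)
Lemma card_pcyc_mul (s p : {perm T}) V : finer (blocks (pcyc p)) V ->
  2 * nblocks V + nblocks (pcyc s) + nblocks (pcyc (s * p)%g) <=
  #|T| + 2 * nblocks (pj V (pcyc s)) + nblocks (pcyc p).
Proof.
move=> pV; have [m hm] := ubnP (#|T| - nblocks (pcyc s)).
elim: m s hm => // m IH s hm.
have [->|ns] := eqVneq s 1%g.
  by rewrite mul1g card_pcyc1 pjC pj_idl ?finer_pcyc1 //; lia.
have [x nx] : exists x, s x != x.
  apply/existsP; apply: contraR ns; rewrite negb_exists => /forallP h.
  by apply/eqP/permP => x; rewrite perm1; apply/eqP; have := h x; rewrite negbK.
set y := s x; set t := tperm x y; pose s' := (t * s)%g.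
have es : s = (t * s')%g by rewrite /s' mulgA tperm2 mul1g.
have := porbits_mul_tperm s x y; rewrite /= eq_sym nx.
have -> : x \in porbit s y by rewrite porbit_sym (mem_porbit s 1).
rewrite -!val_pcyc -/(nblocks _) -/(nblocks _) -/t -/s' /= => c.
have /IH {}IH : #|T| - nblocks (pcyc s') < m.
  by have := finer_card (finer_pcyc1 (pcyc s')); rewrite card_pcyc1; lia.
have := porbits_mul_tperm (s' * p)%g x y; rewrite /= -/t mulgA -es eq_sym nx.
rewrite -!val_pcyc -/(nblocks _) -/(nblocks _) => c2.
have le : nblocks (pj (pj V (pcyc s')) (pcyc t)) <= nblocks (pj V (pcyc s)).
  apply: finer_card; rewrite finer_pj -pjA finer_pjl /=.
  apply: finer_trans (finer_pjr _ _); rewrite es.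
  by apply: finer_pcycM; [apply: finer_pjr|apply: finer_pjl].
have := card_merge (pj V (pcyc s')) x y; rewrite -/t => c3.
(* If x and y share a cycle of [s' * p], the product with t gains one cycle, which makes up for the
   one that s has less than [s'], and the join is unchanged. Otherwise both cycle counts drop by
   one, which pays twice for the block that the join may lose. *)
have [xy|nxy] /= := boolP (x \in porbit (s' * p)%g y); rewrite ?xy ?nxy /= in c2.
  have e : nblocks (pj (pj V (pcyc s')) (pcyc t)) = nblocks (pj V (pcyc s')).
    rewrite pjC pj_idl // finer_tperm eqv_sym.
    have /finerP : finer (blocks (pcyc (s' * p)%g)) (blocks (pj V (pcyc s'))).
      apply: finer_pcycM; first exact: finer_pjr.
      by apply: finer_trans pV _; apply: finer_pjl.
    by apply; rewrite eqv_pcyc.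
  have ar a b b' f f' d d' e' N : b' + 0 = b + 1 -> f + 0 = f' + 1 ->
      2 * a + b' + f' <= N + 2 * d' + e' -> d' <= d -> 2 * a + b + f <= N + 2 * d + e'.
    lia.
  by apply: ar c c2 IH _; rewrite -e.
have ar a b b' f f' d d' d'' (i : bool) e' N : b' + 0 = b + 1 -> f + 2 = f' + 1 ->
    2 * a + b' + f' <= N + 2 * d' + e' -> d'' <= d -> d' = d'' + i ->
    2 * a + b + f <= N + 2 * d + e'.
  by case: i; lia.
by apply: ar c c2 IH le c3.
Qed.

Lemma finer_card_eq V U : finer V U -> nblocks V = nblocks U -> V = U.
Proof.
move=> VU e; apply: finer_anti => //; apply/finerP => x y xy.
apply: contraT => nxy; have := card_merge V x y; rewrite nxy /= => c.
have := @finer_card (pj V (pcyc (tperm x y))) U.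
by rewrite finer_pj VU finer_tperm xy => /(_ isT); lia.
Qed.

Lemma lone_pcyc (s : {perm T}) k : lone k (pcyc s) = (s k == k).
Proof.
apply/loneP/eqP => [h|h m].
  by apply: h; rewrite eqv_pcyc (mem_porbit s 1).
rewrite eqv_pcyc => /porbitP[i ->]; elim: i => [|i IH]; first by rewrite perm1.
by rewrite expgSr permM IH.
Qed.

Lemma pmeet_isolate_merge U k m : m != k -> eqv U k m ->
  pj (pmeet U (isolate k)) (pcyc (tperm k m)) = U.
Proof.
move=> mk km; set X := pmeet U (isolate k).
have XU : finer X U by apply: finer_pmeetl.
apply: finer_anti; first by rewrite finer_pj XU finer_tperm.
set J := pj _ _.
have XJ x y : eqv X x y -> eqv J x y by move: x y; apply/finerP; apply: finer_pjl.
have kmJ : eqv J k m by rewrite -finer_tperm finer_pjr.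
have step x : x != k -> eqv U k x -> eqv J k x.
  move=> xk kx; apply: eqv_trans kmJ _; apply: XJ.
  rewrite /X eqv_pmeet eqv_isolate (negbTE mk) (negbTE xk) eqxx andbT.
  by apply: eqv_trans kx; rewrite eqv_sym.
apply/finerP => x y xy.
have [xk|xk] := eqVneq x k.
  have [->|yk] := eqVneq y k; first by rewrite xk eqv_refl.
  by rewrite xk; apply: step => //; rewrite -xk.
have [yk|yk] := eqVneq y k.
  by rewrite yk eqv_sym; apply: step => //; rewrite -yk eqv_sym.
by apply: XJ; rewrite /X eqv_pmeet xy eqv_isolate (negbTE xk) (negbTE yk).
Qed.

(** If the merge is U, then X refines [pmeet U (isolate k)], and both have exactly one block more
    than U. *)
Lemma merge_lone U X k m : m != k -> eqv U k m -> lone k X ->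
  (pj X (pcyc (tperm k m)) == U) = (X == pmeet U (isolate k)).
Proof.
move=> mk km iX; apply/eqP/eqP => [e|->]; last exact: pmeet_isolate_merge.
have nX : ~~ eqv X k m by apply: contra mk => /(loneP _ _ iX) ->.
apply: finer_card_eq.
  by rewrite finer_pmeet [finer X (isolate k)]iX andbT -e finer_pjl.
have nY : ~~ eqv (pmeet U (isolate k)) k m.
  by rewrite eqv_pmeet km eqv_isolate eqxx (negbTE mk).
rewrite (card_merge X k m) (card_merge (pmeet U (isolate k)) k m) nX nY.
by rewrite e pmeet_isolate_merge.
Qed.

Lemma nblocks_cut U k m : m != k -> eqv U k m ->
  nblocks (pmeet U (isolate k)) = (nblocks U).+1.
Proof.
move=> mk km; rewrite (card_merge _ k m) pmeet_isolate_merge //.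
by rewrite eqv_pmeet km eqv_isolate eqxx (negbTE mk) /= addn1.
Qed.

(** Exchanging k with its predecessor before applying s makes k a fixed point and links the
    predecessor to [s k]: the cycle of k closes up without k. *)
Lemma nblocks_pcyc_cut (s : {perm T}) k : s k != k ->
  nblocks (pcyc (tperm k (s^-1%g k) * s)%g) = (nblocks (pcyc s)).+1.
Proof.
move=> sk; have := porbits_mul_tperm s k (s^-1%g k).
rewrite /nblocks !val_pcyc /= porbit_sym -porbitV (mem_porbit s^-1%g 1) addn0.
have -> : k != s^-1%g k.
  by apply: contra sk => /eqP e; rewrite {1}e permKV.
by rewrite addn1.
Qed.

Lemma cut_perm_fix (s : {perm T}) k : (tperm k (s^-1%g k) * s)%g k = k.
Proof. by rewrite permM tpermL permKV. Qed.

End Partitions.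

(** * Length, product and convolution of partitioned permutations *)

Section PartitionedPermutations.
Variable n : nat.
Implicit Types x y z : pperm n.

Lemma pp_partition x : partition (pp_part x) [set: 'I_n].
Proof. by case/andP: (valP x). Qed.

Definition ppv x : part 'I_n := @exist _ (fun P => partition P [set: 'I_n]) _ (pp_partition x).

Lemma blocks_ppv x : blocks (ppv x) = pp_part x. Proof. by []. Qed.

Lemma ppv_perm x : finer (pcyc (pp_perm x)) (ppv x).
Proof. by rewrite val_pcyc; case/andP: (valP x). Qed.

Lemma mkpp_subproof (V : part 'I_n) (s : 'S_n) : finer (pcyc s) V -> is_pperm (blocks V, s).
Proof. by move=> h; rewrite /is_pperm part_partition -val_pcyc. Qed.

Definition mkpp (V : part 'I_n) (s : 'S_n) (h : finer (pcyc s) V) : pperm n :=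
  @exist _ (@is_pperm n) _ (mkpp_subproof h).

Lemma ppv_mkpp V s h : ppv (@mkpp V s h) = V. Proof. exact: val_inj. Qed.
Lemma perm_mkpp V s h : pp_perm (@mkpp V s h) = s. Proof. by []. Qed.

Lemma pp_inj x y : ppv x = ppv y -> pp_perm x = pp_perm y -> x = y.
Proof.
move=> e1 e2; apply: val_inj; rewrite [LHS]surjective_pairing [RHS]surjective_pairing.
by congr pair => //; have := congr1 (@blocks _) e1.
Qed.

Lemma ppmul_subproof x y :
  finer (pcyc (pp_perm y * pp_perm x)%g) (pj (ppv x) (ppv y)).
Proof.
apply: finer_pcycM.
  by apply: finer_trans (ppv_perm y) _; apply: finer_pjr.
by apply: finer_trans (ppv_perm x) _; apply: finer_pjl.
Qed.

Definition ppmul x y := mkpp (ppmul_subproof x y).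

Lemma ppv_prod x y : ppv (ppmul x y) = pj (ppv x) (ppv y).
Proof. exact: ppv_mkpp. Qed.

Lemma perm_prod x y : pp_perm (ppmul x y) = (pp_perm y * pp_perm x)%g.
Proof. by []. Qed.

Lemma ppmulA x y z : ppmul x (ppmul y z) = ppmul (ppmul x y) z.
Proof.
by apply: pp_inj; rewrite ?ppv_prod ?perm_prod ?pjA ?mulgA.
Qed.

Lemma pp_lenE x :
  pp_len x = (n%:Z - 2 * (nblocks (ppv x))%:Z + (nblocks (pcyc (pp_perm x)))%:Z)%R.
Proof.
rewrite /pp_len -[#|pp_part x|]/(nblocks (ppv x)) -val_pcyc -/(nblocks _).
by move: (nblocks _) (nblocks _) => a b; lia.
Qed.

(** [card_pcyc_mul] is the case where the partition of y consists of the cycles of y; enlarging it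
    to [ppv y] is paid for by [card_pj_mono]. *)
Lemma pp_len_prod x y : (pp_len (ppmul x y) <= pp_len x + pp_len y)%R.
Proof.
rewrite !pp_lenE ppv_prod perm_prod.
have := card_pcyc_mul (pp_perm y) (ppv_perm x); rewrite card_ord.
have := card_pj_mono (ppv x) (ppv_perm y).
have ar (a b c d e f g : nat) : d + b <= g + f ->
  2 * a + f + e <= n + 2 * d + c ->
  (n%:Z - 2 * g%:Z + e%:Z <= n%:Z - 2 * a%:Z + c%:Z + (n%:Z - 2 * b%:Z + f%:Z))%R.
  by lia.
exact: ar.
Qed.

Lemma pp_mulE x y z : pp_mul x y z =
  (z == ppmul x y) && (pp_len x + pp_len y == pp_len (ppmul x y))%R.
Proof.
rewrite /pp_mul; apply/and3P/andP => [[/eqP e1 /eqP e2 /eqP e3]|[/eqP-> /eqP e]].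
  have -> : z = ppmul x y.
    apply: pp_inj; rewrite ?ppv_prod ?perm_prod //.
    by apply: val_inj; rewrite [LHS]e1; exact/esym/val_pj.
  rewrite eqxx; split=> //; apply/eqP; rewrite e3 /pp_len e1 e2 perm_prod.
  by rewrite -!blocks_ppv ppv_prod val_pj.
by rewrite -!blocks_ppv ppv_prod val_pj perm_prod e.
Qed.

Definition ppcyc (s : 'S_n) := mkpp (finer_refl (pcyc s)).

Lemma pp_len_cyc s : pp_len (ppcyc s) = (n%:Z - (nblocks (pcyc s))%:Z)%R.
Proof. by rewrite pp_lenE ppv_mkpp perm_mkpp; lia. Qed.

Lemma ppv1 : blocks (ppv (ppcyc 1)) = [set [set i] | i in [set: 'I_n]].
Proof.
have e (i : 'I_n) : porbit 1 i = [set i].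
  apply/setP=> j; rewrite inE; apply/porbitP/eqP => [[m ->]|->].
    by rewrite expg1n perm1.
  by exists 0%N; rewrite perm1.
rewrite ppv_mkpp val_pcyc; apply/setP=> A.
by apply/imsetP/imsetP => -[i _ ->]; exists i; rewrite ?e.
Qed.

Lemma ppmul1 x : ppmul x (ppcyc 1) = x.
Proof.
apply: pp_inj; rewrite ?ppv_prod ?perm_prod ?ppv_mkpp ?perm_mkpp ?mul1g //.
by rewrite pjC pj_idl // finer_pcyc1.
Qed.

Lemma pp_len1 : pp_len (ppcyc 1) = 0%R.
Proof. by rewrite pp_len_cyc card_pcyc1 card_ord subrr. Qed.

Variable C : comNzRingType.
Implicit Types f g h : pperm n -> C.
Local Open Scope ring_scope.

Lemma pp_convE f g z :
  pp_conv f g z = \sum_x \sum_y (pp_mul x y z)%:R * (f x * g y).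
Proof.
apply: eq_bigr => x _; rewrite big_mkcond; apply: eq_bigr => y _.
by case: ifP => _; rewrite ?mul1r ?mul0r.
Qed.

Lemma sum_pp_mul x y (F : pperm n -> C) : \sum_w (pp_mul x y w)%:R * F w =
  (pp_len x + pp_len y == pp_len (ppmul x y))%:R * F (ppmul x y).
Proof.
rewrite (bigD1 (ppmul x y)) // big1 => [|w nw]; last first.
  by rewrite pp_mulE (negbTE nw) mul0r.
by rewrite pp_mulE eqxx andTb [LHS]addr0.
Qed.

(** By subadditivity of the length, either bracketing is defined exactly when the three lengths add
    up to that of the total product. *)
Lemma pp_mulA x y v z :
  \sum_w (pp_mul x y w)%:R * (pp_mul w v z)%:R =
  \sum_w (pp_mul y v w)%:R * (pp_mul x w z)%:R :> C.
Proof.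
rewrite !sum_pp_mul !pp_mulE -!natrM !mulnb ppmulA; congr (_%:R : C).
congr nat_of_bool; case: (z == _); rewrite ?andbF //=.
have := pp_len_prod x y; have := pp_len_prod (ppmul x y) v.
have := pp_len_prod y v; have := pp_len_prod x (ppmul y v); rewrite ppmulA.
move: (pp_len _) (pp_len _) (pp_len _) (pp_len _) (pp_len _) (pp_len _).
move=> a b c d e f h1 h2 h3 h4.
by apply/andP/andP => -[/eqP e1 /eqP e2]; split; apply/eqP; lia.
Qed.

Lemma pp_convA f g h : pp_conv f (pp_conv g h) =1 pp_conv (pp_conv f g) h.
Proof.
move=> z; rewrite [LHS]pp_convE [RHS]pp_convE.
transitivity (\sum_x \sum_y \sum_v
    (\sum_w (pp_mul y v w)%:R * (pp_mul x w z)%:R) * (f x * g y * h v)).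
  apply: eq_bigr => x _.
  transitivity (\sum_w \sum_y \sum_v
      (pp_mul y v w)%:R * (pp_mul x w z)%:R * (f x * g y * h v)).
    apply: eq_bigr => w _; rewrite pp_convE !mulr_sumr; apply: eq_bigr => y _.
    by rewrite !mulr_sumr; apply: eq_bigr => v _; ring.
  rewrite exchange_big; apply: eq_bigr => y _.
  rewrite exchange_big; apply: eq_bigr => v _.
  by rewrite mulr_suml.
transitivity (\sum_x \sum_y \sum_v \sum_w
    (pp_mul x y w)%:R * (pp_mul w v z)%:R * (f x * g y * h v)).
  by do 3![apply: eq_bigr => ? _]; rewrite -pp_mulA mulr_suml.
transitivity (\sum_w \sum_v \sum_x \sum_y
    (pp_mul x y w)%:R * (pp_mul w v z)%:R * (f x * g y * h v)); last first.
  apply: eq_bigr => w _; apply: eq_bigr => v _; rewrite pp_convE mulr_suml mulr_sumr.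
  apply: eq_bigr => x _; rewrite mulr_suml mulr_sumr.
  by apply: eq_bigr => y _; ring.
symmetry.
rewrite (eq_bigr _ (fun w _ => exchange_big _ _ _ _ _ _)) exchange_big.
apply: eq_bigr => x _.
rewrite (eq_bigr _ (fun w _ => exchange_big _ _ _ _ _ _)) exchange_big.
apply: eq_bigr => y _; exact: exchange_big.
Qed.

Lemma pp_conv_delta f : pp_conv f (@pp_delta C n) =1 f.
Proof.
have dE y : @pp_delta C n y = (y == ppcyc 1)%:R.
  rewrite /pp_delta; congr (_%:R : C); congr nat_of_bool.
  apply/andP/eqP => [[/eqP e1 /eqP e2]|->]; last by rewrite -blocks_ppv ppv1.
  by apply: pp_inj; rewrite ?perm_mkpp //; apply: val_inj; rewrite [RHS]ppv1.
move=> z; rewrite pp_convE (bigD1 z) //= [X in X + _](bigD1 (ppcyc 1)) //=.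
rewrite pp_mulE ppmul1 pp_len1 addr0 !eqxx dE eqxx mul1r mulr1.
rewrite big1 => [|y ny]; last by rewrite dE (negbTE ny) !mulr0.
rewrite big1 ?addr0 // => x nx; rewrite (bigD1 (ppcyc 1)) //=.
rewrite pp_mulE ppmul1 eq_sym (negbTE nx) mul0r add0r.
by rewrite big1 // => y ny; rewrite dE (negbTE ny) !mulr0.
Qed.

Lemma eq_pp_conv f f' g g' : f =1 f' -> g =1 g' -> pp_conv f g =1 pp_conv f' g'.
Proof.
by move=> ef eg z; apply: eq_bigr => x _; apply: eq_bigr => y _; rewrite ef eg.
Qed.

(** [pp_zeta] lives on the pairs (0_s, s), and x . (0_s, s) = z determines s from x and z:
    convolution with [pp_zeta] is a plain sum over the x satisfying this condition. *)
Definition zeta_div x z :=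
  (pj (ppv x) (pcyc (pp_perm z * (pp_perm x)^-1)%g) == ppv z) &&
  (pp_len x + (n%:Z - (nblocks (pcyc (pp_perm z * (pp_perm x)^-1)%g))%:Z) == pp_len z).

Lemma pp_zetaE x : @pp_zeta C n x = (x == ppcyc (pp_perm x))%:R.
Proof.
rewrite /pp_zeta; congr (_%:R : C); congr nat_of_bool.
apply/eqP/eqP => [e|{1}->]; last by rewrite -blocks_ppv ppv_mkpp val_pcyc.
by apply: pp_inj; rewrite ?perm_mkpp // ppv_mkpp; apply: val_inj;
  rewrite [LHS]e -val_pcyc.
Qed.

Lemma pp_mul_cyc x z s : pp_mul x (ppcyc s) z =
  (s == (pp_perm z * (pp_perm x)^-1)%g) && zeta_div x z.
Proof.
rewrite pp_mulE pp_len_cyc /zeta_div.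
apply/andP/and3P => [[/eqP-> /eqP e]|[/eqP-> /eqP e1 /eqP e2]].
  by rewrite ppv_prod perm_prod ppv_mkpp perm_mkpp mulgK !eqxx e.
have ez : z = ppmul x (ppcyc (pp_perm z * (pp_perm x)^-1)%g).
  by apply: pp_inj; rewrite ?ppv_prod ?perm_prod ?ppv_mkpp ?perm_mkpp ?mulgKV.
by rewrite -ez eqxx e2 eqxx.
Qed.

Lemma pp_conv_zeta f z : pp_conv f (@pp_zeta C n) z = \sum_(x | zeta_div x z) f x.
Proof.
rewrite pp_convE [RHS]big_mkcond; apply: eq_bigr => x _.
set s := (pp_perm z * (pp_perm x)^-1)%g.
rewrite (bigD1 (ppcyc s)) //= pp_mul_cyc -/s eqxx /=.
rewrite big1 ?addr0 => [|y ny].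
  by rewrite pp_zetaE perm_mkpp eqxx mulr1; case: ifP; rewrite ?mul1r ?mul0r.
rewrite pp_zetaE; case: eqVneq => [e|_]; last by rewrite !mulr0.
rewrite e pp_mul_cyc -/s; case: eqVneq => [e2|_]; last by rewrite mul0r.
by case/negP: ny; rewrite e e2.
Qed.

Lemma cutpp_subproof k z :
  finer (pcyc (tperm k ((pp_perm z)^-1%g k) * pp_perm z)%g)
        (pmeet (ppv z) (isolate k)).
Proof.
rewrite finer_pmeet [X in _ && X]lone_pcyc cut_perm_fix eqxx andbT.
apply: finer_pcycM; last exact: ppv_perm.
rewrite finer_tperm; have /finer_pcycP : finer (pcyc (pp_perm z)^-1%g) (ppv z).
  by rewrite pcycV ppv_perm.
exact.
Qed.

(* Splits k off its block and takes it out of its cycle. *)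
Definition cutpp k z := mkpp (cutpp_subproof k z).

(** As x fixes k, the quotient s of z by x moves k and maps the z-predecessor of k to k. Cutting k
    out of z cuts it out of s, and both lengths drop by one. *)
Lemma zeta_div_cut k x z : lone k (ppv x) -> pp_perm z k != k ->
  zeta_div x (cutpp k z) = zeta_div x z.
Proof.
move=> ix zk; rewrite /zeta_div ppv_mkpp !pp_lenE ppv_mkpp !perm_mkpp.
set g := pp_perm z; set r := pp_perm x; set m := g^-1%g k; set t := tperm k m.
have mk : m != k by apply: contra zk => /eqP e; rewrite -{1}e permKV.
have km : eqv (ppv z) k m.
  have /finer_pcycP : finer (pcyc g^-1%g) (ppv z) by rewrite pcycV ppv_perm.
  exact.
have rk : r k = k.
  by apply/eqP; rewrite -lone_pcyc; apply: finer_trans (ppv_perm x) ix.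
have rVk : r^-1%g k = k by rewrite -{1}rk permK.
set s := (g * r^-1)%g.
have sm : s m = k by rewrite permM permKV.
have sVk : s^-1%g k = m by rewrite -sm permK.
have sk : s k != k.
  by apply: contra mk => /eqP e; rewrite -sVk -{1}e permK.
have -> : ((t * g) * r^-1 = t * s)%g by rewrite mulgA.
have ct : nblocks (pcyc (t * s)%g) = (nblocks (pcyc s)).+1.
  by rewrite /t -sVk nblocks_pcyc_cut.
have cg : nblocks (pcyc (t * g)%g) = (nblocks (pcyc g)).+1.
  by rewrite nblocks_pcyc_cut.
rewrite ct cg (nblocks_cut mk km) -(merge_lone mk km) //; last first.
  by rewrite lone_pj ix lone_pcyc permM tpermL sm eqxx.
have -> : pj (pj (ppv x) (pcyc (t * s)%g)) (pcyc t) = pj (ppv x) (pcyc s).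
  have ht : finer (pcyc t) (pj (ppv x) (pcyc s)).
    apply: finer_trans (finer_pjr _ _); rewrite finer_tperm eqv_sym eqv_pcyc.
    by rewrite -{1}sm (mem_porbit s 1).
  apply: finer_anti.
    rewrite 2!finer_pj finer_pjl ht andbT /=.
    by apply: finer_pcycM ht _; apply: finer_pjr.
  rewrite finer_pj; apply/andP; split.
    by apply: finer_trans (finer_pjl _ _); apply: finer_pjl.
  have : finer (pcyc (t * (t * s))%g) (pj (pj (ppv x) (pcyc (t * s)%g)) (pcyc t)).
    apply: finer_pcycM; first exact: finer_pjr.
    by apply: finer_trans (finer_pjl _ _); apply: finer_pjr.
  by rewrite mulgA tperm2 mul1g.
congr (_ && _); lia.
Qed.

(* [f0], the restriction of [f * mu] to the k-lone partitioned
   permutations, satisfies [f0 * zeta = f], hence is all of [f * mu]. *)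
Lemma pp_conv_moebius_lone f mu k :
  pp_conv mu (@pp_zeta C n) = @pp_delta C n ->
  pp_conv (@pp_zeta C n) mu = @pp_delta C n ->
  (forall z, pp_perm z k = k -> ~~ lone k (ppv z) -> f z = 0) ->
  (forall z, pp_perm z k != k -> f z = f (cutpp k z)) ->
  forall x, ~~ lone k (ppv x) -> pp_conv f mu x = 0.
Proof.
move=> mz zm f1 f2 x nx.
pose f0 y := if lone k (ppv y) then pp_conv f mu y else 0.
have fz : pp_conv (pp_conv f mu) (@pp_zeta C n) =1 f.
  by move=> z; rewrite -pp_convA mz pp_conv_delta.
have iso z : lone k (ppv z) -> pp_conv f0 (@pp_zeta C n) z = f z.
  move=> iz; rewrite -fz !pp_conv_zeta; apply: eq_bigr => y /andP[/eqP e _].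
  by rewrite /f0 ifT //; apply: finer_trans iz; rewrite -e finer_pjl.
have f0z : pp_conv f0 (@pp_zeta C n) =1 f.
  move=> z; have [/iso//|nz] := boolP (lone k (ppv z)).
  have [zk|zk] := eqVneq (pp_perm z k) k.
    rewrite f1 // pp_conv_zeta big1 // => y /andP[/eqP e _].
    rewrite /f0; case: ifP => // iy; case/negP: nz; rewrite -e lone_pj iy.
    have yk : pp_perm y k = k.
      by apply/eqP; rewrite -lone_pcyc; apply: finer_trans (ppv_perm y) iy.
    by rewrite lone_pcyc permM zk -{1}yk permK eqxx.
  rewrite f2 // -iso; last first.
    by rewrite ppv_mkpp; apply: finer_pmeetr.
  rewrite !pp_conv_zeta big_mkcond [RHS]big_mkcond; apply: eq_bigr => y _.
  rewrite /f0; have [iy|] := boolP (lone k (ppv y)); last by rewrite !if_same.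
  by rewrite zeta_div_cut.
rewrite -(eq_pp_conv f0z (frefl mu)) -pp_convA zm pp_conv_delta.
by rewrite /f0 (negbTE nx).
Qed.

End PartitionedPermutations.

Local Open Scope ring_scope.

(** * Moebius inversion and cumulants *)

Section MoebiusInversion.
Variables (C : comNzRingType) (T : finType).
Implicit Types (U V : part T) (f g : part T -> C).

Lemma nblocks_le V : (nblocks V <= #|T|)%N.
Proof. by rewrite -card_pcyc1; apply: finer_card; apply: finer_pcyc1. Qed.

Lemma finer_lt V U : finer V U -> V != U -> (#|T| - nblocks V < #|T| - nblocks U)%N.
Proof.
move=> VU nVU; have le := finer_card VU.
have := nblocks_le V; have [/(finer_card_eq VU) e|ne] := eqVneq (nblocks V) (nblocks U).
  by rewrite e eqxx in nVU.
by lia.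
Qed.

(** The system is triangular: the term V = U is isolated, and the strictly finer V have more
    blocks. *)
Lemma moebius_unique f g :
  (forall U, \sum_(V : part T | finer V U) f V = \sum_(V : part T | finer V U) g V) -> f =1 g.
Proof.
move=> e U; have [m hm] := ubnP (#|T| - nblocks U)%N.
elim: m U hm => // m IH U hm.
have := e U; rewrite (bigD1 U) ?finer_refl //= [RHS](bigD1 U) ?finer_refl //=.
rewrite (eq_bigr g) => [/addIr//|V /andP[VU nVU]].
by apply: IH; have := finer_lt VU nVU; lia.
Qed.

Lemma moebius_exists f : exists g, forall U, f U = \sum_(V : part T | finer V U) g V.
Proof.
have [m mP] : exists m, forall U, (#|T| - nblocks U < m)%N.
  by exists #|T|.+1 => U; rewrite ltnS leq_subr.
suff [g gP] : exists g, forall U, (#|T| - nblocks U < m)%N ->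
    f U = \sum_(V : part T | finer V U) g V by exists g => U; apply: gP.
elim: {mP} m => [|m [g gP]]; first by exists (fun=> 0).
pose g' U := if (#|T| - nblocks U < m)%N then g U
  else f U - \sum_(V : part T | finer V U && (V != U)) g V.
exists g' => U; rewrite ltnS => leU.
have E : \sum_(V : part T | finer V U && (V != U)) g' V =
    \sum_(V : part T | finer V U && (V != U)) g V.
  apply: eq_bigr => V /andP[VU nVU]; rewrite /g' ifT //.
  exact: leq_trans (finer_lt VU nVU) leU.
rewrite (bigD1 U) ?finer_refl //= E {1}/g'; case: ifP => h; last by rewrite subrK.
by rewrite gP // (bigD1 U) ?finer_refl.
Qed.

(** The Moebius function of the partition lattice between a partition with m blocks and the
    one-block partition. *)
Definition moebius_coef (m : nat) : C := (-1) ^+ m.-1 * (m.-1)`!%:R.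

(** The cancellation behind [moebius_interval]: a partition with r + 1 blocks against the r ways to
    merge a fixed block with another one. *)
Lemma moebius_coefS r : (0 < r)%N ->
  moebius_coef r.+1 + r%:R * moebius_coef r = 0.
Proof.
case: r => // r _; rewrite /moebius_coef /= factS natrM exprS; ring.
Qed.

End MoebiusInversion.

(** * Cumulants of set functions *)

Section Cumulants.
Variables (C : comNzRingType).

(** The classical cumulant when [h D] is the expected product of the variables indexed by D. *)
Definition cum (T : finType) (h : {set T} -> C) (B : {set T}) : C :=
  \sum_(Q | partition Q B) moebius_coef C #|Q| * \prod_(D in Q) h D.

Section OneType.
Variable (T : finType).
Implicit Types (U V W X : part T) (h : {set T} -> C) (B D : {set T}).

Definition inside (W : {set {set T}}) B := [set D in W | D \subset B].

Lemma part_neq0 V B : B \in blocks V -> B != set0.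
Proof. by apply: contraTneq => ->; case/and3P: (part_partition V). Qed.

Lemma inside_partition W U B : finer W U -> B \in blocks U ->
  partition (inside W B) B.
Proof.
move=> WU UB; have /and3P[/eqP cW tW n0] := part_partition W.
apply/and3P; split.
- rewrite eqEsubset; apply/andP; split.
    by apply/bigcupsP => D; rewrite inE => /andP[].
  apply/subsetP => x Bx; apply/bigcupP; exists (pblock W x); last exact: eqv_refl.
  rewrite inE pblock_part /=; apply/subsetP => y xy.
  by rewrite -(eqv_block y UB Bx); move/finerP: WU; apply.
- by apply: trivIsetS tW; apply/subsetP => D; rewrite inE => /andP[].
- by rewrite inE (negbTE n0).
Qed.

Lemma bigcup_partition U (F : {set T} -> {set {set T}}) :
  (forall B, B \in blocks U -> partition (F B) B) ->
  partition (\bigcup_(B in blocks U) F B) [set: T].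
Proof.
move=> pF; apply/and3P; split.
- rewrite eqEsubset subsetT /=; apply/subsetP => x _.
  have UB := pblock_part U x; have pB := pF _ UB.
  have xB : x \in cover (F (pblock U x)).
    by rewrite (cover_partition pB); apply: eqv_refl.
  have /bigcupP[D FD xD] := xB.
  by apply/bigcupP; exists D => //; apply/bigcupP; exists (pblock U x).
- apply/trivIsetP => D D' /bigcupP[B UB FD] /bigcupP[B' UB' FD'] nD.
  have [e|nB] := eqVneq B B'.
    by case/and3P: (pF _ UB) => _ /trivIsetP t _; apply: t nD => //; rewrite e.
  have /trivIsetP t := part_triv U.
  apply: disjointWl (partitionS (pF _ UB) FD) _.
  by apply: disjointWr (partitionS (pF _ UB') FD') _; apply: t.
- by apply/negP => /bigcupP[B UB]; apply/negP; case/and3P: (pF _ UB).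
Qed.

Definition glue U (F : {set T} -> {set {set T}}) : part T :=
  insubd (part_discrete T) (\bigcup_(B in blocks U) F B).

Lemma blocks_glue U F : (forall B, B \in blocks U -> partition (F B) B) ->
  blocks (glue U F) = \bigcup_(B in blocks U) F B.
Proof. by move=> pF; apply: insubdK; apply: bigcup_partition. Qed.

Lemma inside_glue U F B : (forall B, B \in blocks U -> partition (F B) B) ->
  B \in blocks U -> inside (glue U F) B = F B.
Proof.
move=> pF UB; apply/setP => D; rewrite inE blocks_glue //.
apply/andP/idP => [[/bigcupP[B' UB' FD] DB]|FD]; last first.
  by split; [apply/bigcupP; exists B|apply: partitionS (pF _ UB) FD].
have D0 : D != set0 by apply: contraTneq FD => ->; case/and3P: (pF _ UB').
have /set0Pn[x xD] := D0.
have xB' := subsetP (partitionS (pF _ UB') FD) _ xD.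
have xB := subsetP DB _ xD.
by rewrite -(def_pblock (part_triv U) UB xB) (def_pblock (part_triv U) UB' xB').
Qed.

Lemma finer_glue U F : (forall B, B \in blocks U -> partition (F B) B) ->
  finer (glue U F) U.
Proof.
move=> pF; apply/forall_inP => D; rewrite blocks_glue // => /bigcupP[B UB FD].
by apply/exists_inP; exists B => //; apply: partitionS (pF _ UB) FD.
Qed.

Lemma glue_inside W U : finer W U -> glue U (inside W) = W.
Proof.
move=> WU; apply: val_inj; change (blocks (glue U (inside W)) = blocks W).
rewrite blocks_glue => [|B UB]; last exact: inside_partition WU UB.
apply/setP => D; apply/bigcupP/idP => [[B UB]|WD]; first by rewrite inE => /andP[].
by move/forall_inP: WU => /(_ _ WD)/exists_inP[B UB DB]; exists B; rewrite ?inE ?WD.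
Qed.

(** A partition finer than U is a choice of a partition of every block of U, with [inside] and
    [glue] as the two directions of the bijection. *)
Lemma prod_sum_partition U (G : {set T} -> {set {set T}} -> C) :
  \prod_(B in blocks U) \sum_(Q | partition Q B) G B Q =
  \sum_(W : part T | finer W U) \prod_(B in blocks U) G B (inside W B).
Proof.
rewrite (big_distr_big_dep set0) /=.
pose h (W : part T) : {ffun {set T} -> {set {set T}}} :=
  [ffun B => if B \in blocks U then inside W B else set0].
rewrite (reindex_onto h (fun f : {ffun _} => glue U f)) /=; last first.
  move=> f /pfamilyP[/supportP sf pf]; apply/ffunP => B; rewrite ffunE.
  by case: ifP => UB; [rewrite inside_glue|rewrite sf ?UB].
have hE W B : B \in blocks U -> h W B = inside W B by move=> UB; rewrite ffunE UB.
apply: eq_big => [W|W _]; last by apply: eq_bigr => B UB; rewrite hE.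
apply/andP/idP => [[/pfamilyP[_ pf] /eqP <-]|WU]; first exact: finer_glue.
have pW B : B \in blocks U -> partition (h W B) B.
  by move=> UB; rewrite hE //; apply: inside_partition WU UB.
split.
  apply/pfamilyP; split=> [|B UB]; last exact: pW.
  by apply/supportP => B /negbTE nB; rewrite ffunE nB.
apply/eqP; apply: val_inj; change (blocks (glue U (h W)) = blocks W).
rewrite blocks_glue // -[in RHS](glue_inside WU) blocks_glue => [|B UB].
  by apply: eq_bigr => B UB; rewrite hE.
exact: inside_partition WU UB.
Qed.

Lemma prod_inside W U h : finer W U ->
  \prod_(B in blocks U) \prod_(D in inside W B) h D = \prod_(D in blocks W) h D.
Proof.
move=> WU.
rewrite (exchange_big_dep (mem (blocks W))) /= => [|B D _]; last first.
  by rewrite inE => /andP[].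
apply: eq_bigr => D WD.
move/forall_inP: WU => /(_ _ WD)/exists_inP[B UB DB].
rewrite (big_pred1 B) // => B'; rewrite /= inE WD /=.
apply/andP/eqP => [[UB' DB']|->//].
have /set0Pn[x xD] := part_neq0 WD.
rewrite -(def_pblock (part_triv U) UB (subsetP DB _ xD)).
by rewrite (def_pblock (part_triv U) UB' (subsetP DB' _ xD)).
Qed.

Lemma inside_self U B : B \in blocks U -> inside U B = [set B].
Proof.
move=> UB; apply/setP => D; rewrite !inE; apply/andP/eqP => [[UD DB]|->//].
have /set0Pn[x xD] := part_neq0 UD.
rewrite -(def_pblock (part_triv U) UD xD).
exact: (def_pblock (part_triv U) UB (subsetP DB _ xD)).
Qed.

(* If x ~ z in U but not in V, let E be the block of x in V. The partitions W whose
   meet with {E, T \ E} is W0 are W0 itself and the joins of E with another block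
   of W0 inside the block of x in U; these contributions cancel. *)
Lemma moebius_interval V U : finer V U ->
  \sum_(W : part T | finer W U && finer V W)
     \prod_(B in blocks U) moebius_coef C #|inside W B| = (V == U)%:R.
Proof.
move=> VU; have [->|nVU] := eqVneq V U.
  rewrite (big_pred1 U) => [|W]; last first.
    by apply/andP/eqP => [[h1 h2]|->]; [exact: finer_anti|split; exact: finer_refl].
  rewrite big1 // => B UB; rewrite inside_self // cards1 /moebius_coef /=.
  by rewrite expr0 fact0 mul1r.
have [x [z xz nxz]] : exists x, exists2 z, eqv U x z & ~~ eqv V x z.
  have : ~~ finer U V by apply: contra nVU => UV; apply/eqP; apply: finer_anti.
  rewrite /finer negb_forall_in => /exists_inP[B UB nB]; have [x eB] := part_block UB.
  have /subsetPn[z zB nz] : ~~ (B \subset pblock V x).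
    by apply: contra nB => h; apply/exists_inP; exists (pblock V x); rewrite ?pblock_part.
  by exists x, z; rewrite // /eqv -eB.
pose iso := mkpart (fun a b => eqv V x a == eqv V x b).
have isoE a b : eqv (blocks iso) a b = (eqv V x a == eqv V x b).
  by rewrite eqv_mkpart // => ? ? ?; split=> // /eqP->.
have Viso : finer V iso.
  by apply/finerP => a b ab; rewrite isoE; apply/eqP; rewrite !eqv_pblock in ab *; rewrite (eqP ab).
rewrite (partition_big (fun W => pmeet W iso)
  (fun W0 : part T => [&& finer W0 U, finer V W0 & finer W0 iso])) /=; last first.
  move=> W /andP[WU VW]; rewrite finer_pmeet VW Viso finer_pmeetr /= andbT.
  exact: finer_trans (finer_pmeetl _ _) WU.
rewrite big1 // => W0 /and3P[W0U VW0 W0i].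
set B := pblock U x; have UB : B \in blocks U by apply: pblock_part.
set E := pblock W0 x; set R := inside W0 B :\ E.
have W0x a : eqv W0 x a = eqv V x a.
  apply/idP/idP => [/(finerP _ _ W0i)|/(finerP _ _ VW0)//].
  by rewrite isoE eqv_refl => /eqP<-.
pose rep D := odflt x [pick y in D].
pose M D := pj W0 (pcyc (tperm x (rep D))).
have repP D : D \in R -> [/\ pblock W0 (rep D) = D, eqv U x (rep D) & ~~ eqv V x (rep D)].
  rewrite !inE => /andP[nE /andP[WD DB]]; rewrite /rep; case: pickP => [y /= yD|D0]; last first.
    by have /set0Pn[y] := part_neq0 WD; rewrite [y \in D]D0.
  have eD := def_pblock (part_triv W0) WD yD.
  split=> //; first exact: (subsetP DB).
  by rewrite -W0x eqv_pblock eD eq_sym.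
have fib W : finer W U && finer V W && (pmeet W iso == W0) =
    (W == W0) || (W \in M @: R).
  apply/idP/orP => [/andP[/andP[WU VW] /eqP eW]|].
    have W0W : finer W0 W by rewrite -eW finer_pmeetl.
    have eqW a b : eqv W0 a b = eqv W a b && (eqv V x a == eqv V x b).
      by rewrite -eW eqv_pmeet isoE.
    have [Wi|nWi] := boolP (finer W iso).
      by left; apply/eqP; apply: finer_anti => //; rewrite -eW finer_pmeet finer_refl.
    have [y xy nxy] : exists2 y, eqv W x y & ~~ eqv V x y.
      apply/exists_inP; apply: contraR nWi; rewrite negb_exists_in => /forall_inP h.
      have all a : eqv W x a = eqv V x a.
        by apply/idP/idP => [/h|]; [rewrite negbK|apply/finerP].
      apply/finerP => a b ab; rewrite isoE -!all; apply/eqP.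
      by apply/idP/idP => h'; apply: eqv_trans h' _; rewrite // eqv_sym.
    set D := pblock W0 y.
    have RD : D \in R.
      rewrite !inE -eqv_pblock eqv_sym W0x nxy pblock_part; apply/subsetP => d.
      by move/(finerP _ _ W0U); apply: eqv_trans; move/finerP: WU; apply.
    have [eD _ nr] := repP _ RD; set r := rep D in eD nr.
    have yr : eqv W0 y r by rewrite eqv_pblock eD.
    have xr : eqv W x r by apply: eqv_trans xy _; apply: (finerP _ _ W0W).
    right; apply/imsetP; exists D => //; apply: finer_anti; last first.
      by rewrite finer_pj W0W finer_tperm.
    apply/finerP => a b ab; rewrite eqv_merge !W0x !eqW ab -/r (negbTE nr).
    have ra c : eqv W x c -> eqv W r c by apply: eqv_trans; rewrite eqv_sym.
    have xV c : eqv V x c -> eqv W x c by apply/finerP.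
    case: (boolP (eqv V x a)) => [/xV xa|_]; case: (boolP (eqv V x b)) => [/xV xb|_] //=.
      by rewrite ra //; apply: eqv_trans ab.
    by rewrite ra //; apply: eqv_trans xb _; rewrite eqv_sym.
  case=> [/eqP->|/imsetP[D /repP[eD xr nr] ->]].
    rewrite W0U VW0; apply/eqP; apply: finer_anti; first exact: finer_pmeetl.
    by rewrite finer_pmeet finer_refl.
  rewrite finer_pj W0U finer_tperm xr (finer_trans VW0 (finer_pjl _ _)) /=; apply/eqP.
  apply: finer_anti; last by rewrite finer_pmeet finer_pjl.
  apply/finerP => a b; rewrite eqv_pmeet eqv_merge isoE !W0x.
  have rV c : eqv W0 (rep D) c -> eqv V x c = false.
    by move/(finerP _ _ W0i); rewrite isoE (negbTE nr) => /eqP<-.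
  case/andP=> /orP[//|/andP[]] h1 h2 /eqP e; move: h1 h2.
  case: (boolP (eqv V x b)) e => [xb xa _ _|_ nxa /= ra rb].
    by rewrite -W0x eqv_sym in xa; apply: eqv_trans xa _; rewrite W0x.
  by rewrite nxa /= in ra; rewrite eqv_sym in ra; apply: eqv_trans ra rb.
have xM D : D \in R -> eqv (M D) x (rep D) by rewrite -finer_tperm finer_pjr.
have nW0 : W0 \notin M @: R.
  apply/imsetP => -[D RD e]; have := xM D RD; rewrite -e W0x.
  by have [_ _ /negbTE->] := repP D RD.
have Minj : {in R &, injective M}.
  move=> D1 D2 R1 R2 e; have [e1 _ _] := repP D1 R1; have [e2 _ n2] := repP D2 R2.
  have := xM D2 R2; rewrite -e eqv_merge W0x (negbTE n2) eqv_refl /= => r12.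
  by apply/eqP; rewrite -e1 -e2 -eqv_pblock.
rewrite (eq_bigl (fun W => W \in W0 |: M @: R)) => [|W]; last by rewrite in_setU1 -fib.
rewrite big_setU1 //= big_imset //=.
pose K := \prod_(B' in blocks U | B' != B) moebius_coef C #|inside W0 B'|.
have EB : E \in inside W0 B.
  by rewrite inE pblock_part; apply/subsetP => a; apply: (finerP _ _ W0U).
have cR : #|inside W0 B| = #|R|.+1 by rewrite (cardsD1 E) EB.
have wM D : D \in R ->
    \prod_(B in blocks U) moebius_coef C #|inside (M D) B| = moebius_coef C #|R| * K.
  move=> RD; have [eD xr nr] := repP D RD.
  have bM : blocks (M D) = (E :|: D) |: ((blocks W0 :\ E) :\ D).
    by rewrite blocks_merge ?W0x ?eD.
  have rD : rep D \in D by rewrite -{2}eD; apply: eqv_refl.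
  rewrite (bigD1 B) //=; congr (_ * _); last first.
    apply: eq_bigr => B' /andP[UB' nB]; congr (moebius_coef C #|pred_of_set _|).
    have dB a : a \in B -> a \notin B'.
      move=> aB; apply: contra nB => aB'.
      by rewrite -(def_pblock (part_triv U) UB' aB') (def_pblock (part_triv U) UB aB).
    have xE : x \in E by apply: eqv_refl.
    have nE : ~~ (E \subset B') by apply/subsetPn; exists x; rewrite // dB // [_ \in B]eqv_refl.
    have nD : ~~ (D \subset B') by apply/subsetPn; exists (rep D); rewrite ?dB.
    apply/setP => D'; rewrite !inE bM !inE; have [->|_] := eqVneq D' (E :|: D).
      by rewrite subUset (negbTE nE) !andbF.
    have [->|_] := eqVneq D' E; first by rewrite (negbTE nE) !andbF.
    by have [->|_] := eqVneq D' D; first by rewrite (negbTE nD) !andbF.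
  have -> : inside (M D) B = (E :|: D) |: (R :\ D).
    apply/setP => D'; rewrite !inE bM !inE; have [->|_] := eqVneq D' (E :|: D).
      move: EB RD; rewrite !inE => /andP[_ EB] /and3P[_ _ DB].
      by rewrite subUset EB DB.
    by rewrite -!andbA.
  have nED : E :|: D \notin R :\ D.
    have := merge_notin W0 x (rep D); rewrite eD; apply: contra.
    by rewrite !inE => /and4P[-> -> ->].
  by rewrite cardsU1 nED (cardsD1 D R) RD.
have R0 : (0 < #|R|)%N.
  apply/card_gt0P; exists (pblock W0 z); rewrite !inE -eqv_pblock eqv_sym W0x nxz pblock_part.
  by apply/subsetP => d; move/(finerP _ _ W0U); apply: eqv_trans.
rewrite (bigD1 B) //= cR -/K (eq_bigr _ wM) sumr_const -mulr_natl mulrA -mulrDl.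
by rewrite moebius_coefS ?mul0r.
Qed.
(* h need not be a family of moments: a set function vanishing on some sets
   restricts the partitions that contribute. *)
Lemma moment_cumulant h U :
  \prod_(B in blocks U) h B =
  \sum_(V : part T | finer V U) \prod_(B in blocks V) cum h B.
Proof.
have [g gP] := moebius_exists (fun U : part T => \prod_(B in blocks U) h B).
rewrite gP; apply: eq_bigr => V _; symmetry.
rewrite /cum prod_sum_partition.
(* Products of h are replaced by sums of g. After the exchange of sums, the coefficient of [g X] is
   the Moebius sum over the interval from X to V, so only X = V is left. *)
transitivity (\sum_(W : part T | finer W (blocks V))
   (\prod_(B in blocks V) moebius_coef C #|inside W B|) *
    \sum_(X : part T | finer X W) g X).
  apply: eq_bigr => W WV; rewrite big_split /= prod_inside //.
  by rewrite -gP.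
under eq_bigr => W WV do rewrite mulr_sumr.
rewrite (exchange_big_dep (fun X : part T => finer X (blocks V))) /= => [|W X WV XW]; last first.
  exact: finer_trans XW WV.
rewrite (bigD1 V) ?finer_refl //= -mulr_suml moebius_interval ?finer_refl // eqxx mul1r.
rewrite big1 ?addr0 // => X /andP[XV nXV].
by rewrite -mulr_suml moebius_interval // (negbTE nXV) mul0r.
Qed.

End OneType.

(* Only the partitions whose blocks are saturated for g contribute, and these
   are the preimages of the partitions of the image. *)
Lemma cum_fibers (T T' : finType) (g : T -> T') (B : {set T}) (h : {set T} -> C) :
  (forall D : {set T}, D \subset B -> h D != 0 ->
     forall x y, x \in D -> y \in B -> g x = g y -> y \in D) ->
  cum h B = cum (fun D' => h (B :&: g @^-1: D')) (g @: B).
Proof.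
move=> sat; pose p (D' : {set T'}) := B :&: g @^-1: D'.
pose good (Q : {set {set T}}) := [forall D in Q, h D != 0].
have -> : cum h B = \sum_(Q | partition Q B && good Q)
    moebius_coef C #|Q| * \prod_(D in Q) h D.
  rewrite /cum [LHS](bigID good) /= [X in _ + X]big1 ?addr0 // => Q /andP[_].
  rewrite negb_forall_in => /exists_inP[D QD]; rewrite negbK => /eqP e.
  by rewrite (bigD1 D) //= e mul0r mulr0.
have gp (D' : {set T'}) : D' \subset g @: B -> g @: p D' = D'.
  move=> s; apply/setP => y; apply/imsetP/idP => [[x]|yD].
    by rewrite !inE => /andP[_ h'] ->.
  have /imsetP[x xB e] := subsetP s _ yD.
  by exists x; rewrite // !inE xB -e.
have pg (D : {set T}) : D \subset B -> h D != 0 -> p (g @: D) = D.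
  move=> DB nD; apply/setP => x; rewrite !inE; apply/andP/idP => [[xB]|xD].
    by case/imsetP => y yD e; apply: sat DB nD _ _ yD xB _; rewrite e.
  by split; [apply: (subsetP DB)|apply: imset_f].
pose h1 (Q' : {set {set T'}}) := [set p D' | D' in Q'].
pose h2 (Q : {set {set T}}) := [set g @: (D : {set T}) | D in Q].
have h12 Q : partition Q B && good Q -> h1 (h2 Q) = Q.
  case/andP=> pQ /forall_inP gQ; rewrite /h1 /h2 -imset_comp -[RHS]imset_id.
  by apply: eq_in_imset => D QD /=; rewrite pg ?gQ ?(partitionS pQ).
have h21 Q' : partition Q' (g @: B) -> h2 (h1 Q') = Q'.
  move=> pQ; rewrite /h1 /h2 -imset_comp -[RHS]imset_id.
  by apply: eq_in_imset => D QD /=; rewrite gp ?(partitionS pQ).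
have pinj Q' : partition Q' (g @: B) -> {in Q' &, injective p}.
  move=> pQ D1 D2 Q1 Q2 e; rewrite -(gp D1) ?(partitionS pQ) // e gp //.
  exact: partitionS pQ Q2.
have ph1 Q' : partition Q' (g @: B) -> partition (h1 Q') B.
  move=> pQ; have /and3P[/eqP cQ /trivIsetP tQ n0] := pQ; apply/and3P; split.
  - rewrite eqEsubset; apply/andP; split.
      by apply/bigcupsP => D /imsetP[D' _ ->]; apply: subsetIl.
    apply/subsetP => x xB; have : g x \in cover Q' by rewrite cQ imset_f.
    case/bigcupP => D' QD' gx; apply/bigcupP; exists (p D'); first exact: imset_f.
    by rewrite !inE xB.
  - apply/trivIsetP => _ _ /imsetP[D1 Q1 ->] /imsetP[D2 Q2 ->] nD.
    have /tQ : D1 != D2 by apply: contraNneq nD => ->.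
    move=> /(_ Q1 Q2); rewrite -!setI_eq0 => /eqP e.
    apply/eqP/setP => x; rewrite !inE; have /setP/(_ (g x)) := e; rewrite !inE.
    by case: (x \in B); case: (g x \in D1).
  - apply/negP => /imsetP[D' QD' e]; case/negP: n0.
    by have := gp D' (partitionS pQ QD'); rewrite -e imset0 => ->.
have ph2 Q : partition Q B && good Q -> partition (h2 Q) (g @: B).
  move=> /andP[pQ /forall_inP gQ]; have /and3P[/eqP cQ /trivIsetP tQ n0] := pQ.
  apply/and3P; split.
  - rewrite eqEsubset; apply/andP; split.
      by apply/bigcupsP => D /imsetP[D' QD ->]; apply/imsetS/(partitionS pQ QD).
    apply/subsetP => y /imsetP[x xB ->]; move: xB; rewrite -{1}cQ.
    case/bigcupP => D QD xD; apply/bigcupP; exists (g @: D); first exact: imset_f.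
    exact: imset_f.
  - apply/trivIsetP => _ _ /imsetP[D1 Q1 ->] /imsetP[D2 Q2 ->] nD.
    have /tQ : D1 != D2 by apply: contraNneq nD => ->.
    move=> /(_ Q1 Q2); rewrite -!setI_eq0 => /eqP e.
    apply/eqP/setP => y; rewrite !inE; apply/negP => /andP[/imsetP[x1 x1D ey]].
    case/imsetP => x2 x2D ey2.
    have x21 : x2 \in D1.
      apply: (sat D1 (partitionS pQ Q1) (gQ _ Q1) x1) => //; last by rewrite -ey.
      exact: (subsetP (partitionS pQ Q2)).
    by have := in_set0 x2; rewrite -e inE x21 x2D.
  - apply/negP => /imsetP[D QD /esym/eqP]; rewrite -cards_eq0.
    have /set0Pn[x xD] : D != set0 by apply: contraNneq n0 => <-.
    by rewrite cards_eq0 => /eqP e; have := imset_f g xD; rewrite e inE.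
rewrite (reindex_onto h1 h2) //= /cum [RHS](bigID (fun Q' => good (h1 Q'))) /=.
rewrite [X in _ = _ + X]big1 ?addr0 => [|Q' /andP[pQ' ngood]]; last first.
  move: ngood; rewrite negb_forall_in => /exists_inP[_ /imsetP[D' QD' ->]].
  by rewrite negbK => /eqP e; rewrite (bigD1 D') //= [h _]e mul0r mulr0.
apply: eq_big => [Q'|Q' /andP[/andP[pQ' gQ'] /eqP e]].
  apply/andP/andP => [[hQ /eqP <-]|[pQ' gQ']].
    by split; [exact: ph2|rewrite h12 //; case/andP: hQ].
  by rewrite ph1 // gQ' h21 ?eqxx.
have pQ2 : partition Q' (g @: B) by rewrite -e ph2 // pQ'.
rewrite card_in_imset; last exact: pinj.
by rewrite big_imset //; apply: pinj.
Qed.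

End Cumulants.

(** * Sums over index assignments and traces of products *)

Section Averages.
Variables (C : numFieldType) (K : finType) (N : nat).
Local Notation X := 'I_N.+1.
Local Notation asg := {ffun K -> X}.
Implicit Types (F G : asg -> C) (S : {set K}).

(** Averages rather than sums: the coordinates of x are independent under the uniform measure, so
    averages over disjoint coordinates multiply without counting the coordinates that do not
    occur. *)
Definition avg F : C := #|{: asg}|%:R^-1 * \sum_x F x.

Lemma card_asg_neq0 : #|{: asg}|%:R != 0 :> C.
Proof.
rewrite pnatr_eq0 -lt0n; apply/card_gt0P; exists [ffun=> ord0]; by rewrite inE.
Qed.

Lemma eq_avg F G : F =1 G -> avg F = avg G.
Proof. by move=> e; rewrite /avg (eq_bigr _ (fun x _ => e x)). Qed.

Lemma avg_cst c : avg (fun=> c) = c.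
Proof. by rewrite /avg sumr_const -[c *+ _]mulr_natl mulKf ?card_asg_neq0. Qed.

Lemma avgZ c F : avg (fun x => c * F x) = c * avg F.
Proof. by rewrite /avg -mulr_sumr mulrCA. Qed.

Lemma avg_sum (J : finType) (F : J -> asg -> C) :
  avg (fun x => \sum_j F j x) = \sum_j avg (F j).
Proof. by rewrite /avg exchange_big mulr_sumr. Qed.

Lemma sum_avg F : \sum_x F x = N.+1%:R ^+ #|K| * avg F.
Proof. by rewrite /avg card_ffun card_ord natrX mulVKf // -natrX pnatr_eq0 expn_eq0. Qed.

Definition depends S F := forall x y : asg, {in S, x =1 y} -> F x = F y.

(* Exchanging the coordinates of [x] and [y] outside [S] is an involution of
   the pairs (x, y). *)
Lemma avgM S F G : depends S F -> depends (~: S) G ->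
  avg (fun x => F x * G x) = avg F * avg G.
Proof.
move=> dF dG; pose mix (x y : asg) : asg := [ffun k => if k \in S then x k else y k].
pose sw (p : asg * asg) := (mix p.1 p.2, mix p.2 p.1).
have swK : involutive sw.
  by case=> x y; congr pair; apply/ffunP => k; rewrite !ffunE; case: (k \in S).
have E : (\sum_x F x) * (\sum_x G x) = #|{: asg}|%:R * \sum_x F x * G x.
  rewrite mulr_suml; under eq_bigr => x _ do rewrite mulr_sumr.
  rewrite pair_bigA /= (reindex_inj (inv_inj swK)) /=.
  transitivity (\sum_(p : asg * asg) F p.1 * G p.1).
    apply: eq_bigr => -[x y] _ /=; congr (_ * _).
      by apply: dF => k kS; rewrite ffunE kS.
    by apply: dG => k; rewrite inE => /negbTE kS; rewrite ffunE kS.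
  rewrite -(pair_bigA _ (fun x (_ : asg) => F x * G x)) /= mulr_sumr.
  by apply: eq_bigr => x _; rewrite sumr_const mulr_natl.
by rewrite /avg mulrACA E -mulrA mulKf ?card_asg_neq0.
Qed.

Lemma avg_prod (J : finType) (p : pred J) (S : J -> {set K}) (F : J -> asg -> C) :
  (forall i j, p i -> p j -> i != j -> [disjoint S i & S j]) ->
  (forall j, p j -> depends (S j) (F j)) ->
  avg (fun x => \prod_(j | p j) F j x) = \prod_(j | p j) avg (F j).
Proof.
move=> dS dF; elim: index_enum (index_enum_uniq J) => [_|j s IH /andP[js us]].
  by rewrite big_nil -[RHS](avg_cst 1); apply: eq_avg => x; rewrite big_nil.
rewrite big_cons; case: ifP => pj; last first.
  by rewrite -IH //; apply: eq_avg => x; rewrite big_cons pj.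
rewrite -IH // -(@avgM (S j)); last 2 first.
- exact: dF.
- move=> x y e; rewrite big_seq_cond [RHS]big_seq_cond; apply: eq_bigr => i /andP[is_ pi].
  apply: dF => // k ki; apply: e; rewrite inE; apply: contraTN (ki) => kj.
  by rewrite (disjointFr (dS j i pj pi _) kj) //; apply: contraNneq js => ->.
by apply: eq_avg => x; rewrite big_cons pj.
Qed.

(* The variable p, on which F depends freely, may be fused with the unused
   coordinate k. *)
Lemma avg_coord (k : K) (F : X -> asg -> C) :
  (forall p, depends [set~ k] (F p)) ->
  \sum_p avg (F p) = N.+1%:R * avg (fun x => F (x k) x).
Proof.
move=> dF; rewrite /avg -mulr_sumr mulrCA; congr (_ * _).
pose upd (x : asg) p : asg := [ffun l => if l == k then p else x l].
pose sw (q : X * asg) := (q.2 k, upd q.2 q.1).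
have swK : involutive sw.
  case=> p x; congr pair; rewrite /= ?ffunE ?eqxx //.
  by apply/ffunP => l; rewrite !ffunE; case: eqVneq => // ->.
rewrite pair_bigA /= (reindex_inj (inv_inj swK)) /=.
transitivity (\sum_(q : X * asg) F (q.2 k) q.2).
  apply: eq_bigr => -[p x] _ /=; apply: dF => l.
  by rewrite !inE ffunE => /negbTE->.
rewrite -(pair_bigA _ (fun (_ : X) (x : asg) => F (x k) x)) /= sumr_const card_ord.
by rewrite mulr_natl.
Qed.

Lemma avg_proj (k : K) (f : X -> C) : N.+1%:R * avg (fun x => f (x k)) = \sum_p f p.
Proof.
by rewrite -(@avg_coord k (fun p _ => f p)) //; apply: eq_bigr => p _; rewrite avg_cst.
Qed.

Section Traces.
Variable A : K -> 'M[C]_N.+1.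

(** One term of the expansion of a matrix product: [x j] is the row index of the factor j, hence the
    column index of the factor before it; q is the last column. *)
Fixpoint chain (s : seq K) (x : asg) (q : X) : C :=
  if s is j :: s' then
    A j (x j) (if s' is j' :: _ then x j' else q) * chain s' x q else 1.

Lemma depends_chain s q : depends [set j in s] (fun x => chain s x q).
Proof.
elim: s => //= j s IH x y e; congr (_ * _).
  rewrite e ?inE ?eqxx //; case: s e {IH} => // j' s e.
  by rewrite (e j') // !inE eqxx orbT.
by apply: IH => k; rewrite inE => ks; apply: e; rewrite !inE ks orbT.
Qed.

(** The weight h carries the induction: for the remaining factors it is the row [A j p] of the first
    matrix. *)
Lemma chain_avg j s (h : X -> C) q : uniq (j :: s) ->
  N.+1%:R ^+ (size s).+1 * avg (fun x => h (x j) * chain (j :: s) x q) =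
  \sum_p h p * (\prod_(k <- j :: s) A k) p q.
Proof.
elim: s j h => [|j' s IH] j h /=.
  move=> _; rewrite expr1 -(avg_proj j); congr (_ * _); apply: eq_avg => x.
  by rewrite big_seq1 mulr1.
move=> us; have [/= jn us'] := andP us.
transitivity (\sum_p N.+1%:R ^+ (size s).+1 *
    avg (fun x => h p * (A j p (x j') * chain (j' :: s) x q))).
  rewrite -mulr_sumr (@avg_coord j) ?mulrA -?exprSr // => p x y e.
  congr (_ * _); have js k : k \in j' :: s -> k \in [set~ j].
    by move=> ks; rewrite !inE; apply: contraNneq jn => <-.
  congr (_ * _); first by rewrite e // js // mem_head.
  by apply: depends_chain => k; rewrite inE => ks; rewrite e // js.
apply: eq_bigr => p _; rewrite avgZ mulrCA (IH j' (A j p)) //; congr (_ * _).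
by rewrite [in RHS]big_cons mxE.
Qed.

Lemma chain_traject (s : {perm K}) i m x :
  chain (traject s i m) x (x (iter m s i)) =
  \prod_(j <- traject s i m) A j (x j) (x (s j)).
Proof.
elim: m i => [|m IH] i; first by rewrite big_nil.
rewrite trajectS /= big_cons; congr (_ * _).
  by case: m {IH} => [|m]; rewrite ?trajectS.
by rewrite -[s (iter m s i)]/(iter m.+1 s i) iterSr IH.
Qed.

(** The trace closes the path: with q equal to the first row index [x i], the last column is the row
    index of the image under s of the last point of the orbit. *)
Lemma trace_orbit (s : {perm K}) i :
  \tr (\prod_(j <- fingraph.orbit s i) A j) =
  N.+1%:R ^+ fingraph.order s i *
  avg (fun x => \prod_(j <- fingraph.orbit s i) A j (x j) (x (s j))).
Proof.
have [m em] : exists m, fingraph.order s i = m.+1.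
  by exists (fingraph.order s i).-1; rewrite prednK // order_gt0.
have uo := orbit_uniq s i.
rewrite /mxtrace /fingraph.orbit em trajectS.
transitivity (\sum_q N.+1%:R ^+ m.+1 * avg (fun x => (x i == q)%:R *
     chain (i :: traject s (s i) m) x q)).
  apply: eq_bigr => q _; have := @chain_avg i (traject s (s i) m) (fun p => (p == q)%:R) q.
  rewrite size_traject => ->; last by rewrite -trajectS -em.
  rewrite [RHS](bigD1 q) //= eqxx mul1r [X in _ = _ + X]big1 ?addr0 // => p /negbTE->.
  by rewrite mul0r.
rewrite -mulr_sumr -avg_sum; congr (_ * _); apply: eq_avg => x.
rewrite (bigD1 (x i)) //= eqxx mul1r big1 ?addr0 => [|q]; last first.
  by rewrite eq_sym => /negbTE->; rewrite mul0r.
rewrite -trajectS -chain_traject -em iter_order ?em //; exact: perm_inj.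
Qed.

Definition stable (s : {perm K}) (D : {set K}) := [forall j in D, s j \in D].

Lemma fconnect_stable (s : {perm K}) (D : {set K}) i j :
  stable s D -> fconnect s i j -> (i \in D) = (j \in D).
Proof.
move=> /forall_inP sD.
have sub a b : fconnect s a b -> a \in D -> b \in D.
  by move/iter_findex <-; elim: (findex _ _ _) => //= m IH /IH; apply: sD.
move=> ij; apply/idP/idP; apply: sub => //.
by rewrite fconnect_sym //; apply: perm_inj.
Qed.

Lemma orbit_prod_set (s : {perm K}) i (f : K -> C) :
  \prod_(j <- fingraph.orbit s i) f j = \prod_(j | fconnect s i j) f j.
Proof.
rewrite -[RHS]big_filter; apply: perm_big; apply: uniq_perm; rewrite ?orbit_uniq //.
  by rewrite filter_uniq // index_enum_uniq.
by move=> j; rewrite mem_filter mem_index_enum andbT fconnect_orbit.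
Qed.

Lemma big_roots (M : Type) (idx : M) (op : Monoid.com_law idx) (s : {perm K})
    (D : {set K}) (f : K -> M) : stable s D ->
  \big[op/idx]_(i in D | i \in froots s)
      \big[op/idx]_(j | fconnect s i j) f j = \big[op/idx]_(j in D) f j.
Proof.
move=> sD; have fs : connect_sym (frel s) := fconnect_sym (@perm_inj _ s).
rewrite [RHS](partition_big (froot s) (fun i => (i \in D) && (i \in froots s))) /=.
  apply: eq_bigr => i /andP[iD ri]; apply: eq_bigl => j.
  have ri' : froot s i = i := eqP ri.
  have -> : fconnect s i j = (froot s j == i).
    by rewrite -{2}ri' root_connect // fs.
  have [e|] := eqVneq (froot s j) i; last by rewrite andbF.
  rewrite andbT; symmetry.
  by rewrite -(fconnect_stable sD (i := i)) // -e fs connect_root.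
move=> j jD; rewrite [_ \in froots s](roots_root fs) andbT.
by rewrite -(fconnect_stable sD (i := j)) // connect_root.
Qed.

(** Distinct cycles involve disjoint coordinates of x, and their lengths add up to the cardinal of
    D. *)
Lemma prod_traces (s : {perm K}) (D : {set K}) : stable s D ->
  \prod_(i in D | i \in froots s) \tr (\prod_(j <- fingraph.orbit s i) A j) =
  N.+1%:R ^+ #|D| * avg (fun x => \prod_(j in D) A j (x j) (x (s j))).
Proof.
move=> sD; have fs : connect_sym (frel s) := fconnect_sym (@perm_inj _ s).
under eq_bigr => i _ do rewrite trace_orbit.
rewrite big_split /= -expr_sum; congr (_ * _).
  congr (_ ^+ _); rewrite -sum1_card -(big_roots _ _ sD); apply: eq_bigr => i _.
  by rewrite sum1_card; apply: eq_card.
rewrite -(@avg_prod _ _ (fun i => [set j | fconnect s i j])).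
- apply: eq_avg => x; rewrite -[RHS](big_roots _ _ sD); apply: eq_bigr => i _.
  exact: orbit_prod_set.
- move=> i j /andP[_ ri] /andP[_ rj] nij; rewrite -setI_eq0; apply/eqP/setP => k.
  rewrite !inE; apply: contraNF nij => /andP[ik jk].
  by rewrite -(eqP ri) -(eqP rj) root_connect // (connect_trans ik) // fs.
- move=> i _ x y e; rewrite orbit_prod_set [RHS]orbit_prod_set; apply: eq_bigr => j ij.
  by rewrite !e ?inE //; apply: connect_trans ij (fconnect1 _ _).
Qed.

End Traces.
End Averages.

Local Open Scope sesquilinear_scope.

(** * From unitary matrices to all matrices *)

Section MatrixGeneration.
Variables (C : numClosedFieldType) (N : nat).
Local Notation M := 'M[C]_N.+1.

(* The Cayley transforms of the integers: infinitely many complex numbers of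
   modulus 1, hence enough points to determine a polynomial. *)
Definition unit_seq (m : nat) : C := (1 + 'i * m%:R) / (1 - 'i * m%:R).

Lemma unit_seq_mul (m : nat) : (1 + 'i * m%:R) * (1 - 'i * m%:R) = (m ^ 2).+1%:R :> C.
Proof.
rewrite -natr1 natrX; have := sqrCi C; move: ('i : C) => i i2.
transitivity (1 - i ^+ 2 * m%:R ^+ 2 : C); first by ring.
by rewrite i2; ring.
Qed.

Lemma unit_seq_den m : 1 - 'i * m%:R != 0 :> C.
Proof.
have := unit_seq_mul m; apply: contra_eq_neq => ->.
by rewrite mulr0 eq_sym pnatr_eq0.
Qed.

Lemma norm_unit_seq m : `|unit_seq m| = 1.
Proof.
rewrite /unit_seq normf_div (_ : 1 + 'i * m%:R = (1 - 'i * m%:R)^*); last first.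
  by rewrite rmorphB rmorph1 rmorphM /= conjCi conjC_nat mulNr opprK.
by rewrite norm_conjC divff // normr_eq0 unit_seq_den.
Qed.

Lemma unit_seq_inj : injective unit_seq.
Proof.
move=> m k /eqP; rewrite /unit_seq eqr_div ?unit_seq_den // -subr_eq0 => /eqP e.
have : (2 * 'i) * (m%:R - k%:R) = 0 :> C by rewrite -[RHS]e; ring.
move/eqP; rewrite mulf_eq0 mulf_eq0 pnatr_eq0 /= (negbTE (neq0Ci C)) /= subr_eq0.
by rewrite eqr_nat => /eqP.
Qed.

(** In the application, [Q g] says that the products of entries of the g A_k and of the A_k g have
    the same expectations; it holds along a line because both sides are polynomials there. *)
Variable Q : M -> Prop.
Hypothesis Q_unitary : forall U : M, U \is unitarymx -> Q U.
Hypothesis Q_mul : forall g h, Q g -> Q h -> Q (g *m h).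
Hypothesis Q_line : forall g h (z : nat -> C), injective z ->
  (forall m, Q (g + z m *: h)) -> forall t, Q (g + t *: h).

Lemma Q_diag_seq (s : seq 'I_N.+1) (d : 'rV[C]_N.+1) :
  (forall v, v \notin s -> `|d 0 v| = 1) -> Q (diag_mx d).
Proof.
elim: s d => [|v s IH] d hd.
  apply: Q_unitary; apply/unitarymxP; rewrite tr_diag_mx map_diag_mx mulmx_diag.
  rewrite -diag_const_mx; congr diag_mx; apply/rowP => j; rewrite !mxE.
  by rewrite -normCK hd // expr1n.
pose d' t : 'rV[C]_N.+1 := \row_j (if j == v then t else d 0 j).
have dE t : diag_mx (d' t) = diag_mx (d' 0) + t *: delta_mx v v.
  apply/matrixP => i j; rewrite !mxE.
  have [->|nij] := eqVneq i j; rewrite ?eqxx ?mulr1n.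
    by case: (j == v); rewrite /= ?add0r ?mulr1 ?mulr0 ?addr0.
  rewrite !mulr0n add0r; case: eqVneq => [eiv|_] /=; last by rewrite mulr0.
  case: eqVneq => [ejv|_]; last by rewrite mulr0.
  by rewrite eiv ejv eqxx in nij.
have -> : d = d' (d 0 v) by apply/rowP => j; rewrite mxE; case: eqVneq => [->|].
rewrite dE; apply: Q_line unit_seq_inj _ _ => m; rewrite -dE; apply: IH => j js.
rewrite mxE; case: eqVneq => [_|jv]; first exact: norm_unit_seq.
by apply: hd; rewrite inE negb_or jv js.
Qed.

Lemma Q_diag d : Q (diag_mx d).
Proof. by apply: (@Q_diag_seq (enum 'I_N.+1)) => v; rewrite mem_enum. Qed.

Lemma Q_hermitian (H : M) : H^t* = H -> Q H.
Proof.
move=> hH; have /orthomx_spectralP -> : H \is normalmx.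
  by apply/normalmxP; rewrite hH.
have U := spectral_unitarymx H; apply: Q_mul; last exact: Q_unitary.
apply: Q_mul; last exact: Q_diag.
by apply: Q_unitary; rewrite invmx_unitary // trmxC_unitary.
Qed.

(* Diagonal matrices are reached one entry at a time, Hermitian ones by the
   spectral theorem, and g = (H1 + i H2) / 2 lies on a line of Hermitian
   matrices. *)
Lemma Q_all (g : M) : Q g.
Proof.
pose h1 := g + g^t*; pose h2 := 'i *: (g^t* - g).
have tD (X Y : M) : (X + Y)^t* = X^t* + Y^t* by rewrite linearD map_mxD.
have tN (X : M) : (- X)^t* = - X^t* by rewrite linearN map_mxN.
have tZ c (X : M) : (c *: X)^t* = c^* *: X^t* by rewrite linearZ map_mxZ.
have tK (X : M) : X^t*^t* = X.
  by apply/matrixP => i j; rewrite !mxE conjCK.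
have h1H : h1^t* = h1 by rewrite /h1 tD tK addrC.
have h2H : h2^t* = h2.
  by rewrite /h2 tZ tD tN tK conjCi scaleNr -scalerN opprB.
have all2 t : Q (h1 + t *: h2).
  apply: (@Q_line _ _ (fun m => m%:R)) => [m k /eqP|m].
    by rewrite eqr_nat => /eqP.
  by apply: Q_hermitian; rewrite tD tZ rmorph_nat h1H h2H.
have -> : g = (2^-1)%:M *m (h1 + 'i *: h2).
  rewrite mul_scalar_mx /h1 /h2 scalerA -expr2 sqrCi scaleN1r opprB addrACA.
  by rewrite subrr addr0 -mulr2n -scaler_nat scalerA mulVf ?scale1r ?pnatr_eq0.
by apply: Q_mul => //; rewrite -diag_const_mx; apply: Q_diag.
Qed.

End MatrixGeneration.

Close Scope sesquilinear_scope.

From mathcomp Require Import all_classical all_reals all_analysis.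
From mathcomp Require Import measurable_realfun.
Import numFieldNormedType.Exports.
Local Open Scope complex_scope.
Local Open Scope classical_set_scope.
Local Open Scope ring_scope.

(** * Expectations of complex random variables *)

Section RealMoments.
Context (R : realType) (d : measure_display) (T : measurableType d) (P : probability T R).
Implicit Types (X Y : T -> R).

(** Natural exponents are convenient for products; as P is finite, they control every real exponent
    [p >= 1] ([all_momentsP]). *)
Definition all_moments X := measurable_fun [set: T] X /\
  forall m : nat, P.-integrable [set: T] (fun w => (`|X w| ^+ m)%:E).

Lemma Lfun_natP X (m : nat) : (0 < m)%N -> measurable_fun [set: T] X ->
  P.-integrable [set: T] (fun w => (`|X w| ^+ m)%:E) <-> X \in Lfun P (m%:R%:E).
Proof.
move=> m0 mX; have m1 : 1 <= m%:R :> R by rewrite ler1n.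
have e w : `|X w| ^+ m = `|X w| `^ m%:R by rewrite powR_mulrn.
split=> [iX|/(Lfun_integrable m1)]; last first.
  by apply: eq_integrable => // w _; rewrite e.
rewrite inE; apply/andP; split; first by rewrite inE.
rewrite inE /= /finite_norm.
have n0 : m%:R != 0 :> R by rewrite pnatr_eq0 -lt0n.
have eE w : (`|(EFin \o X) w| `^ m%:R)%E = (`|X w| ^+ m)%:E.
  by rewrite e.
rewrite unlock poweR_lty //.
rewrite (eq_integral (fun w => (`|X w| ^+ m)%:E)) => [|w _]; last exact: eE.
move/integrableP: iX => [_]; apply: le_lt_trans.
apply: ge0_le_integral => //.
- by apply/measurable_EFinP/measurable_funX; exact: measurableT_comp.
- apply: measurableT_comp => //; apply/measurable_EFinP/measurable_funX.
  exact: measurableT_comp.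
- by move=> w _; rewrite lee_fin ler_norm.
Qed.

Lemma all_momentsP X : all_moments X <-> (forall p : R, 1 <= p -> X \in Lfun P p%:E).
Proof.
split=> [[mX iX] p p1|h].
  pose m := (Num.trunc p).+1.
  have pm : p <= m%:R by apply: ltW; rewrite /m truncnS_gt.
  have m1 : (1%:E <= (m%:R : R)%:E)%E by rewrite lee_fin ler1n.
  have p1' : (1%:E <= p%:E)%E by rewrite lee_fin.
  apply: (@Lfun_subset _ _ _ P p%:E m%:R%:E p1' m1 _ _ X _).
  - by have hP : P [set: T] \is a fin_num by rewrite probability_setT.
  - by rewrite lee_fin.
  - exact/Lfun_natP.
have mX : measurable_fun [set: T] X.
  by have := h 1 (lexx _); rewrite inE => /andP[]; rewrite inE.
split=> // -[|m]; last by apply/Lfun_natP => //; apply: h; rewrite ler1n.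
apply: (@eq_integrable _ _ _ _ _ _ (EFin \o cst 1)) => //.
by apply/Lfun1_integrable; exact: Lfun_cst.
Qed.

Lemma all_moments_Lfun1 X : all_moments X -> X \in Lfun P 1.
Proof. by move/all_momentsP; apply. Qed.

Lemma all_moments_cst (c : R) : all_moments (cst c).
Proof. by apply/all_momentsP => p _; exact: Lfun_cst. Qed.

Lemma all_momentsD X Y : all_moments X -> all_moments Y -> all_moments (X \+ Y).
Proof.
move=> /all_momentsP hX /all_momentsP hY; apply/all_momentsP => p p1.
have p1' : (1 <= p%:E)%E by rewrite lee_fin.
by have [_] := @Lfun_addr_closed _ _ _ P _ p1'; apply; [exact: hX|exact: hY].
Qed.

(** Cauchy-Schwarz: the m-th powers of |X| and |Y| are in L^2 by the moments of order 2m. *)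
Lemma all_momentsM X Y : all_moments X -> all_moments Y -> all_moments (X \* Y).
Proof.
move=> [mX iX] [mY iY]; split; first exact: measurable_funM.
move=> m; pose f (Z : T -> R) w : R := `|Z w| ^+ m.
have L2 (Z : T -> R) : measurable_fun [set: T] Z ->
    (forall m : nat, P.-integrable [set: T] (fun w => (`|Z w| ^+ m)%:E)) ->
    f Z \in Lfun P 2%:E.
  move=> mZ iZ; apply/(@Lfun_natP _ 2) => //.
    by apply/measurable_funX; exact: measurableT_comp.
  apply: eq_integrable (iZ (m * 2)%N) => // w _.
  by rewrite exprM /f (normrX m) normr_id.
have := Lfun2_mul_Lfun1 (L2 _ mX iX) (L2 _ mY iY).
move/Lfun1_integrable; apply: eq_integrable => // w _.
by rewrite /f /= normrM exprMn.
Qed.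

Lemma all_momentsN X : all_moments X -> all_moments (\- X).
Proof.
move=> hX; rewrite (_ : \- X = cst (-1) \* X).
  by apply: all_momentsM => //; exact: all_moments_cst.
by apply/funext => w /=; rewrite mulN1r.
Qed.

Definition rE X : R := fine ('E_P[X])%E.

Lemma rE_fin X : all_moments X -> ('E_P[X])%E = (rE X)%:E.
Proof. by move=> hX; rewrite fineK // expectation_fin_num // all_moments_Lfun1. Qed.

Lemma rED X Y : all_moments X -> all_moments Y -> rE (X \+ Y) = rE X + rE Y.
Proof.
move=> hX hY; rewrite {1}/rE expectationD ?all_moments_Lfun1 //.
by rewrite !rE_fin.
Qed.

Lemma rEZ (c : R) X : all_moments X -> rE (cst c \* X) = c * rE X.
Proof.
move=> hX; rewrite (_ : cst c \* X = c \o* X); last first.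
  by apply/funext => w /=; rewrite mulrC.
by rewrite {1}/rE expectationZl ?all_moments_Lfun1 // rE_fin.
Qed.

Lemma rE_cst c : rE (cst c) = c.
Proof. by rewrite /rE expectation_cst. Qed.

Lemma rEN X : all_moments X -> rE (\- X) = - rE X.
Proof.
move=> hX; rewrite (_ : \- X = cst (-1) \* X) ?rEZ ?mulN1r //.
by apply/funext => w /=; rewrite mulN1r.
Qed.

Lemma rE_law X Y : all_moments X -> all_moments Y ->
  (forall B, measurable B -> P (X @^-1` B) = P (Y @^-1` B)) -> rE X = rE Y.
Proof.
move=> hX hY e; rewrite /rE unlock; congr fine.
have int Z : all_moments Z ->
    (\int[P]_w (Z w)%:E = \int[pushforward P Z]_y (y%:E))%E.
  move=> hZ; rewrite integral_pushforward //; first exact: hZ.1.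
  by apply/Lfun1_integrable; exact: all_moments_Lfun1.
rewrite (int _ hX) (int _ hY).
pose mfX : {mfun T >-> R} := HB.pack X (isMeasurableFun.Build _ _ _ _ _ hX.1).
pose mfY : {mfun T >-> R} := HB.pack Y (isMeasurableFun.Build _ _ _ _ _ hY.1).
apply: (@eq_measure_integral _ _ _ _ (distribution P mfY) (distribution P mfX)).
by move=> A mA ?; exact: e.
Qed.

(** The law of the pair agrees with the product of the laws on rectangles, hence everywhere; Fubini
    separates the integral. *)
Lemma rE_indep X Y : all_moments X -> all_moments Y ->
  (forall A B, measurable A -> measurable B ->
     P (X @^-1` A `&` Y @^-1` B) = (P (X @^-1` A) * P (Y @^-1` B))%E) ->
  rE (X \* Y) = rE X * rE Y.
Proof.
move=> hX hY ind.
have [mX _] := hX; have [mY _] := hY.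
have mXY : measurable_fun [set: T] (fun w => (X w, Y w)) by exact: measurable_fun_pair.
pose mfX : {mfun T >-> R} := HB.pack X (isMeasurableFun.Build _ _ _ _ _ mX).
pose mfY : {mfun T >-> R} := HB.pack Y (isMeasurableFun.Build _ _ _ _ _ mY).
pose f (z : R * R) : \bar R := (z.1 * z.2)%:E.
have mf : measurable_fun [set: R * R] f.
  by apply/measurable_EFinP; apply: measurable_funM.
have iXY : P.-integrable [set: T] (f \o (fun w => (X w, Y w))).
  by apply/Lfun1_integrable; apply: all_moments_Lfun1; apply: all_momentsM.
pose m1 := distribution P mfX; pose m2 := distribution P mfY.
pose mfXY : {mfun T >-> ((R : measurableType _) * (R : measurableType _))%type} :=
  HB.pack (fun w => (X w, Y w)) (isMeasurableFun.Build _ _ _ _ _ mXY).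
pose m' := distribution P mfXY.
have mE (A : set (R * R)) : measurable A -> (m1 \x m2)%E A = m' A.
  move=> mA; apply: (@product_measure_unique _ _ _ _ _ m1 m2 m') => //.
have e : (\int[(m1 \x m2)%E]_z f z = \int[P]_w (X w * Y w)%:E)%E.
  rewrite (@eq_measure_integral _ _ _ _ m') => [|A mA ?]; last exact: mE.
  by rewrite integral_pushforward.
have if12 : (m1 \x m2)%E.-integrable [set: R * R] f.
  apply/integrableP; split=> //.
  rewrite (@eq_measure_integral _ _ _ _ m') => [|A mA ?]; last exact: mE.
  by have /integrableP[_] := integrable_pushforward mXY mf iXY measurableT.
have iX0 : P.-integrable [set: T] ((fun y : R => y%:E) \o X).
  by have /Lfun1_integrable := all_moments_Lfun1 hX.
have iY0 : P.-integrable [set: T] ((fun y : R => y%:E) \o Y).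
  by have /Lfun1_integrable := all_moments_Lfun1 hY.
have mE' : measurable_fun [set: R] (fun y : R => y%:E) by exact: EFin_measurable.
have eX : (\int[m1]_x x%:E = 'E_P[X])%E.
  by rewrite unlock (integral_pushforward mX mE' iX0 measurableT).
have eY : (\int[m2]_x x%:E = 'E_P[Y])%E.
  by rewrite unlock (integral_pushforward mY mE' iY0 measurableT).
have iY : m2.-integrable [set: R] (fun y => y%:E).
  exact: (integrable_pushforward mY mE' iY0 measurableT).
have iX : m1.-integrable [set: R] (fun y => y%:E).
  exact: (integrable_pushforward mX mE' iX0 measurableT).
suff : ('E_P[X \* Y] = (rE X * rE Y)%:E)%E by move=> h; rewrite [LHS]/rE h.
rewrite unlock -e -integral12_prod_meas1 //.
transitivity (\int[m1]_x (x%:E * 'E_P[Y]))%E.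
  apply: eq_integral => x _; rewrite -eY -integralZl //.
by rewrite (rE_fin hY) integralZr // eX rE_fin.
Qed.

End RealMoments.

Lemma big_fun_closed (T V K : Type) (idx : V) (op : V -> V -> V) (Q : (T -> V) -> Prop)
    (s : seq K) (p : pred K) (X : K -> T -> V) :
  Q (fun=> idx) -> (forall Y Z, Q Y -> Q Z -> Q (fun w => op (Y w) (Z w))) ->
  (forall k, p k -> Q (X k)) -> Q (fun w => \big[op/idx]_(k <- s | p k) X k w).
Proof.
move=> Q0 Qop QX; elim: s => [|k s IH].
  rewrite (_ : (fun w => _) = fun=> idx) //.
  by apply/funext => w; rewrite big_nil.
rewrite (_ : (fun w => _) = fun w =>
  if p k then op (X k w) (\big[op/idx]_(k <- s | p k) X k w)
  else \big[op/idx]_(k <- s | p k) X k w).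
  by case: (p k) (QX k) => [/(_ isT) h|_]; [exact: Qop|exact: IH].
by apply/funext => w; rewrite big_cons.
Qed.

Section ComplexMeasurability.
Context (R : realType) (d : measure_display) (T : measurableType d).
Implicit Types (X Y : T -> R[i]).

Lemma ReD X Y : (fun w => complex.Re (X w + Y w)) =
  (fun w => complex.Re (X w)) \+ (fun w => complex.Re (Y w)).
Proof. by apply/funext => w /=; case: (X w) => ? ?; case: (Y w). Qed.

Lemma ImD X Y : (fun w => complex.Im (X w + Y w)) =
  (fun w => complex.Im (X w)) \+ (fun w => complex.Im (Y w)).
Proof. by apply/funext => w /=; case: (X w) => ? ?; case: (Y w). Qed.

Lemma ReM X Y : (fun w => complex.Re (X w * Y w)) =
  ((fun w => complex.Re (X w)) \* (fun w => complex.Re (Y w))) \+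
  (\- ((fun w => complex.Im (X w)) \* (fun w => complex.Im (Y w)))).
Proof. by apply/funext => w /=; case: (X w) => ? ?; case: (Y w). Qed.

Lemma ImM X Y : (fun w => complex.Im (X w * Y w)) =
  ((fun w => complex.Re (X w)) \* (fun w => complex.Im (Y w))) \+
  ((fun w => complex.Im (X w)) \* (fun w => complex.Re (Y w))).
Proof. by apply/funext => w /=; case: (X w) => ? ?; case: (Y w). Qed.

Definition cmeas X := measurable_fun [set: T] (fun w => complex.Re (X w)) /\
  measurable_fun [set: T] (fun w => complex.Im (X w)).

Lemma cmeas_cst c : cmeas (fun=> c).
Proof. by split; apply: measurable_cst. Qed.

Lemma cmeasD X Y : cmeas X -> cmeas Y -> cmeas (fun w => X w + Y w).
Proof.
move=> [rX iX] [rY iY]; rewrite /cmeas ReD ImD.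
by split; apply: measurable_funD.
Qed.

Lemma cmeasM X Y : cmeas X -> cmeas Y -> cmeas (fun w => X w * Y w).
Proof.
move=> [rX iX] [rY iY]; rewrite /cmeas ReM ImM; split.
  by apply: measurable_funD; [|apply: measurableT_comp => //]; apply: measurable_funM.
by apply: measurable_funD; apply: measurable_funM.
Qed.

Lemma cmeas_sum (K : Type) (s : seq K) (p : pred K) (X : K -> T -> R[i]) :
  (forall k, p k -> cmeas (X k)) -> cmeas (fun w => \sum_(k <- s | p k) X k w).
Proof. by apply: big_fun_closed; [exact: cmeas_cst|exact: cmeasD]. Qed.

Lemma cmeas_prod (K : Type) (s : seq K) (p : pred K) (X : K -> T -> R[i]) :
  (forall k, p k -> cmeas (X k)) -> cmeas (fun w => \prod_(k <- s | p k) X k w).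
Proof. by apply: big_fun_closed; [exact: cmeas_cst|exact: cmeasM]. Qed.

End ComplexMeasurability.

Lemma gen_cmeas (R : realType) (T : pointedType) (G : set (set T)) (f : T -> R[i]) :
  (forall B, @borelC R B -> G (f @^-1` B)) ->
  cmeas (f : g_sigma_algebraType G -> R[i]).
Proof.
move=> h; split=> _ B mB; rewrite setTI; apply: sub_sigma_algebra.
  have -> : (fun w => complex.Re (f w)) @^-1` B = f @^-1` [set z | B (complex.Re z)] by [].
  apply: h; rewrite /borelC /=.
  rewrite (_ : [set xy | _] = B `*` setT); first exact: measurableX.
  by apply/seteqP; split=> -[x y] //= [].
have -> : (fun w => complex.Im (f w)) @^-1` B = f @^-1` [set z | B (complex.Im z)] by [].
apply: h; rewrite /borelC /=.
rewrite (_ : [set xy | _] = setT `*` B); first exact: measurableX.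
by apply/seteqP; split=> -[x y] //= [].
Qed.

Section ComplexExpectation.
Context (R : realType) (d : measure_display) (T : measurableType d) (P : probability T R).
Implicit Types (X Y : T -> R[i]).
Local Notation Lc := (Linfty_minus P).
Local Notation EC := (expectationC P).

Lemma LcP X : Lc X <-> all_moments P (fun w => complex.Re (X w)) /\
  all_moments P (fun w => complex.Im (X w)).
Proof.
split=> [h|[/all_momentsP hr /all_momentsP hi] p p1]; last by split; [exact: hr|exact: hi].
by split; apply/all_momentsP => p p1; have [] := h p p1.
Qed.

Lemma Lc_cst c : Lc (fun=> c).
Proof. by apply/LcP; split; apply: all_moments_cst. Qed.

Lemma LcD X Y : Lc X -> Lc Y -> Lc (fun w => X w + Y w).
Proof.
move=> /LcP[rX iX] /LcP[rY iY]; apply/LcP; rewrite ReD ImD.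
by split; apply: all_momentsD.
Qed.

Lemma LcM X Y : Lc X -> Lc Y -> Lc (fun w => X w * Y w).
Proof.
move=> /LcP[rX iX] /LcP[rY iY]; apply/LcP; rewrite ReM ImM; split.
  by apply: all_momentsD; [|apply: all_momentsN]; apply: all_momentsM.
by apply: all_momentsD; apply: all_momentsM.
Qed.

Lemma LcZ c X : Lc X -> Lc (fun w => c * X w).
Proof. by move=> hX; apply: LcM => //; exact: Lc_cst. Qed.

Lemma Lc_sum (K : Type) (s : seq K) (p : pred K) (X : K -> T -> R[i]) :
  (forall k, p k -> Lc (X k)) -> Lc (fun w => \sum_(k <- s | p k) X k w).
Proof. by apply: big_fun_closed; [exact: Lc_cst|exact: LcD]. Qed.

Lemma Lc_prod (K : Type) (s : seq K) (p : pred K) (X : K -> T -> R[i]) :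
  (forall k, p k -> Lc (X k)) -> Lc (fun w => \prod_(k <- s | p k) X k w).
Proof. by apply: big_fun_closed; [exact: Lc_cst|exact: LcM]. Qed.

Lemma EC_ext X Y : (forall w, X w = Y w) -> EC X = EC Y.
Proof. by move=> e; congr (EC _); apply/funext. Qed.

Lemma EC_cst c : EC (fun=> c) = c.
Proof. by rewrite /expectationC -!/(rE P _) !rE_cst; case: c. Qed.

Lemma ECE X : EC X = rE P (fun w => complex.Re (X w)) +i* rE P (fun w => complex.Im (X w)).
Proof. by []. Qed.

Lemma ECD X Y : Lc X -> Lc Y -> EC (fun w => X w + Y w) = EC X + EC Y.
Proof.
move=> /LcP[rX iX] /LcP[rY iY]; rewrite !ECE ReD ImD !rED //.
Qed.

Lemma ECZ c X : Lc X -> EC (fun w => c * X w) = c * EC X.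
Proof.
move=> /LcP[rX iX]; rewrite !ECE ReM ImM; case: c => a b /=.
have cM (e : R) (Y : T -> R) : all_moments P Y -> all_moments P ((fun=> e) \* Y).
  by move=> hY; apply: all_momentsM => //; exact: all_moments_cst.
rewrite !rED ?rEN ?rEZ //; try exact: cM; try (apply: all_momentsN; exact: cM).
Qed.

Lemma EC_sum (K : Type) (s : seq K) (p : pred K) (X : K -> T -> R[i]) :
  (forall k, p k -> Lc (X k)) ->
  EC (fun w => \sum_(k <- s | p k) X k w) = \sum_(k <- s | p k) EC (X k).
Proof.
move=> h; elim: s => [|k s IH].
  rewrite big_nil -[RHS]EC_cst; congr (EC _).
  by apply/funext => w; rewrite big_nil.
rewrite big_cons -IH; case: ifP => pk.
  rewrite -ECD; [|exact: h|exact: Lc_sum].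
  by apply: EC_ext => w; rewrite big_cons pk.
by apply: EC_ext => w; rewrite big_cons pk.
Qed.

Lemma EC_law X Y : Lc X -> Lc Y ->
  (forall B, measurable B -> P ((fun w => complex.Re (X w)) @^-1` B) =
                             P ((fun w => complex.Re (Y w)) @^-1` B)) ->
  (forall B, measurable B -> P ((fun w => complex.Im (X w)) @^-1` B) =
                             P ((fun w => complex.Im (Y w)) @^-1` B)) ->
  EC X = EC Y.
Proof.
move=> /LcP[rX iX] /LcP[rY iY] hr hi; rewrite !ECE.
by congr (_ +i* _); apply: rE_law.
Qed.

Lemma EC_indep (G H : set (set T)) X Y : Lc X -> Lc Y ->
  (forall E F, <<s G >> E -> <<s H >> F -> P (E `&` F) = (P E * P F)%E) ->
  cmeas (X : g_sigma_algebraType G -> R[i]) -> cmeas (Y : g_sigma_algebraType H -> R[i]) ->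
  EC (fun w => X w * Y w) = EC X * EC Y.
Proof.
move=> /LcP[rX iX] /LcP[rY iY] ind [mrX miX] [mrY miY]; rewrite !ECE ReM ImM.
have ii (f g : T -> R) : all_moments P f -> all_moments P g ->
    measurable_fun [set: g_sigma_algebraType G] f ->
    measurable_fun [set: g_sigma_algebraType H] g -> rE P (f \* g) = rE P f * rE P g.
  move=> hf hg mf mg; apply: rE_indep => // A B mA mB; apply: ind.
    by have := mf measurableT A mA; rewrite setTI.
  by have := mg measurableT B mB; rewrite setTI.
rewrite !rED ?rEN ?ii //; try (apply: all_momentsM => //);
  try (apply: all_momentsN; apply: all_momentsM => //).
Qed.

End ComplexExpectation.

Definition mx_tuple (R : realType) (n N : nat) : Type := 'I_n -> 'M[R[i]]_N.+1.
HB.instance Definition _ R n N := gen_eqMixin (mx_tuple R n N).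
HB.instance Definition _ R n N := gen_choiceMixin (mx_tuple R n N).
HB.instance Definition _ R n N := isPointed.Build (mx_tuple R n N) (fun=> 0).

Definition mx_events (R : realType) (n N : nat) : set (set (mx_tuple R n N)) :=
  [set Z | exists k i j B, @borelC R B /\
    Z = [set M : 'I_n -> 'M[R[i]]_N.+1 | B (M k i j)]].

Section Ensembles.
Context (R : realType) (d : measure_display) (T : measurableType d) (P : probability T R).
Variable N : nat.
Local Notation RM := (T -> 'M[R[i]]_N.+1).
Implicit Types (S : set RM).

Definition entry_events S : set (set T) :=
  [set E | exists A i j B, [/\ S A, @borelC R B & E = [set w | B (A w i j)]]].

Lemma EC_unitarily_invariant S n (A : 'I_n -> RM) (U : 'M[R[i]]_N.+1)
    (g : ('I_n -> 'M[R[i]]_N.+1) -> R[i]) :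
  unitarily_invariant P S -> (forall k, S (A k)) -> U \is unitarymx ->
  cmeas (g : g_sigma_algebraType (@mx_events R n N) -> R[i]) ->
  Linfty_minus P (fun w => g (fun k => A k w)) ->
  Linfty_minus P (fun w => g (fun k => U *m A k w *m (U ^t*)%sesqui)) ->
  expectationC P (fun w => g (fun k => A k w)) =
  expectationC P (fun w => g (fun k => U *m A k w *m (U ^t*)%sesqui)).
Proof.
move=> ui SA uU [mr mi] L1 L2; apply: EC_law => // B mB.
  apply: (ui n A SA U uU ((fun M => complex.Re (g M)) @^-1` B)).
  by have := mr measurableT B mB; rewrite setTI.
apply: (ui n A SA U uU ((fun M => complex.Im (g M)) @^-1` B)).
by have := mi measurableT B mB; rewrite setTI.
Qed.

Lemma EC_independent_ensembles S1 S2 (X Y : T -> R[i]) :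
  independent_ensembles P S1 S2 -> Linfty_minus P X -> Linfty_minus P Y ->
  cmeas (X : g_sigma_algebraType (entry_events S1) -> R[i]) ->
  cmeas (Y : g_sigma_algebraType (entry_events S2) -> R[i]) ->
  expectationC P (fun w => X w * Y w) = expectationC P X * expectationC P Y.
Proof. by move=> ind LX LY mX mY; apply: EC_indep LX LY ind mX mY. Qed.

End Ensembles.

Close Scope classical_set_scope.
Local Open Scope complex_scope.

(** * Moments of unitarily invariant ensembles *)

Section ExpectedProducts.
Context (R : realType) (d : measure_display) (T : measurableType d) (P : probability T R).
Variables (n N : nat).
Local Notation Lc := (Linfty_minus P).
Local Notation EC := (expectationC P).
Local Notation asg := {ffun 'I_n -> 'I_N.+1}.
Implicit Types (B : {set 'I_n}) (U : part 'I_n).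

Lemma EC_avg (F : asg -> T -> R[i]) : (forall x, Lc (F x)) ->
  EC (fun w => avg (fun x => F x w)) = avg (fun x => EC (F x)).
Proof. by move=> hF; rewrite /avg ECZ ?EC_sum //; apply: Lc_sum. Qed.

Lemma EC_prod_sum B (Y : 'I_n -> 'I_N.+1 -> T -> R[i]) : (forall k p, Lc (Y k p)) ->
  EC (fun w => \prod_(k in B) \sum_p Y k p w) =
  N.+1%:R ^+ #|B| * avg (fun x : asg => EC (fun w => \prod_(k in B) Y k (x k) w)).
Proof.
move=> hY; rewrite -EC_avg; last by move=> x; apply: Lc_prod.
rewrite -ECZ; last first.
  by rewrite /avg; apply: LcZ; apply: Lc_sum => x _; apply: Lc_prod.
apply: EC_ext => w.
rewrite (@avg_prod _ _ _ _ _ (fun k => [set k])) => [|i j _ _ nij|j _ x y e].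
- rewrite -prodr_const -big_split; apply: eq_bigr => k _.
  by rewrite [RHS](avg_proj k (fun p => Y k p w)).
- by rewrite disjoints1 inE.
- by rewrite e ?inE.
Qed.

(** The factor of a block depends on the coordinates of that block only, so the blockwise averages
    combine into a single one. *)
Lemma prod_EC_prod_sum U (Y : 'I_n -> 'I_N.+1 -> T -> R[i]) : (forall k p, Lc (Y k p)) ->
  \prod_(B in blocks U) EC (fun w => \prod_(k in B) \sum_p Y k p w) =
  \sum_(x : asg) \prod_(B in blocks U) EC (fun w => \prod_(k in B) Y k (x k) w).
Proof.
move=> hY; rewrite sum_avg (@avg_prod _ _ _ _ _ (fun B => B)).
- under eq_bigr => B _ do rewrite EC_prod_sum //.
  rewrite big_split /= -expr_sum; congr (_ ^+ _ * _).
  by rewrite -cardsT (card_partition (part_partition U)).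
- by have /finset.trivIsetP := part_triv U.
- move=> B _ x y e; apply: EC_ext => w.
  by apply: eq_bigr => k kB; rewrite e.
Qed.

Definition Lmx (X : T -> 'M[R[i]]_N.+1) := forall i j, Lc (fun w => X w i j).

Lemma Lmx_mul X Y : Lmx X -> Lmx Y -> Lmx (fun w => X w *m Y w).
Proof.
move=> hX hY i j.
rewrite (_ : (fun w => _) = fun w => \sum_k X w i k * Y w k j); last first.
  by apply/boolp.funext => w; rewrite mxE.
by apply: Lc_sum => k _; apply: LcM.
Qed.

Lemma Lmx_cst (g : 'M[R[i]]_N.+1) : Lmx (fun=> g).
Proof. by move=> i j; apply: Lc_cst. Qed.

Definition same_products B (X Y : 'I_n -> T -> 'M[R[i]]_N.+1) :=
  forall i j : 'I_n -> 'I_N.+1,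
    EC (fun w => \prod_(k in B) X k w (i k) (j k)) =
    EC (fun w => \prod_(k in B) Y k w (i k) (j k)).

Lemma same_products_comb B X Y (c : 'I_n -> 'I_N.+1 -> R[i]) (u v : 'I_n -> 'I_N.+1 -> 'I_N.+1) :
  (forall k, Lmx (X k)) -> (forall k, Lmx (Y k)) -> same_products B X Y ->
  EC (fun w => \prod_(k in B) \sum_p c k p * X k w (u k p) (v k p)) =
  EC (fun w => \prod_(k in B) \sum_p c k p * Y k w (u k p) (v k p)).
Proof.
move=> hX hY e.
have E Z : (forall k, Lmx (Z k)) ->
    EC (fun w => \prod_(k in B) \sum_p c k p * Z k w (u k p) (v k p)) =
    N.+1%:R ^+ #|B| * avg (fun x : asg => \prod_(k in B) c k (x k) *
       EC (fun w => \prod_(k in B) Z k w (u k (x k)) (v k (x k)))).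
  move=> hZ; rewrite (@EC_prod_sum _ (fun k p w => c k p * Z k w (u k p) (v k p))) => [|k p].
    congr (_ * _); apply: eq_avg => x; rewrite -ECZ; last by apply: Lc_prod => k _; apply: hZ.
    by apply: EC_ext => w; rewrite big_split.
  by apply: LcZ; apply: hZ.
rewrite !E //; congr (_ * _); apply: eq_avg => x.
by rewrite (e (fun k => u k (x k)) (fun k => v k (x k))).
Qed.

Lemma same_products_mull B X Y (g : 'M[R[i]]_N.+1) :
  (forall k, Lmx (X k)) -> (forall k, Lmx (Y k)) -> same_products B X Y ->
  same_products B (fun k w => g *m X k w) (fun k w => g *m Y k w).
Proof.
move=> hX hY e i j; have E Z : EC (fun w => \prod_(k in B) (g *m Z k w) (i k) (j k)) =
    EC (fun w => \prod_(k in B) \sum_p g (i k) p * Z k w p (j k)).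
  by apply: EC_ext => w; apply: eq_bigr => k _; rewrite mxE.
by rewrite !E; apply: (same_products_comb (fun k p => g (i k) p) (fun _ p => p) (fun k _ => j k)).
Qed.

Lemma same_products_mulr B X Y (g : 'M[R[i]]_N.+1) :
  (forall k, Lmx (X k)) -> (forall k, Lmx (Y k)) -> same_products B X Y ->
  same_products B (fun k w => X k w *m g) (fun k w => Y k w *m g).
Proof.
move=> hX hY e i j; have E Z : EC (fun w => \prod_(k in B) (Z k w *m g) (i k) (j k)) =
    EC (fun w => \prod_(k in B) \sum_p g p (j k) * Z k w (i k) p).
  apply: EC_ext => w; apply: eq_bigr => k _; rewrite mxE.
  by apply: eq_bigr => p _; rewrite mulrC.
by rewrite !E; apply: (same_products_comb (fun k p => g p (j k)) (fun k _ => i k) (fun _ p => p)).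
Qed.

(** Expectations are taken coefficientwise in the random polynomial given by the product of the
    [a k + b k X]: its degree is bounded uniformly in w and its coefficients have all moments. *)
Lemma EC_prod_line_poly B (a b : 'I_n -> T -> R[i]) :
  (forall k, Lc (a k)) -> (forall k, Lc (b k)) ->
  exists p : {poly R[i]}, forall t,
    EC (fun w => \prod_(k in B) (a k w + t * b k w)) = p.[t].
Proof.
move=> ha hb.
pose good (q : T -> {poly R[i]}) := (exists m, forall w, (size (q w) <= m)%N) /\
  forall l, Lc (fun w => (q w)`_l).
have good1 : good (fun=> 1).
  by split=> [|l]; [exists (size (1 : {poly R[i]}))|exact: Lc_cst].
have goodM q r : good q -> good r -> good (fun w => q w * r w).
  move=> [[m hm] hq] [[m' hm'] hr]; split.
    exists (m + m').-1 => w; apply: leq_trans (size_polyMleq _ _) _.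
    by rewrite -!subn1 leq_sub2r // leq_add.
  move=> l; rewrite (_ : (fun w => _) = fun w => \sum_(i < l.+1) (q w)`_i * (r w)`_(l - i)).
    by apply: Lc_sum => k _; apply: LcM.
  by apply/boolp.funext => w; rewrite coefM.
have goodk k : good (fun w => (a k w)%:P + (b k w) *: 'X).
  split=> [|l].
    exists 2%N => w; apply: leq_trans (size_polyD _ _) _; rewrite geq_max.
    rewrite (leq_trans (size_polyC_leq1 _)) //=.
    by apply: leq_trans (size_scale_leq _ _) _; rewrite size_polyX.
  rewrite (_ : (fun w => _) = fun w => (if l == 0%N then a k w else 0) +
       (l == 1%N)%:R * b k w).
    apply: LcD; last exact: LcZ.
    by case: (l == 0%N) => //; exact: Lc_cst.
  by apply/boolp.funext => w; rewrite coefD coefC coefZ coefX mulrC.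
have [[m hm] hq] : good (fun w => \prod_(k in B) ((a k w)%:P + (b k w) *: 'X)).
  elim: index_enum => [|k s IH].
    by rewrite (_ : (fun w => _) = fun=> 1) //; apply/boolp.funext => w; rewrite big_nil.
  rewrite (_ : (fun w => _) = fun w =>
    (if k \in B then (a k w)%:P + (b k w) *: 'X else 1) *
    \prod_(k <- s | k \in B) ((a k w)%:P + (b k w) *: 'X)).
    by apply: goodM => //; case: (k \in B).
  by apply/boolp.funext => w; rewrite big_cons; case: (k \in B); rewrite ?mul1r.
exists (\poly_(l < m) EC (fun w => (\prod_(k in B) ((a k w)%:P + (b k w) *: 'X))`_l)) => t.
rewrite horner_poly.
transitivity (EC (fun w => \sum_(l < m)
    t ^+ l * (\prod_(k in B) ((a k w)%:P + (b k w) *: 'X))`_l)).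
  apply: EC_ext => w.
  transitivity ((\prod_(k in B) ((a k w)%:P + (b k w) *: 'X)).[t]).
    rewrite horner_prod; apply: eq_bigr => k _.
    by rewrite hornerD hornerC hornerZ hornerX mulrC.
  by rewrite (horner_coef_wide _ (hm w)); apply: eq_bigr => l _; rewrite mulrC.
rewrite EC_sum => [|l _]; last exact: LcZ.
by apply: eq_bigr => l _; rewrite ECZ // mulrC.
Qed.

Lemma poly_eq_inf (p q : {poly R[i]}) (z : nat -> R[i]) : injective z ->
  (forall m, p.[z m] = q.[z m]) -> p = q.
Proof.
move=> zi e; apply/eqP; rewrite -subr_eq0; apply: contraT => n0.
have := @max_poly_roots _ (p - q) (map z (iota 0 (size (p - q)))) n0.
rewrite size_map size_iota ltnn => -> //.
  by apply/allP => _ /mapP[m _ ->]; rewrite /root hornerD hornerN e subrr.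
by rewrite map_inj_uniq ?iota_uniq.
Qed.

(* Both sides are polynomials in t. *)
Lemma same_products_line B (X Y X' Y' : 'I_n -> T -> 'M[R[i]]_N.+1) (z : nat -> R[i]) :
  (forall k, Lmx (X k)) -> (forall k, Lmx (Y k)) ->
  (forall k, Lmx (X' k)) -> (forall k, Lmx (Y' k)) -> injective z ->
  (forall m, same_products B (fun k w => X k w + z m *: X' k w)
                             (fun k w => Y k w + z m *: Y' k w)) ->
  forall t, same_products B (fun k w => X k w + t *: X' k w)
                            (fun k w => Y k w + t *: Y' k w).
Proof.
move=> hX hY hX' hY' zi h t i j.
have E (Z Z' : 'I_n -> T -> 'M[R[i]]_N.+1) s :
    EC (fun w => \prod_(k in B) (Z k w + s *: Z' k w) (i k) (j k)) =
    EC (fun w => \prod_(k in B) (Z k w (i k) (j k) + s * Z' k w (i k) (j k))).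
  by apply: EC_ext => w; apply: eq_bigr => k _; rewrite !mxE.
have [p hp] := @EC_prod_line_poly B (fun k w => X k w (i k) (j k))
  (fun k w => X' k w (i k) (j k)) (fun k => hX k _ _) (fun k => hX' k _ _).
have [q hq] := @EC_prod_line_poly B (fun k w => Y k w (i k) (j k))
  (fun k w => Y' k w (i k) (j k)) (fun k => hY k _ _) (fun k => hY' k _ _).
rewrite !E hp hq (poly_eq_inf zi (p := p) (q := q)) // => m.
by rewrite -hp -hq -!E; apply: h.
Qed.

Section Invariant.
Variable S : set (T -> 'M[R[i]]_N.+1).
Hypothesis S_sub : classical_sets.subset S (@moment_mx R d T P N).
Hypothesis S_inv : unitarily_invariant P S.
Variable A : 'I_n -> T -> 'M[R[i]]_N.+1.
Hypothesis SA : forall k, S (A k).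

Lemma LmxA k : Lmx (A k). Proof. exact: S_sub. Qed.

(** For unitary U, invariance is applied to the product of the entries of the M_k U: at M = A it
    gives A U, at M = U A U^* it gives U A. Products and lines then lead to every g. *)
Lemma same_products_comm B (g : 'M[R[i]]_N.+1) :
  same_products B (fun k w => g *m A k w) (fun k w => A k w *m g).
Proof.
have LA := LmxA; have Lg := Lmx_cst.
have LgA h k : Lmx (fun w => h *m A k w) by apply: Lmx_mul.
have LAg h k : Lmx (fun w => A k w *m h) by apply: Lmx_mul.
apply: (@Q_all _ _ (fun g => same_products B (fun k w => g *m A k w)
                                             (fun k w => A k w *m g))).
- move=> U uU i j.
  pose f (M : 'I_n -> 'M[R[i]]_N.+1) := \prod_(k in B) (M k *m U) (i k) (j k).
  have := @EC_unitarily_invariant _ _ _ P N S n A U f S_inv SA uU.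
  have LU w k : (U *m A k w *m (U ^t*)%sesqui *m U) = U *m A k w.
    by rewrite mulmxKtV.
  move=> -> //.
  + apply: EC_ext => w; rewrite /f; apply: eq_bigr => k _.
    by rewrite LU.
  + rewrite /f; apply: cmeas_prod => k _.
    rewrite (_ : (fun M : g_sigma_algebraType (@mx_events R n N) => (M k *m U) (i k) (j k)) =
      fun M => \sum_p M k (i k) p * U p (j k)); last first.
      by apply/boolp.funext => M; rewrite mxE.
    apply: cmeas_sum => p _; apply: cmeasM; last exact: cmeas_cst.
    apply: gen_cmeas => D bD; exists k, (i k), p, D.
    by split.
  + by apply: Lc_prod => k _; apply: LAg.
  + rewrite /f (_ : (fun w => _) = fun w => \prod_(k in B) (U *m A k w) (i k) (j k)).
      by apply: Lc_prod => k _; apply: LgA.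
    by apply/boolp.funext => w; apply: eq_bigr => k _; rewrite LU.
- move=> g1 g2 h1 h2 i j.
  transitivity (EC (fun w => \prod_(k in B) (g1 *m (A k w *m g2)) (i k) (j k))).
    have := @same_products_mull B _ _ g1 (LgA g2) (LAg g2) h2 i j => <-.
    by apply: EC_ext => w; apply: eq_bigr => k _; rewrite mulmxA.
  have := @same_products_mulr B _ _ g2 (LgA g1) (LAg g1) h1 i j.
  under [in X in X = _ -> _]eq_fun => w do under eq_bigr => k _ do rewrite -mulmxA.
  move=> ->.
  by apply: EC_ext => w; apply: eq_bigr => k _; rewrite mulmxA.
- move=> g1 g2 z zi h t.
  have := @same_products_line B _ _ _ _ z (LgA g1) (LAg g1) (LgA g2) (LAg g2) zi _ t.
  have E s : (fun k w => (g1 + s *: g2) *m A k w) = (fun k w => g1 *m A k w + s *: (g2 *m A k w)).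
    by apply/boolp.funext => k; apply/boolp.funext => w; rewrite mulmxDl scalemxAl.
  have E' s : (fun k w => A k w *m (g1 + s *: g2)) = (fun k w => A k w *m g1 + s *: (A k w *m g2)).
    by apply/boolp.funext => k; apply/boolp.funext => w; rewrite mulmxDr scalemxAr.
  by rewrite E E'; apply => m; rewrite -E -E'; apply: h.
Qed.

End Invariant.
End ExpectedProducts.

Section InvariantMoments.
Context (R : realType) (d : measure_display) (T : measurableType d) (P : probability T R).
Variables (n N : nat).
Local Notation EC := (expectationC P).
Implicit Types (B : {set 'I_n}) (U : part 'I_n).

Definition entry_moment (A : 'I_n -> T -> 'M[R[i]]_N.+1) U (i j : 'I_n -> 'I_N.+1) :=
  \prod_(B in blocks U) EC (fun w => \prod_(k in B) A k w (i k) (j k)).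

Variable S : set (T -> 'M[R[i]]_N.+1).
Hypothesis S_sub : classical_sets.subset S (@moment_mx R d T P N).
Hypothesis S_inv : unitarily_invariant P S.
Variable A : 'I_n -> T -> 'M[R[i]]_N.+1.
Hypothesis SA : forall k, S (A k).
Hypothesis nN : (n <= N.+1)%N.

Let e (k : 'I_n) : 'I_N.+1 := widen_ord nN k.

Let e_inj : injective e.
Proof. by move=> k l /(congr1 val) /= h; apply: val_inj. Qed.

(* Commute with the projection killing the vector e_m. *)
Lemma entry_moment_support U i : entry_moment A U i e != 0 ->
  exists2 rho : 'S_n, finer (pcyc rho) U & forall k, i k = e (rho k).
Proof.
move=> nz.
have ex m : exists2 k, eqv U m k & i k = e m.
  set B := finset.pblock U m.
  have UB : B \in blocks U by apply: pblock_part.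
  have nB : EC (fun w => \prod_(k in B) A k w (i k) (e k)) != 0.
    by apply: contraNneq nz => z; rewrite /entry_moment (bigD1 B) //= z mul0r.
  have [/exists_inP[k kB /eqP ik]|] := boolP [exists k in B, i k == e m].
    by exists k.
  rewrite negb_exists_in => /forall_inP h; case/eqP: nB.
  pose p : 'rV[R[i]]_N.+1 := \row_v (v != e m)%:R.
  have := same_products_comm S_sub S_inv SA B (diag_mx p) i e.
  rewrite (_ : (fun w => \prod_(k in B) (diag_mx p *m A k w) (i k) (e k)) =
    fun w => \prod_(k in B) A k w (i k) (e k)); last first.
    apply/boolp.funext => w; apply: eq_bigr => k kB.
    by rewrite mul_diag_mx !mxE h // mul1r.
  move=> ->; rewrite -[RHS](EC_cst P); apply: EC_ext => w.
  rewrite (bigD1 m) /=; last exact: eqv_refl.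
  by rewrite mul_mx_diag !mxE eqxx mulr0 mul0r.
(* f picks, in the block of m, a position with row index [e m]. It is injective since e is, and rho
   is its inverse. *)
have /boolp.choice[f fP] : forall m, exists k, eqv U m k /\ i k = e m.
  by move=> m; have [k mk ik] := ex m; exists k.
have fi : injective f.
  by move=> k l h; apply: e_inj; rewrite -(fP k).2 h (fP l).2.
exists (perm fi)^-1%g => [|k]; last first.
  by rewrite -(fP _).2 -[f _](permE fi) permKV.
apply/finer_pcycP => k; rewrite eqv_sym.
by have := (fP ((perm fi)^-1%g k)).1; rewrite -[f _](permE fi) permKV.
Qed.

(* Write the column index j as the image of e under the matrix g sending
   e_k to j_k, and move g to the left. *)
Lemma entry_moment_expansion U (i j : 'I_n -> 'I_N.+1) :
  entry_moment A U i j = \sum_(rho : 'S_n | finer (pcyc rho) U)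
    entry_moment A U (fun k => e (rho k)) e * \prod_k (i k == j (rho k))%:R.
Proof.
pose g : 'M[R[i]]_N.+1 :=
  \matrix_(u, v) (if [pick k | e k == v] is Some k then (u == j k)%:R else 0).
have gE u k : g u (e k) = (u == j k)%:R.
  rewrite mxE; case: pickP => [l /eqP/e_inj->//|/(_ k)]; by rewrite eqxx.
have LA := LmxA S_sub SA.
transitivity (entry_moment (fun k w => A k w *m g) U i e).
  apply: eq_bigr => B _; apply: EC_ext => w; apply: eq_bigr => k _.
  rewrite mxE (bigD1 (j k)) //= gE eqxx mulr1 big1 ?addr0 // => p /negbTE np.
  by rewrite gE np mulr0.
transitivity (entry_moment (fun k w => g *m A k w) U i e).
  by apply: eq_bigr => B _; rewrite (same_products_comm S_sub S_inv SA).
transitivity (\sum_(x : {ffun 'I_n -> 'I_N.+1})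
    (\prod_k g (i k) (x k)) * entry_moment A U x e).
  transitivity (\prod_(B in blocks U) EC (fun w => \prod_(k in B)
      \sum_p g (i k) p * A k w p (e k))).
    apply: eq_bigr => B _; apply: EC_ext => w.
    by apply: eq_bigr => k _; rewrite mxE.
  rewrite (@prod_EC_prod_sum _ _ _ _ _ _ U (fun k p w => g (i k) p * A k w p (e k))).
    apply: eq_bigr => x _.
    have -> : \prod_k g (i k) (x k) = \prod_(B in blocks U) \prod_(k in B) g (i k) (x k).
      rewrite -(set_partition_big _ (part_partition U)).
      by apply: eq_bigl => k; rewrite inE.
    rewrite -big_split; apply: eq_bigr => B _ /=.
    rewrite -ECZ; last by apply: Lc_prod => k _; apply: LA.
    by apply: EC_ext => w; rewrite big_split.
  by move=> k p; apply: LcZ; apply: LA.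
(* By [entry_moment_support] only the index functions of this form contribute to the sum over x. *)
pose h (rho : 'S_n) : {ffun 'I_n -> 'I_N.+1} := [ffun k => e (rho k)].
have hi : injective h.
  by move=> r s /ffunP rs; apply/permP => k; have := rs k; rewrite !ffunE => /e_inj.
rewrite (bigID (fun x => x \in h @: [set rho : 'S_n | finer (pcyc rho) U])) /=.
rewrite [X in _ + X]big1 ?addr0 => [|x nx]; last first.
  have [->|/entry_moment_support[rho fr ek]] := eqVneq (entry_moment A U x e) 0.
    by rewrite mulr0.
  case/imsetP: nx; exists rho; first by rewrite inE.
  by apply/ffunP => k; rewrite ffunE.
rewrite big_imset /=; last by move=> r s _ _; apply: hi.
apply: eq_big => [rho|rho _]; first by rewrite inE.
rewrite mulrC; congr (_ * _).
  by apply: eq_bigr => B _; apply: EC_ext => w;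
    apply: eq_bigr => k _; rewrite ffunE.
by apply: eq_bigr => k _; rewrite ffunE gE.
Qed.

End InvariantMoments.

(** If Z does not refine U, it refines no V below U either, so the triangular system at U has only
    zero terms. *)
Lemma moebius_support (C : comNzRingType) (T : finType) (Z : part T) (f g : part T -> C) :
  (forall U, f U = \sum_(V : part T | finer V U) g V) ->
  (forall U : part T, ~~ finer Z U -> f U = 0) ->
  forall U : part T, ~~ finer Z U -> g U = 0.
Proof.
move=> fg f0 U; have [m hm] := ubnP (#|T| - nblocks U)%N.
elim: m U hm => // m IH U hm nU; have := fg U; rewrite f0 // (bigD1 U) ?finer_refl //=.
rewrite big1 ?addr0 // => V /andP[VU nVU]; have := finer_lt VU nVU => lt.
by apply: IH; [lia|apply: contra nU => ZV; apply: finer_trans ZV VU].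
Qed.

Lemma exprz_sum (F : fieldType) (x : F) (J : Type) (r : seq J) (p : pred J) (f : J -> int) :
  x != 0 -> x ^ (\sum_(j <- r | p j) f j) = \prod_(j <- r | p j) x ^ f j.
Proof.
move=> x0; elim: r => [|j r IH]; first by rewrite !big_nil expr0z.
by rewrite !big_cons; case: (p j) => //; rewrite expfzDr // IH.
Qed.

Section CycleCounting.
Variables (n : nat).
Implicit Types (s : 'S_n) (V : part 'I_n).

Lemma porbit_fconnect s i j : (j \in porbit s i) = fconnect s i j.
Proof.
apply/porbitP/idP => [[m ->]|/iter_findex <-].
  have -> : (s ^+ m)%g i = iter m s i by elim: m => [|m IH]; rewrite ?perm1 // expgSr permM IH.
  exact: fconnect_iter.
exists (findex s i j); elim: (findex s i j) => [|m IH]; rewrite ?perm1 //.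
by rewrite expgSr permM -IH.
Qed.

Lemma finer_stable s V B : finer (pcyc s) V -> B \in blocks V -> stable s B.
Proof.
move=> /finer_pcycP h VB; apply/forall_inP => j jB.
by rewrite -(eqv_block _ VB jB); apply: h.
Qed.

Lemma not_finer_stable s V : ~~ finer (pcyc s) V ->
  exists2 B, B \in blocks V & ~~ stable s B.
Proof.
move=> nf; apply/exists_inP; apply: contraR nf; rewrite negb_exists_in => /forall_inP h.
apply/finer_pcycP => x; have := h _ (pblock_part V x); rewrite negbK => /forall_inP.
by apply; apply: eqv_refl.
Qed.

Lemma sum_roots s V : finer (pcyc s) V ->
  (\sum_(B in blocks V) #|[pred i in B | i \in froots s]|)%N = nblocks (pcyc s).
Proof.
move=> fV; have fs : connect_sym (frel s) := fconnect_sym (@perm_inj _ s).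
rewrite /nblocks val_pcyc.
have -> : porbits s = porbit s @: [set i | i \in froots s].
  apply/setP => A; apply/imsetP/imsetP => -[i _ ->]; last by exists i.
  exists (froot s i); first by rewrite inE; exact: (roots_root fs).
  apply/eqP; rewrite eq_sym eq_porbit_mem porbit_fconnect; exact: connect_root.
rewrite card_in_imset => [|i j]; last first.
  rewrite !inE => /eqP ri /eqP rj /eqP; rewrite eq_porbit_mem porbit_fconnect => ij.
  by rewrite -ri -rj; apply/eqP; rewrite root_connect // fs.
rewrite -sum1_card (eq_bigl (fun i => (i \in [set: 'I_n]) && (i \in froots s))); last first.
  by move=> i; rewrite !inE.
rewrite (set_partition_big_cond _ (part_partition V)); apply: eq_bigr => B _.
by rewrite -sum1_card; apply: eq_bigl => i; rewrite inE.
Qed.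

End CycleCounting.

(** * Cumulants of traces at finite size *)

Section TraceCumulants.
Context (R : realType) (d : measure_display) (T : measurableType d) (P : probability T R).
Variables (n N : nat).
Local Notation EC := (expectationC P).
Local Notation RM := (T -> 'M[R[i]]_N.+1).
Local Notation asg := {ffun 'I_n -> 'I_N.+1}.
Local Notation rc := (@rescaled_cumulant R d T P N).
Implicit Types (B D : {set 'I_n}) (U V : part 'I_n) (s : 'S_n) (A : 'I_n -> RM).

Lemma prod_fctE (J : Type) (r : seq J) (f : J -> RM) w :
  (\prod_(j <- r) f j) w = \prod_(j <- r) f j w.
Proof. by elim: r => [|j r IH]; rewrite ?big_nil // !big_cons -IH. Qed.

(* The value 0 on the sets that are not unions of cycles makes the cumulants below
   range over partitions of the cycles. *)
Definition trace_moment A s D : R[i] :=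
  if stable s D then
    EC (fun w => \prod_(i in D | i \in froots s)
                    \tr (\prod_(j <- fingraph.orbit s i) A j w))
  else 0.

(** phi(V, s) without its power of N, but for every partition V: it vanishes unless V is above the
    cycles of s, so Moebius inversion can run over the whole lattice. *)
Definition phi_raw A s V : R[i] := \prod_(B in blocks V) cum (trace_moment A s) B.

Lemma cumulantE (X : seq (T -> R[i])) : cumulant P X =
  cum (fun V : {set 'I_(size X)} =>
    EC (fun w => \prod_(i in V) nth (cst 0) X i w)) finset.setT.
Proof. by []. Qed.

(** The left side is indexed by cycles and the right side by points; g sends a point to the position
    of its cycle, and [cum_fibers] applies because [trace_moment] vanishes on sets that cut a
    cycle. *)
Lemma cumulant_cycles A s B : B != finset.set0 -> stable s B ->
  cumulant P [seq (fun w => \tr (X w)) |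
    X <- [seq \prod_(j <- fingraph.orbit s i) A j | i <- enum B & i \in froots s]] =
  cum (trace_moment A s) B.
Proof.
move=> B0 sB; have fs : connect_sym (frel s) := fconnect_sym (@perm_inj _ s).
set r := [seq i <- enum B | i \in froots s].
rewrite -map_comp; set X := map _ r.
have ur : uniq r by rewrite filter_uniq // enum_uniq.
have sX : size X = size r by rewrite size_map.
have mr i : (i \in r) = (i \in B) && (i \in froots s).
  by rewrite mem_filter mem_enum andbC.
have rr x : x \in B -> froot s x \in r.
  move=> xB; rewrite mr -(fconnect_stable sB (i := x)) ?connect_root // xB /=.
  exact: (roots_root fs).
have [x0 x0B] : exists x, x \in B by apply/set0Pn.
have pos : (0 < size X)%N.
  by rewrite sX; case: r rr {X sX ur mr} => // /(_ _ x0B).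
(* The default [Ordinal pos] concerns only points outside B: for x in B the index is in range. *)
pose g x : 'I_(size X) := insubd (Ordinal pos) (index (froot s x) r).
have gE x : x \in B -> val (g x) = index (froot s x) r.
  move=> xB; have ir : (index (froot s x) r < size X)%N by rewrite sX index_mem rr.
  by rewrite val_insubd ir.
have gr q : (q < size r)%N -> val (g (nth x0 r q)) = q.
  move=> qr; have := mem_nth x0 qr; rewrite mr => /andP[qB /eqP rq].
  by rewrite gE // rq index_uniq.
have gB : g @: B = finset.setT.
  apply/setP => q; rewrite inE; have qr : (q < size r)%N by rewrite -sX.
  apply/imsetP; exists (nth x0 r q); last by apply: val_inj; rewrite /= gr.
  by have := mem_nth x0 qr; rewrite mr => /andP[].
rewrite cumulantE -gB (cum_fibers (g := g)) => [|D DB]; last first.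
  rewrite /trace_moment; case: ifP; rewrite ?eqxx // => sD _ x y xD yB exy.
  have xB := fintype.subsetP DB _ xD.
  have e : froot s x = froot s y.
    rewrite -(nth_index x0 (rr _ xB)) -(nth_index x0 (rr _ yB)).
    by rewrite -!gE // exy.
  rewrite -(fconnect_stable sD (i := x)) //.
  by rewrite -root_connect // e.
rewrite /cum; apply: eq_bigr => Q _; congr (_ * _); apply: eq_bigr => D' _.
have sD : stable s (B :&: g @^-1: D').
  apply/forall_inP => x; rewrite !inE => /andP[xB gx].
  have sxB : s x \in B by move/forall_inP: sB; apply.
  rewrite sxB; suff -> : g (s x) = g x by [].
  apply: val_inj; rewrite /= !gE //; congr (index _ _).
  by apply/eqP; rewrite root_connect // fs fconnect1.
rewrite /trace_moment sD; apply: EC_ext => w.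
transitivity (\prod_(i <- r | g i \in D') \tr (\prod_(j <- fingraph.orbit s i) A j w)).
  rewrite (big_nth x0) -sX big_mkord; apply: eq_big => [q|q _].
    have qr : (q < size r)%N by rewrite -sX.
    suff -> : g (nth x0 r q) = q by [].
    by apply: val_inj; rewrite /= gr.
  by rewrite (nth_map x0) -?sX //= prod_fctE.
rewrite big_filter_cond big_enum_cond; apply: eq_bigl => i.
by rewrite !inE andbAC -andbA; case: (i \in B) => //=; rewrite andbC.
Qed.

(** A block with r cycles brings the exponent r - 2; over all blocks these add up to the number of
    cycles minus twice the number of blocks, which is |z| - n. *)
Lemma phi_ppE A (z : pperm n) :
  phi_pp rc z A = N.+1%:R ^ (pp_len z - n%:Z) * phi_raw A (pp_perm z) (ppv z).
Proof.
have nz : N.+1%:R != 0 :> R[i] by rewrite pnatr_eq0.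
set s := pp_perm z; have fV : finer (pcyc s) (ppv z) := ppv_perm z.
rewrite /phi_pp -blocks_ppv /phi_raw -/s.
have -> : pp_len z - n%:Z =
    \sum_(B in blocks (ppv z)) (#|[pred i in B | i \in froots s]|%:Z - 2).
  have e : (nblocks (pcyc s))%:Z = \sum_(B in blocks (ppv z)) #|[pred i in B | i \in froots s]|%:Z.
    by rewrite -(sum_roots fV) (big_morph Posz PoszD (erefl _)).
  rewrite pp_lenE -/s e big_split /= sumrN; move: (\sum_(B in _) _) => S.
  rewrite (_ : \sum_(B in blocks (ppv z)) 2 = 2 * (nblocks (ppv z))%:Z); last first.
    by rewrite sumr_const -[LHS]mulr_natr; congr (_ * _); exact: natz.
  by ring.
rewrite (@exprz_sum R[i] _ _ _ _ _ nz).
rewrite -big_split /=; apply: eq_bigr => B VB.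
have {}VB : B \in blocks (ppv z) := VB.
have B0 : B != finset.set0 by exact: part_neq0 VB.
rewrite /rescaled_cumulant (cumulant_cycles _ B0 (finer_stable fV VB)).
rewrite mulrC size_map; congr (_ ^ (_%:Z - _) * _).
rewrite cardE -(size_map id) map_id; apply: perm_size; apply: uniq_perm.
- by rewrite filter_uniq // enum_uniq.
- exact: enum_uniq.
- by move=> i; rewrite mem_filter !mem_enum inE andbC.
Qed.

(** [moment_cumulant] turns the sum into a product of trace moments, which are expanded over
    indices. If a cycle of s crosses blocks of U, some block is not stable and its moment is 0. *)
Lemma phi_raw_sum A s U : (forall k, Lmx P (A k)) ->
  \sum_(V : part 'I_n | finer V U) phi_raw A s V =
  if finer (pcyc s) U then \sum_(x : asg) entry_moment P A U x (x \o s) else 0.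
Proof.
move=> hA; rewrite -moment_cumulant; case: ifP => [fU|/negbT/not_finer_stable[B UB nB]].
  rewrite sum_avg (@avg_prod _ _ _ _ _ (fun B => B)).
  - rewrite -[X in N.+1%:R ^+ X]cardsT (card_partition (part_partition U)) expr_sum.
    rewrite -big_split; apply: eq_bigr => B UB /=.
    have sB := finer_stable fU UB; rewrite /trace_moment sB.
    rewrite -EC_avg; last by move=> x; apply: Lc_prod => k _; apply: hA.
    rewrite -ECZ; last first.
      by rewrite /avg; apply: LcZ; apply: Lc_sum => x _; apply: Lc_prod => k _; apply: hA.
    by apply: EC_ext => w; rewrite (prod_traces (fun j => A j w) sB).
  - by have /finset.trivIsetP := part_triv U.
  - move=> B UB x y e; apply: EC_ext => w; apply: eq_bigr => k kB /=.
    rewrite !e //; have /forall_inP := finer_stable fU UB; exact.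
by rewrite (bigD1 B) //= /trace_moment (negbTE nB) mul0r.
Qed.

Lemma phi_raw_support A s V : (forall k, Lmx P (A k)) ->
  ~~ finer (pcyc s) V -> phi_raw A s V = 0.
Proof.
move=> hA; apply: moebius_support (fun U => esym (phi_raw_sum s U hA)) _ V => U nU.
by rewrite (negbTE nU).
Qed.

End TraceCumulants.

Lemma exprz_shuffle (F : fieldType) (x : F) (a b c : int) (k f : F) : x != 0 ->
  x ^ (a + b + c) * (k * f) = x ^ a * (x ^ b * k * (x ^ c * f)).
Proof. by move=> x0; rewrite !expfzDr //; ring. Qed.

Section PairSums.
Variables (C : comNzRingType) (n : nat).

Lemma sum_pperm (F : part 'I_n -> 'S_n -> C) :
  (forall (V : part 'I_n) s, ~~ finer (pcyc s) V -> F V s = 0) ->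
  \sum_V \sum_s F V s = \sum_(x : pperm n) F (ppv x) (pp_perm x).
Proof.
move=> F0; rewrite pair_bigA /=.
rewrite (bigID (fun p : part 'I_n * 'S_n => finer (pcyc p.2) p.1)) /=.
rewrite [X in _ + X]big1 ?addr0 => [|p]; last exact: F0.
pose h (x : pperm n) : part 'I_n * 'S_n := (ppv x, pp_perm x).
have hi : injective h.
  by move=> x y e; apply: pp_inj; [exact: (congr1 fst e)|exact: (congr1 snd e)].
rewrite (eq_bigl (fun p => p \in h @: finset.setT)).
  rewrite big_imset /=; last by move=> x y _ _; apply: hi.
  by apply: eq_bigl => x; rewrite inE.
move=> [V s] /=; apply/idP/imsetP => [fV|[x _ e]]; last first.
  by have -> : V = ppv x := congr1 fst e; have -> : s = pp_perm x := congr1 snd e;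
    apply: ppv_perm.
by exists (mkpp fV); rewrite ?inE // /h ppv_mkpp perm_mkpp.
Qed.

End PairSums.

(** * The product formula at finite size *)

Section ProductFormula.
Context (R : realType) (d : measure_display) (T : measurableType d) (P : probability T R).
Variables (n N : nat).
Local Notation EC := (expectationC P).
Local Notation RM := (T -> 'M[R[i]]_N.+1).
Local Notation asg := {ffun 'I_n -> 'I_N.+1}.
Local Notation rc := (@rescaled_cumulant R d T P N).
Local Notation nu := (N.+1%:R : R[i]).

Variables S1 S2 : set RM.
Hypothesis S1_sub : classical_sets.subset S1 (@moment_mx R d T P N).
Hypothesis S2_sub : classical_sets.subset S2 (@moment_mx R d T P N).
Hypothesis S1_inv : unitarily_invariant P S1.
Hypothesis S12 : independent_ensembles P S1 S2.
Hypothesis nN : (n <= N.+1)%N.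
Variable A : 'I_n -> RM.
Hypothesis SA : forall k, S1 (A k).

Let LA := LmxA S1_sub SA.

Lemma cmeas_entries (S : set RM) (X : 'I_n -> RM) (D : {set 'I_n}) (i j : 'I_n -> 'I_N.+1) :
  (forall k, S (X k)) ->
  cmeas ((fun w => \prod_(k in D) X k w (i k) (j k))
    : g_sigma_algebraType (entry_events S) -> R[i]).
Proof.
move=> SX; apply: cmeas_prod => k _; apply: gen_cmeas => B bB.
by exists (X k), (i k), (j k), B.
Qed.

Lemma entry_momentM (X : 'I_n -> RM) (U : part 'I_n) (i j : 'I_n -> 'I_N.+1) :
  (forall k, S2 (X k)) ->
  entry_moment P (fun k => A k * X k) U i j =
  \sum_(y : asg) entry_moment P A U i y * entry_moment P X U y j.
Proof.
move=> SX; have LX k : Lmx P (X k) by exact: S2_sub.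
transitivity (\prod_(B in blocks U) EC (fun w => \prod_(k in B)
    \sum_p A k w (i k) p * X k w p (j k))).
  by apply: eq_bigr => B _; apply: EC_ext => w; apply: eq_bigr => k _; rewrite mxE.
rewrite (@prod_EC_prod_sum _ _ _ _ _ _ U (fun k p w => A k w (i k) p * X k w p (j k))).
  apply: eq_bigr => y _; rewrite -big_split; apply: eq_bigr => B _ /=.
  rewrite -(EC_independent_ensembles S12).
  - by apply: EC_ext => w; rewrite big_split.
  - by apply: Lc_prod => k _; apply: LA.
  - by apply: Lc_prod => k _; apply: LX.
  - exact: (@cmeas_entries S1 A).
  - exact: (@cmeas_entries S2 X).
by move=> k p; apply: LcM; [apply: LA|apply: LX].
Qed.

Lemma Lmx_fctM (X : 'I_n -> RM) k : S2 (X k) -> Lmx P (A k * X k).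
Proof. by move=> /S2_sub hX; apply: Lmx_mul => //; apply: LA. Qed.

(** k0 is the Moebius inverse, in U, of the coefficients [c r U] of [entry_moment_expansion]. It is
    chosen before X, so that X = 1 can be used to determine its behaviour. *)
Lemma phi_raw_product : exists k0 : part 'I_n -> 'S_n -> R[i],
  (forall (V : part 'I_n) s, ~~ finer (pcyc s) V -> k0 V s = 0) /\
  forall X : 'I_n -> RM, (forall k, S2 (X k)) -> forall (U : part 'I_n) s,
    phi_raw P (fun k => A k * X k) s U =
    \sum_V \sum_r \sum_(W | pj V W == U) k0 V r * phi_raw P X (s * r)%g W.
Proof.
pose e (k : 'I_n) : 'I_N.+1 := widen_ord nN k.
pose c (r : 'S_n) (U : part 'I_n) : R[i] :=
  if finer (pcyc r) U then entry_moment P A U (fun k => e (r k)) e else 0.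
have /boolp.choice[g gP] r := moebius_exists (c r).
have g0 (V : part 'I_n) s : ~~ finer (pcyc s) V -> g s V = 0.
  by apply: moebius_support (gP s) _ V => U /negbTE nU; rewrite /c nU.
exists (fun V s => g s V); split=> // X SX U s.
have LX k : Lmx P (X k) by exact: S2_sub.
have LAX k : Lmx P (A k * X k) by apply: Lmx_fctM.
move: U; apply: moebius_unique => U; rewrite phi_raw_sum //.
transitivity (\sum_r c r U * \sum_(W : part 'I_n | finer W U) phi_raw P X (s * r)%g W).
  (* If the cycles of s do not refine U, both sides vanish: with r and [s * r] below U, s would be
     too. *)
  case: ifP => fU; last first.
    rewrite big1 // => r _; rewrite /c; case: ifP => rU; last by rewrite mul0r.
    rewrite phi_raw_sum // ifN ?mulr0 //; apply: contraFN fU => srU.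
    have := finer_pcycM srU (_ : finer (pcyc r^-1%g) U); rewrite mulgK; apply.
    by rewrite pcycV.
  transitivity (\sum_(r : 'S_n | finer (pcyc r) U)
      entry_moment P A U (fun k => e (r k)) e *
      \sum_(y : asg) entry_moment P X U y (y \o (s * r)%g)).
    transitivity (\sum_(x : asg) \sum_(y : asg)
        entry_moment P A U x y * entry_moment P X U y (x \o s)).
      by apply: eq_bigr => x _; rewrite entry_momentM.
    rewrite exchange_big /=.
    transitivity (\sum_(y : asg) \sum_(r : 'S_n | finer (pcyc r) U)
        entry_moment P A U (fun k => e (r k)) e *
        entry_moment P X U y (y \o (s * r)%g)).
      apply: eq_bigr => y _.
      under eq_bigr => x _ do rewrite (entry_moment_expansion S1_sub S1_inv SA nN) mulr_suml.
      rewrite exchange_big; apply: eq_bigr => r _ /=.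
      (* The deltas leave only x = y o r, and the column indices x o s become y o (s * r). *)
      pose x0 : asg := [ffun k => y (r k)].
      rewrite (bigD1 x0) //= big1 ?mulr1 => [|k _]; last by rewrite ffunE eqxx.
      rewrite big1 ?addr0 => [|x nx].
        congr (_ * _); apply: eq_bigr => B _; apply: EC_ext => w.
        by apply: eq_bigr => k _; rewrite /= ffunE permM.
      suff [k nk] : exists k, x k != y (r k).
        by rewrite (bigD1 k) //= (negbTE nk) mul0r mulr0 mul0r.
      apply/existsP; apply: contraR nx; rewrite negb_exists => /forallP h.
      apply/eqP/ffunP => k; rewrite ffunE; apply/eqP.
      by have := h k; rewrite negbK.
    by rewrite exchange_big; apply: eq_bigr => r _; rewrite mulr_sumr.
  rewrite big_mkcond; apply: eq_bigr => r _; rewrite /c; case: ifP => rU; last by rewrite mul0r.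
  by rewrite phi_raw_sum // (finer_pcycM fU rU).
transitivity (\sum_r \sum_V \sum_W \sum_(Z : part 'I_n | finer Z U)
    (pj V W == Z)%:R * (g r V * phi_raw P X (s * r)%g W)).
  apply: eq_bigr => r _; rewrite gP mulr_suml [LHS]big_mkcond; apply: eq_bigr => V _.
  rewrite mulr_sumr; transitivity (\sum_(W : part 'I_n) (finer (blocks V) U && finer W U)%:R *
      (g r V * phi_raw P X (s * r)%g W)).
    case: (finer (blocks V) U); last by rewrite big1 // => W _; rewrite mul0r.
    rewrite big_mkcond; apply: eq_bigr => W _ /=.
    by case: finer; rewrite ?mul1r ?mul0r.
  apply: eq_bigr => W _; rewrite -mulr_suml -finer_pj; congr (_ * _).
  case: (boolP (finer (pj V W) U)) => h.
    by rewrite (bigD1 (pj V W)) //= eqxx big1 ?addr0 // => Z /andP[_]; rewrite eq_sym => /negbTE->.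
  by rewrite big1 // => Z hZ; case: eqVneq => // eZ; rewrite eZ hZ in h.
transitivity (\sum_(Z : part 'I_n | finer Z U) \sum_r \sum_V \sum_W
    (pj V W == Z)%:R * (g r V * phi_raw P X (s * r)%g W)).
  rewrite [RHS]exchange_big; apply: eq_bigr => r _.
  rewrite [RHS]exchange_big; apply: eq_bigr => V _; exact: exchange_big.
apply: eq_bigr => Z _; rewrite exchange_big; apply: eq_bigr => V _.
apply: eq_bigr => r _; rewrite [RHS]big_mkcond; apply: eq_bigr => W _.
by case: eqP; rewrite ?mul1r ?mul0r.
Qed.

(** In [phi_raw_product] the permutation of X is [s * r]; taking r inverse to the permutation of x
    makes it the right factor y of z. The factor [nu ^ pp_len x] in k brings the exponent to |z| -
    |x| - |y|. *)
Lemma phi_pp_product : exists k : pperm n -> R[i],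
  forall X : 'I_n -> RM, (forall l, S2 (X l)) -> forall z : pperm n,
    phi_pp rc z (fun l => A l * X l) =
    \sum_x \sum_(y | ppmul x y == z)
      nu ^ (pp_len z - pp_len x - pp_len y) * (k x * phi_pp rc y X).
Proof.
have [k0 [k00 kP]] := phi_raw_product.
have nz : nu != 0 by rewrite pnatr_eq0.
exists (fun x => nu ^ pp_len x * k0 (ppv x) (pp_perm x)^-1%g) => X SX z.
have LX k : Lmx P (X k) by exact: S2_sub.
rewrite phi_ppE kP //.
transitivity (nu ^ (pp_len z - n%:Z) * \sum_V \sum_r \sum_(W | pj V W == ppv z)
    k0 V r^-1%g * phi_raw P X (pp_perm z * r^-1)%g W).
  congr (_ * _); apply: eq_bigr => V _; rewrite (reindex_inj invg_inj) /=.
  by apply: eq_bigr.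
rewrite (@sum_pperm _ _ (fun V r => \sum_(W | pj V W == ppv z)
    k0 V r^-1%g * phi_raw P X (pp_perm z * r^-1)%g W)); last first.
  by move=> V s nf; rewrite big1 // => W _; rewrite k00 ?mul0r // pcycV.
rewrite mulr_sumr; apply: eq_bigr => x _.
transitivity (nu ^ (pp_len z - n%:Z) * \sum_W \sum_t
   ((pj (ppv x) W == ppv z) && (t == (pp_perm z * (pp_perm x)^-1)%g))%:R *
   (k0 (ppv x) (pp_perm x)^-1%g * phi_raw P X t W)).
  congr (_ * _); rewrite big_mkcond; apply: eq_bigr => W _.
  rewrite (bigD1 (pp_perm z * (pp_perm x)^-1)%g) //= eqxx andbT big1 ?addr0.
    by case: eqP; rewrite ?mul1r ?mul0r.
  by move=> t /negbTE->; rewrite andbF mul0r.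
rewrite (@sum_pperm _ _ (fun W t =>
   ((pj (ppv x) W == ppv z) && (t == (pp_perm z * (pp_perm x)^-1)%g))%:R *
   (k0 (ppv x) (pp_perm x)^-1%g * phi_raw P X t W))); last first.
  by move=> V s nf; rewrite phi_raw_support // !mulr0.
rewrite mulr_sumr [RHS]big_mkcond; apply: eq_bigr => y _.
have -> : (pj (ppv x) (ppv y) == ppv z) && (pp_perm y == (pp_perm z * (pp_perm x)^-1)%g) =
    (ppmul x y == z).
  apply/andP/eqP => [[/eqP e1 /eqP e2]|<-]; last by rewrite ppv_prod perm_prod mulgK !eqxx.
  by apply: pp_inj; rewrite ?ppv_prod // perm_prod e2 mulgKV.
case: eqP => _; last by rewrite mul0r mulr0.
rewrite mul1r phi_ppE.
have -> : pp_len z - n%:Z = (pp_len z - pp_len x - pp_len y) + pp_len x + (pp_len y - n%:Z).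
  by ring.
exact: exprz_shuffle.
Qed.

End ProductFormula.

(** * Arguments equal to the identity matrix *)

Section RemovePoint.
Variables (C : comNzRingType) (T : finType) (k : T).
Implicit Types (U W : part T).

(** The right side depends only on the restriction of W to the complement of k; a block {k}
    contributes [F set0 = 1]. *)
Lemma prod_blocks_remove W (F : {set T} -> C) : F finset.set0 = 1 ->
  \prod_(B in blocks W) F (B :\ k)%SET =
  \prod_(D in [set D : {set T} |
    [exists x, (x != k) && (D == finset.pblock W x :\ k)%SET]]%SET) F D.
Proof.
move=> F0; rewrite (bigID (fun B : {set T} => (B :\ k)%SET == finset.set0)) /=.
rewrite big1 ?mul1r => [|B /andP[_ /eqP->]//].
pose J := [set B in blocks W | (B :\ k)%SET != finset.set0]%SET.
have inj : {in J &, injective (fun B : {set T} => (B :\ k)%SET)}.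
  move=> B1 B2; rewrite !inE => /andP[W1 /set0Pn[x x1]] /andP[W2 _] e.
  have x2 : x \in (B2 :\ k)%SET by rewrite -e.
  move: x1 x2; rewrite !inE => /andP[_ x1] /andP[_ x2].
  by rewrite -(def_pblock (part_triv W) W1 x1) (def_pblock (part_triv W) W2 x2).
transitivity (\prod_(D in (fun B : {set T} => (B :\ k)%SET) @: J) F D).
  by rewrite big_imset //; apply: eq_bigl => B; rewrite inE.
apply: eq_bigl => D; rewrite inE; apply/imsetP/existsP => [[B]|[x /andP[xk /eqP->]]].
  rewrite inE => /andP[WB /set0Pn[x]]; rewrite !inE => /andP[xk xB] ->.
  by exists x; rewrite xk (def_pblock (part_triv W) WB xB) eqxx.
exists (finset.pblock W x) => //; rewrite inE pblock_part; apply/set0Pn; exists x.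
by rewrite !inE xk; apply: eqv_refl.
Qed.

Lemma prod_blocks_cut U (F : {set T} -> C) : F finset.set0 = 1 ->
  \prod_(B in blocks (pmeet U (isolate k))) F (B :\ k)%SET =
  \prod_(B in blocks U) F (B :\ k)%SET.
Proof.
move=> F0; rewrite !prod_blocks_remove //; apply: eq_bigl => D; rewrite !inE.
apply: eq_existsb => x; have [xk|nxk //] := eqVneq x k; rewrite /= ?andbF //.
congr (_ == _); apply/setP => y; rewrite !inE; have [//|yk /=] := eqVneq y k.
have := eqv_pmeet U (isolate k) x y; rewrite /eqv => ->.
by have := eqv_isolate k x y; rewrite /eqv => ->; rewrite (negbTE nxk) (negbTE yk) andbT.
Qed.

End RemovePoint.

Section Units.
Context (R : realType) (d : measure_display) (T : measurableType d) (P : probability T R).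
Variables (n N : nat).
Local Notation EC := (expectationC P).
Local Notation RM := (T -> 'M[R[i]]_N.+1).
Local Notation asg := {ffun 'I_n -> 'I_N.+1}.
Local Notation rc := (@rescaled_cumulant R d T P N).
Local Notation nu := (N.+1%:R : R[i]).

Variables (A : 'I_n -> RM) (k : 'I_n).
Hypothesis LA : forall l, Lmx P (A l).
Hypothesis Ak : A k = 1.

Definition reduced_moment (U : part 'I_n) (i j : 'I_n -> 'I_N.+1) :=
  \prod_(B in blocks U) EC (fun w => \prod_(l in (B :\ k)%SET) A l w (i l) (j l)).

Lemma entry_moment_unit U i j :
  entry_moment P A U i j = (i k == j k)%:R * reduced_moment U i j.
Proof.
have UB := pblock_part U k; set B := finset.pblock U k in UB.
have kB : k \in B by apply: eqv_refl.
rewrite /entry_moment /reduced_moment (bigD1 B) //= [in RHS](bigD1 B) //= mulrA.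
congr (_ * _).
  rewrite -ECZ; last by apply: Lc_prod => l _; apply: LA.
  apply: EC_ext => w; rewrite (bigD1 k) //= Ak mxE; congr (_ * _).
  by apply: eq_bigl => l; rewrite !inE andbC.
apply: eq_bigr => D /andP[UD nD]; apply: EC_ext => w; apply: eq_bigl => l.
rewrite !inE; have [->|//] := eqVneq l k; apply: contraNF nD => kD.
by rewrite /B (def_pblock (part_triv U) UD kD).
Qed.

Lemma reduced_moment_cut U i j :
  reduced_moment (pmeet U (isolate k)) i j = reduced_moment U i j.
Proof.
apply: (@prod_blocks_cut _ _ k U
  (fun D => EC (fun w => \prod_(l in D) A l w (i l) (j l)))).
by rewrite -[RHS](EC_cst P); apply: EC_ext => w; rewrite big_set0.
Qed.

Lemma eq_reduced_moment U (i i' j j' : 'I_n -> 'I_N.+1) :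
  (forall l, l != k -> i l = i' l /\ j l = j' l) ->
  reduced_moment U i j = reduced_moment U i' j'.
Proof.
move=> e; apply: eq_bigr => B _; apply: EC_ext => w; apply: eq_bigr => l.
by rewrite !inE => /andP[/e[-> ->]].
Qed.

(** Keeping only the V with k lone amounts to summing below [pmeet U (isolate k)]; when s fixes k,
    the moments of U do not change under this cut, so both functions have the same sums. *)
Lemma phi_raw_unit_fix (s : 'S_n) (V : part 'I_n) :
  s k = k -> ~~ lone k V -> phi_raw P A s V = 0.
Proof.
move=> sk nV; pose g (W : part 'I_n) := if lone k W then phi_raw P A s W else 0.
suff -> : phi_raw P A s V = g V by rewrite /g (negbTE nV).
move: V {nV}; apply: moebius_unique => U.
have -> : \sum_(V : part 'I_n | finer V U) g V =
    \sum_(V : part 'I_n | finer V (pmeet U (isolate k))) phi_raw P A s V.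
  rewrite big_mkcond [RHS]big_mkcond; apply: eq_bigr => V _.
  by rewrite finer_pmeet /g /lone; case: finer; case: finer.
rewrite !phi_raw_sum // finer_pmeet [X in _ && X]lone_pcyc sk eqxx andbT.
case: ifP => // _; apply: eq_bigr => x _.
by rewrite !entry_moment_unit reduced_moment_cut.
Qed.

(* The trace of the cycle of k does not see the point k, at the cost of a
   factor N + 1 for the new cycle {k}. *)
Lemma phi_raw_unit_cut (s : 'S_n) (U : part 'I_n) : s k != k -> finer (pcyc s) U ->
  phi_raw P A s U =
  nu^-1 * phi_raw P A (tperm k (s^-1%g k) * s)%g (pmeet U (isolate k)).
Proof.
move=> sk sU; set m := s^-1%g k; set t := tperm k m; set s' := (t * s)%g.
have mk : m != k by apply: contra sk => /eqP e; rewrite -{1}e permKV.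
have ks (V : part 'I_n) : finer (pcyc s) V -> eqv V k m.
  move=> sV; have /finer_pcycP : finer (pcyc s^-1%g) V by rewrite pcycV.
  exact.
have s'k : s' k = k by rewrite permM tpermL permKV.
pose g (V : part 'I_n) := if finer (pcyc s) V then
  nu^-1 * phi_raw P A s' (pmeet V (isolate k)) else 0.
suff -> : phi_raw P A s U = g U by rewrite /g sU.
move: U {sU}; apply: moebius_unique => U; rewrite phi_raw_sum //.
case: (boolP (finer (pcyc s) U)) => sU; last first.
  rewrite big1 // => V VU; rewrite /g ifN //.
  by apply: contra sU => sV; apply: finer_trans sV VU.
have kmU := ks _ sU.
have tU : finer (pcyc t) U by rewrite finer_tperm.
have s'U : finer (pcyc s') (pmeet U (isolate k)).
  rewrite finer_pmeet [X in _ && X]lone_pcyc s'k eqxx andbT.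
  exact: finer_pcycM.
have -> : \sum_(V : part 'I_n | finer V U) g V = nu^-1 *
    \sum_(V : part 'I_n | finer V (pmeet U (isolate k))) phi_raw P A s' V.
  rewrite -big_mkcondr -mulr_sumr; congr (_ * _).
  rewrite [RHS](bigID (fun V : part 'I_n => finer (pcyc s') V)) /=.
  rewrite [X in _ = _ + X]big1 ?addr0 => [|V /andP[_ nV]]; last exact: phi_raw_support.
  (* Cutting k off and joining it to m again are inverse bijections between the V above the cycles
     of s and those above the cycles of [s'] with k lone. *)
  rewrite [RHS](reindex_onto (fun V : part 'I_n => pmeet V (isolate k))
     (fun V : part 'I_n => pj V (pcyc t))) /=; last first.
    move=> V /andP[]; rewrite finer_pmeet => /andP[VU Vi] s'V.
    apply/esym/eqP; rewrite -(@merge_lone _ (pj V (pcyc t)) V k m) //.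
    by rewrite -finer_tperm finer_pjr.
  apply: eq_bigl => V; apply/andP/andP => [[VU sV]|[/andP[hV hs'] /eqP e]].
    rewrite pmeet_isolate_merge ?ks //; split=> //.
    rewrite !finer_pmeet finer_pmeetr andbT [X in _ && (_ && X)]lone_pcyc s'k eqxx andbT.
    rewrite (finer_trans (finer_pmeetl _ _) VU) /=.
    by apply: finer_pcycM => //; rewrite finer_tperm ks.
  have h1 : finer (pcyc t) V by rewrite -e finer_pjr.
  split.
    rewrite -e finer_pj tU andbT; apply: finer_trans hV _; exact: finer_pmeetl.
  have -> : s = (t * s')%g by rewrite /s' mulgA tperm2 mul1g.
  apply: finer_pcycM => //; apply: finer_trans hs' _; exact: finer_pmeetl.
rewrite phi_raw_sum // s'U.
pose H (x : asg) := reduced_moment U x (x \o s').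
have e1 (x : asg) : entry_moment P A U x (x \o s) = (x k == x (s k))%:R * H x.
  rewrite entry_moment_unit /=; case: eqP => [e|_]; last by rewrite !mul0r.
  congr (_ * _); apply: eq_reduced_moment => l lk; split=> //=.
  have [->|lm] := eqVneq l m; first by rewrite /s' permM tpermR permKV -e.
  by rewrite /s' permM tpermD // eq_sym.
have e2 (x : asg) : entry_moment P A (pmeet U (isolate k)) x (x \o s') = H x.
  by rewrite entry_moment_unit reduced_moment_cut /= s'k eqxx mul1r.
under eq_bigr => x _ do rewrite e1.
under [in RHS]eq_bigr => x _ do rewrite e2.
rewrite !sum_avg.
have nz : nu != 0 by rewrite pnatr_eq0.
(* H does not involve [x k], because [s'] fixes k; the constraint on [x k] therefore costs exactly
   the factor nu. *)
suff E : avg H = nu * avg (fun x : asg => (x k == x (s k))%:R * H x).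
  by rewrite [avg (fun x => H x)]E [RHS]mulrCA mulKf.
have Hk (x y : asg) : {in finset.setC [set k]%SET, x =1 y} -> H x = H y.
  move=> xy; apply: eq_reduced_moment => l lk /=; split; rewrite xy // !inE //.
  by apply: contra lk => /eqP e; rewrite -(inj_eq (@perm_inj _ s')) e s'k.
rewrite -(@avg_coord _ _ _ k (fun p (x : asg) => (p == x (s k))%:R * H x)).
  rewrite -avg_sum; apply: eq_avg => x; rewrite -mulr_suml (bigD1 (x (s k))) //= eqxx.
  by rewrite big1 ?addr0 ?mul1r // => p /negbTE->.
by move=> p x y xy; rewrite (Hk x y) // xy // !inE.
Qed.

Lemma phi_pp_unit_fix (z : pperm n) :
  pp_perm z k = k -> ~~ lone k (ppv z) -> phi_pp rc z A = 0.
Proof. by move=> h1 h2; rewrite phi_ppE phi_raw_unit_fix ?mulr0. Qed.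

(** Cutting k lowers the length of z by one, and the rescaling absorbs the factor [nu^-1] of
    [phi_raw_unit_cut]. *)
Lemma phi_pp_unit_cut (z : pperm n) :
  pp_perm z k != k -> phi_pp rc z A = phi_pp rc (cutpp k z) A.
Proof.
move=> zk; rewrite !phi_ppE ppv_mkpp perm_mkpp phi_raw_unit_cut ?ppv_perm // mulrA.
congr (_ * _); have nz : nu != 0 by rewrite pnatr_eq0.
have km : eqv (ppv z) k ((pp_perm z)^-1%g k).
  have /finer_pcycP : finer (pcyc (pp_perm z)^-1%g) (ppv z) by rewrite pcycV ppv_perm.
  exact.
have mk : (pp_perm z)^-1%g k != k.
  by apply: contra zk => /eqP e; rewrite -{1}e permKV.
rewrite -[nu^-1]/(nu ^ (-1)) -expfzDr //; congr (nu ^ _).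
rewrite !pp_lenE ppv_mkpp perm_mkpp (nblocks_cut mk km) nblocks_pcyc_cut //.
by lia.
Qed.

End Units.

Local Open Scope classical_set_scope.

(** * The limit of large matrices *)

(* Locked: a convergence statement unfolds to a product, which would otherwise
   be eliminated by unification. *)
HB.lock Definition cv (R : realType) (u : nat -> R[i]) (l : R[i]) : Prop :=
  (u : nat -> R[i]^o) @ \oo --> (l : R[i]^o).

Section ComplexLimits.
Variable R : realType.
Local Notation C := R[i].
Implicit Types (u v : nat -> C) (l m : C).

Lemma cvE u l : cv u l = ((u : nat -> C^o) @ \oo --> (l : C^o)).
Proof. by rewrite cv.unlock. Qed.

Lemma cv_cst l : cv (fun=> l) l.
Proof. rewrite cvE; exact: (@cvg_cst C^o). Qed.

Lemma cvD u v l m : cv u l -> cv v m -> cv (fun N => u N + v N) (l + m).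
Proof. rewrite !cvE => hu hv; exact: (@cvgD _ C^o _ _ _ _ _ _ _ hu hv). Qed.

Lemma cvM u v l m : cv u l -> cv v m -> cv (fun N => u N * v N) (l * m).
Proof. rewrite !cvE => hu hv; exact: (@cvgM C _ _ _ _ _ _ _ hu hv). Qed.

Lemma cvV u l : l != 0 -> cv u l -> cv (fun N => (u N)^-1) l^-1.
Proof. rewrite !cvE => l0 hu; exact: (@cvgV C _ _ _ _ _ l0 hu). Qed.

Lemma cv_sum (I : Type) (s : seq I) (p : pred I) (u : I -> nat -> C) (l : I -> C) :
  (forall i, p i -> cv (u i) (l i)) ->
  cv (fun N => \sum_(i <- s | p i) u i N) (\sum_(i <- s | p i) l i).
Proof.
move=> h; elim: s => [|i s IH].
  rewrite big_nil (_ : (fun N => _) = fun=> 0); first exact: cv_cst.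
  by apply/funext => N; rewrite big_nil.
rewrite big_cons (_ : (fun N => _) = fun N =>
    if p i then u i N + \sum_(i <- s | p i) u i N else \sum_(i <- s | p i) u i N); last first.
  by apply/funext => N; rewrite big_cons.
by case: (p i) (h i) => [/(_ isT) hi|_]; [exact: (cvD hi IH)|exact: IH].
Qed.

Lemma cv_prod (I : Type) (s : seq I) (p : pred I) (u : I -> nat -> C) (l : I -> C) :
  (forall i, p i -> cv (u i) (l i)) ->
  cv (fun N => \prod_(i <- s | p i) u i N) (\prod_(i <- s | p i) l i).
Proof.
move=> h; elim: s => [|i s IH].
  rewrite big_nil (_ : (fun N => _) = fun=> 1); first exact: cv_cst.
  by apply/funext => N; rewrite big_nil.
rewrite big_cons (_ : (fun N => _) = fun N =>
    if p i then u i N * \prod_(i <- s | p i) u i N else \prod_(i <- s | p i) u i N); last first.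
  by apply/funext => N; rewrite big_cons.
by case: (p i) (h i) => [/(_ isT) hi|_]; [exact: (cvM hi IH)|exact: IH].
Qed.

Lemma cv_near u v l : (\forall N \near \oo, u N = v N) -> cv u l -> cv v l.
Proof.
rewrite !cvE => e h; apply: cvg_trans h; apply: near_eq_cvg; apply: filterS e => N ->; reflexivity.
Qed.

Lemma cv_unique u l m : cv u l -> cv u m -> l = m.
Proof. rewrite !cvE => h1 h2; exact: (@cvg_unique C^o (@norm_hausdorff _ C^o) _ _ _ _ h1 h2). Qed.

Lemma cv_neq0 u l : l != 0 -> cv u l -> \forall N \near \oo, u N != 0.
Proof.
rewrite cvE => l0 hu; have l0' : 0 < `|l| by rewrite normr_gt0.
have /cvgrPdist_lt/(_ _ l0') := hu; apply: filterS => N.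
by apply: contraTneq => ->; rewrite subr0 ltxx.
Qed.

Lemma cv_inv_nat : cv (fun N => N.+1%:R^-1 : C) 0.
Proof.
rewrite cvE; apply/cvgrPdist_lt => e e0.
have [r r0 er] : exists2 r : R, 0 < r & e = r%:C.
  case: e e0 => a b; rewrite ltcE /= => /andP[/eqP b0 a0].
  by exists a => //; rewrite b0.
pose M := Num.trunc r^-1.
exists M => // N /= MN; rewrite sub0r normrN normfV er.
have -> : `|N.+1%:R : C| = (N.+1%:R : R)%:C by rewrite normr_nat rmorph_nat.
rewrite -fmorphV ltcR invf_plt ?posrE //.
apply: lt_le_trans (truncnS_gt _) _; by rewrite ler_nat.
Qed.

Lemma cv_pow u l k : cv u l -> cv (fun N => u N ^+ k) (l ^+ k).
Proof.
move=> h; elim: k => [|k IH]; first exact: cv_cst.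
rewrite exprS (_ : (fun N => _) = fun N => u N * u N ^+ k); first exact: cvM.
by apply/funext => N; rewrite exprS.
Qed.

Lemma cv_scale (a : int) : a <= 0 -> cv (fun N => N.+1%:R ^ a : C) (a == 0)%:R.
Proof.
case: a => [[|k]|k] //; first by move=> _; exact: cv_cst.
move=> _; rewrite (_ : (fun N => _) = fun N => N.+1%:R^-1 ^+ k.+1).
  by have := cv_pow k.+1 cv_inv_nat; rewrite expr0n.
by apply/funext => N; rewrite exprVn.
Qed.

Lemma cv_det p (M : nat -> 'M[C]_p) (L : 'M[C]_p) : (forall i j, cv (fun N => M N i j) (L i j)) ->
  cv (fun N => \det (M N)) (\det L).
Proof.
move=> h; rewrite /determinant; apply: cv_sum => s _.
by apply: cvM (cv_cst _) _; apply: cv_prod => i _; exact: h.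
Qed.

Lemma cv_adj p (M : nat -> 'M[C]_p) (L : 'M[C]_p) : (forall i j, cv (fun N => M N i j) (L i j)) ->
  forall i j, cv (fun N => (\adj (M N)) i j) ((\adj L) i j).
Proof.
move=> h i j; rewrite mxE (_ : (fun N => _) = fun N => cofactor (M N) j i); last first.
  by apply/funext => N; rewrite mxE.
apply: cvM; first exact: cv_cst.
apply: cv_det => a b; rewrite !mxE.
by rewrite (_ : (fun N => _) = fun N => M N (lift j a) (lift i b)) //;
  apply/funext => N; rewrite !mxE.
Qed.

(** Cramer's rule: determinant and adjugate are continuous in the entries, and [\det (M N)] is
    nonzero for large N. *)
Lemma cv_solve p (M : nat -> 'M[C]_p) (L : 'M[C]_p) (v w : nat -> 'rV[C]_p) (w0 : 'rV[C]_p) :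
  (forall i j, cv (fun N => M N i j) (L i j)) -> \det L != 0 ->
  (forall j, cv (fun N => w N 0 j) (w0 0 j)) ->
  (\forall N \near \oo, v N *m M N = w N) ->
  forall j, cv (fun N => v N 0 j) ((w0 *m invmx L) 0 j).
Proof.
move=> hM dL hw e j.
have uL : L \in unitmx by rewrite unitmxE unitfE.
apply: (@cv_near (fun N => (\det (M N))^-1 * (w N *m \adj (M N)) 0 j)).
  have h := cv_neq0 dL (cv_det hM).
  near=> N; rewrite -(_ : v N *m M N = w N); last by near: N.
  rewrite -mulmxA mul_mx_adj mul_mx_scalar mxE mulKf //; by near: N.
have -> : (w0 *m invmx L) 0 j = (\det L)^-1 * (w0 *m \adj L) 0 j.
  by rewrite /invmx uL -scalemxAr mxE.
apply: cvM; first by apply: cvV dL _; exact: cv_det.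
rewrite mxE (_ : (fun N => _) = fun N => \sum_k w N 0 k * (\adj (M N)) k j); last first.
  by apply/funext => N; rewrite mxE.
by apply: cv_sum => k _; apply: cvM; [exact: hw|exact: cv_adj].
Unshelve. all: by end_near. Qed.

End ComplexLimits.

Section LimitConvolution.
Variables (R : realType) (n : nat).
Local Notation C := R[i].
Local Notation weight N x y z := (N.+1%:R ^ (pp_len z - pp_len x - pp_len y) : C).

Definition zeta_mx : 'M[C]_#|{: pperm n}| :=
  \matrix_(i, j) (zeta_div (enum_val i) (enum_val j))%:R.

Lemma zeta_div_len (x z : pperm n) : zeta_div x z -> x = z \/ (pp_len x < pp_len z)%R.
Proof.
case/andP=> /eqP e1 /eqP e2.
have [e|ne] := eqVneq (pp_perm z * (pp_perm x)^-1)%g 1%g; [left|right].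
  apply: pp_inj; last by rewrite -[LHS]mul1g -e mulgKV.
  by rewrite -e1 e pjC pj_idl // finer_pcyc1.
set s := (pp_perm z * _)%g in e2 ne; rewrite -e2 ltrDl subr_gt0 ltz_nat.
have le := finer_card (finer_pcyc1 (pcyc s)); rewrite card_pcyc1 card_ord in le.
rewrite ltn_neqAle le andbT; apply: contra ne => /eqP e.
have h : pcyc 1 = pcyc s :> part 'I_n.
  by apply: finer_card_eq; [exact: finer_pcyc1|rewrite card_pcyc1 card_ord e].
apply/eqP/permP => i; rewrite perm1; apply/eqP.
by rewrite -lone_pcyc -h lone_pcyc perm1.
Qed.

(** By [zeta_div_len] the matrix is triangular for the length, with ones on the diagonal. The shift
    by n makes the length a natural number for the induction. *)
Lemma det_zeta_mx : \det zeta_mx != 0.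
Proof.
rewrite -unitfE -unitmxE -row_free_unit; apply: inj_row_free => v v0.
have h z : \sum_(x : pperm n | zeta_div x z) v 0 (enum_rank x) = 0.
  transitivity ((v *m zeta_mx) 0 (enum_rank z)); last by rewrite v0 mxE.
  rewrite big_mkcond mxE [RHS](reindex enum_rank) /=; last first.
    by exists enum_val => ? _; rewrite ?enum_rankK ?enum_valK.
  by apply: eq_bigr => x _; rewrite mxE !enum_rankK; case: zeta_div; rewrite ?mulr1 ?mulr0.
suff v1 z : v 0 (enum_rank z) = 0 by apply/rowP => i; rewrite mxE -(enum_valK i).
have pos (x : pperm n) : (0 <= pp_len x + n%:Z)%R.
  have := finer_card (finer_pcyc1 (ppv x)); rewrite card_pcyc1 card_ord pp_lenE.
  by move: (nblocks _) (nblocks _) => a b; lia.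
have [m hm] := ubnP (absz (pp_len z + n%:Z)); elim: m z hm => // m IH z hz.
have := h z; rewrite (bigD1 z) /=.
  rewrite big1 ?addr0 // => x /andP[/zeta_div_len[->|lt]]; first by rewrite eqxx.
  by move=> _; apply: IH; move: (pos x) (pos z) hz lt; lia.
rewrite /zeta_div mulgV; apply/andP; split.
  by rewrite pjC pj_idl // finer_pcyc1.
by rewrite card_pcyc1 card_ord subrr addr0.
Qed.

Lemma subr_sub_eq0 (V : zmodType) (a b c : V) : (c - a - b == 0) = (a + b == c).
Proof. by rewrite -addrA -opprD subr_eq0 eq_sym. Qed.

Lemma pp_convE2 (f g : pperm n -> C) z : pp_conv f g z =
  \sum_x \sum_(y | ppmul x y == z) (pp_len z - pp_len x - pp_len y == 0)%:R * (f x * g y).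
Proof.
rewrite pp_convE; apply: eq_bigr => x _; rewrite [RHS]big_mkcond; apply: eq_bigr => y _.
rewrite pp_mulE [z == _]eq_sym; case: eqP => [<-|_] /=; last by rewrite mul0r.
by rewrite subr_sub_eq0; case: eqP => _; rewrite ?mul1r ?mul0r.
Qed.

Lemma cv_weight (x y z : pperm n) : ppmul x y == z ->
  @cv R (fun N => weight N x y z) (pp_len z - pp_len x - pp_len y == 0)%:R.
Proof.
move=> /eqP <-; apply: cv_scale; have := pp_len_prod x y.
by move: (pp_len _) (pp_len _) (pp_len _) => p q r; lia.
Qed.

(* Only the terms with |x| + |y| = |z| survive in the limit, and there the
   system for [k] is triangular. *)
Lemma limit_convolution (fA fB fAB k : nat -> pperm n -> C) (lA lB : pperm n -> C) :
  (forall z, cv (fA ^~ z) (lA z)) -> (forall z, cv (fB ^~ z) (lB z)) ->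
  (\forall N \near \oo, forall z, fA N z = \sum_x \sum_(y | ppmul x y == z)
     weight N x y z * (k N x * pp_zeta C y)) ->
  (\forall N \near \oo, forall z, fAB N z = \sum_x \sum_(y | ppmul x y == z)
     weight N x y z * (k N x * fB N y)) ->
  exists kl : pperm n -> C, (forall z, pp_conv kl (@pp_zeta C n) z = lA z) /\
    forall z, cv (fAB ^~ z) (pp_conv kl lB z).
Proof.
move=> hA hB eA eAB.
pose M N : 'M[C]_#|{: pperm n}| := \matrix_(i, j)
  \sum_(y | ppmul (enum_val i) y == enum_val j)
    weight N (enum_val i) y (enum_val j) * pp_zeta C y.
pose v N : 'rV[C]_#|{: pperm n}| := \row_i k N (enum_val i).
pose w N : 'rV[C]_#|{: pperm n}| := \row_i fA N (enum_val i).
pose w0 : 'rV[C]_#|{: pperm n}| := \row_i lA (enum_val i).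
(* Convolving the indicator of one element with [pp_zeta] reads off an entry of the matrix. *)
have zmE i j : zeta_mx i j = \sum_(y | ppmul (enum_val i) y == enum_val j)
    (pp_len (enum_val j) - pp_len (enum_val i) - pp_len y == 0)%:R * pp_zeta C y.
  rewrite mxE; pose d x : C := (x == enum_val i)%:R.
  have := pp_conv_zeta d (enum_val j).
  rewrite [X in _ = X -> _](_ : _ = (zeta_div (enum_val i) (enum_val j))%:R); last first.
    rewrite big_mkcond (bigD1 (enum_val i)) //= /d eqxx big1 ?addr0; first by case: zeta_div.
    by move=> x /negbTE->; case: ifP.
  move=> <-; rewrite pp_convE2 (bigD1 (enum_val i)) //= [X in _ + X]big1 ?addr0.
    by apply: eq_bigr => y _; rewrite /d eqxx mul1r.
  by move=> x /negbTE nx; rewrite big1 // => y _; rewrite /d nx mul0r mulr0.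
have cM i j : cv (fun N => M N i j) (zeta_mx i j).
  rewrite zmE (_ : (fun N => _) = fun N => \sum_(y | ppmul (enum_val i) y == enum_val j)
    weight N (enum_val i) y (enum_val j) * pp_zeta C y); last first.
    by apply/funext => N; rewrite mxE.
  by apply: cv_sum => y h; apply: cvM; [exact: cv_weight|exact: cv_cst].
have cw j : cv (fun N => w N 0 j) (w0 0 j).
  rewrite mxE (_ : (fun N => _) = fA ^~ (enum_val j)); first exact: hA.
  by apply/funext => N; rewrite mxE.
have e : \forall N \near \oo, v N *m M N = w N.
  apply: filterS eA => N eN; apply/rowP => j; rewrite !mxE eN.
  rewrite [LHS](reindex enum_rank) /=; last first.
    by exists enum_val => ? _; rewrite ?enum_rankK ?enum_valK.
  apply: eq_bigr => x _; rewrite !mxE !enum_rankK mulr_sumr.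
  by apply: eq_bigr => y _; exact: mulrCA.
have ck := cv_solve cM det_zeta_mx cw e.
pose kl x := (w0 *m invmx zeta_mx) 0 (enum_rank x).
have ckl x : cv (k ^~ x) (kl x).
  rewrite /kl (_ : k ^~ x = fun N => v N 0 (enum_rank x)); first exact: ck.
  by apply/funext => N; rewrite mxE enum_rankK.
exists kl; split=> z.
  apply: (@cv_unique _ (fA ^~ z)); last exact: hA.
  apply: (@cv_near _ (fun N => \sum_x \sum_(y | ppmul x y == z)
     weight N x y z * (k N x * pp_zeta C y))).
    by apply: filterS eA => N ->.
  rewrite pp_convE2; apply: cv_sum => x _; apply: cv_sum => y h.
  by apply: cvM; [exact: cv_weight|apply: cvM; [exact: ckl|exact: cv_cst]].
apply: (@cv_near _ (fun N => \sum_x \sum_(y | ppmul x y == z)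
     weight N x y z * (k N x * fB N y))).
  by apply: filterS eAB => N ->.
rewrite pp_convE2; apply: cv_sum => x _; apply: cv_sum => y h.
by apply: cvM; [exact: cv_weight|apply: cvM; [exact: ckl|exact: hB]].
Qed.

End LimitConvolution.

Close Scope classical_set_scope.

(** * Rules for the rescaled cumulants *)

Section CumulantRules.
Context (R : realType) (d : measure_display) (T : measurableType d) (P : probability T R).
Local Notation Lc := (Linfty_minus P).
Local Notation EC := (expectationC P).

(** Indexed by a fixed ['I_m], since the index type ['I_(size X)] of [cumulant] varies with the
    list. *)
Definition cumulant_fun m (X : 'I_m -> T -> R[i]) : R[i] :=
  cum (fun V : {set 'I_m} => EC (fun w => \prod_(i in V) X i w)) finset.setT.

Lemma cumulant_funE m (X : seq (T -> R[i])) : size X = m ->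
  cumulant P X = cumulant_fun (fun i : 'I_m => nth (cst 0) X i).
Proof. by move=> <-. Qed.

Lemma eq_cumulant_fun m (X Y : 'I_m -> T -> R[i]) : (forall i, X i = Y i) ->
  cumulant_fun X = cumulant_fun Y.
Proof. by move=> e; congr cumulant_fun; apply/boolp.funext. Qed.

Lemma cumulant_fun_linear m (X Y Z : 'I_m -> T -> R[i]) (c : R[i]) p :
  (forall i, Lc (X i)) -> (forall i, Lc (Y i)) ->
  (forall i, i != p -> X i = Z i /\ Y i = Z i) ->
  Z p = (fun w => c * X p w + Y p w) ->
  cumulant_fun Z = c * cumulant_fun X + cumulant_fun Y.
Proof.
move=> LX LY e eZ; rewrite /cumulant_fun /cum mulr_sumr -big_split /=.
apply: eq_bigr => Q pQ; rewrite mulrCA -mulrDr; congr (_ * _).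
have pc : p \in finset.cover Q by rewrite (cover_partition pQ) inE.
have QB : finset.pblock Q p \in Q by rewrite pblock_mem.
set B := finset.pblock Q p in QB.
have pB : p \in B by rewrite mem_pblock.
have eD (W : 'I_m -> T -> R[i]) : (forall i, i != p -> W i = Z i) ->
    \prod_(D in Q | D != B) EC (fun w => \prod_(i in D) W i w) =
    \prod_(D in Q | D != B) EC (fun w => \prod_(i in D) Z i w).
  move=> eW; apply: eq_bigr => D /andP[QD nD]; apply: EC_ext => w.
  apply: eq_bigr => i iD; rewrite eW //; apply: contraNneq nD => ip.
  rewrite ip in iD; have /and3P[_ tQ _] := pQ.
  by rewrite /B (def_pblock tQ QD iD).
rewrite (bigD1 B) //= [in X in c * X](bigD1 B) //= [in X in _ + X](bigD1 B) //=.
rewrite (eD X) => [|i /e[]//]; rewrite (eD Y) => [|i /e[]//].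
rewrite mulrA -mulrDl; congr (_ * _).
have fB (W : 'I_m -> T -> R[i]) : (forall i, i != p -> W i = Z i) -> forall w,
    \prod_(i in B) W i w = W p w * \prod_(i in B | i != p) Z i w.
  move=> eW w; rewrite (bigD1 p) //=; congr (_ * _).
  by apply: eq_bigr => i /andP[_ ip]; rewrite eW.
rewrite -ECZ; last by apply: Lc_prod.
rewrite -ECD; [|by apply: LcZ; apply: Lc_prod|by apply: Lc_prod].
apply: EC_ext => w; rewrite (fB Z) // (fB X) => [|i /e[]//].
rewrite (fB Y) => [|i /e[]//].
by rewrite eZ mulrDl mulrA.
Qed.

Lemma cumulant_fun_perm m (X : 'I_m -> T -> R[i]) (s : 'S_m) :
  cumulant_fun (fun i => X (s i)) = cumulant_fun X.
Proof.
rewrite /cumulant_fun (cum_fibers (g := s)) => [|D _ _ x y xD _ /perm_inj <-//].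
have -> : s @: [set: 'I_m] = [set: 'I_m].
  by apply/setP => i; rewrite inE; apply/imsetP; exists (s^-1%g i); rewrite ?inE ?permKV.
apply: eq_bigr => Q _; congr (_ * _); apply: eq_bigr => D _; apply: EC_ext => w.
rewrite [RHS](reindex_inj (@perm_inj _ s)); apply: eq_bigl => i.
by rewrite !inE.
Qed.

Lemma cumulant_perm (X Y : seq (T -> R[i])) : perm_eq X Y -> cumulant P X = cumulant P Y.
Proof.
move=> XY; have sXY := perm_size XY.
have /(@tuple_permP _ _ _ (in_tuple Y))[s es] := XY.
rewrite (cumulant_funE sXY) (@cumulant_funE _ Y erefl) -(cumulant_fun_perm _ s).
apply: eq_cumulant_fun => i; rewrite es -[LHS](tnth_nth _ _ i) /=.
rewrite tnth_map tnth_ord_tuple.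
exact: tnth_nth.
Qed.

Lemma partition_set1 (I : finType) (x : I) (Q : {set {set I}}) :
  finset.partition Q [set x]%SET = (Q == [set [set x]]%SET).
Proof.
apply/idP/eqP => [pQ|->]; last first.
  apply/and3P; split; rewrite ?/finset.cover ?big_set1 //; first exact: finset.trivIset1.
  by rewrite inE eq_sym; apply/set0Pn; exists x; rewrite inE.
have n0 : finset.set0 \notin Q by case/and3P: pQ.
have e B : B \in Q -> B = [set x]%SET.
  move=> QB; apply/eqP; have := partitionS pQ QB; rewrite subset1 => /orP[//|/eqP e].
  by rewrite -e QB in n0.
apply/setP => B; rewrite inE; apply/idP/eqP => [/e//|->].
have : x \in finset.cover Q by rewrite (cover_partition pQ) inE.
by case/finset.bigcupP => B' QB' _; rewrite -(e _ QB').
Qed.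

Lemma cumulant1 (X : T -> R[i]) : cumulant P [:: X] = EC X.
Proof.
rewrite (@cumulant_funE 1) // /cumulant_fun /cum.
have e : [set: 'I_1]%SET = [set ord0]%SET by apply/setP => i; rewrite !inE ord1.
rewrite e (eq_bigl _ _ (partition_set1 ord0)) big_pred1_eq cards1 big_set1.
rewrite /moebius_coef /= expr0 mul1r mul1r.
by apply: EC_ext => w; rewrite big_set1.
Qed.

(* A constant entry forces its index to be a singleton of every partition
   that contributes. *)
Lemma cumulant_cst (c : R[i]) (X : seq (T -> R[i])) : X <> [::] ->
  (forall Y, Y \in X -> Lc Y) -> cumulant P ((fun=> c) :: X) = 0.
Proof.
case: X => // X0 X _ LX; rewrite (@cumulant_funE (size X).+2) //.
pose Y (i : 'I_(size X).+2) := nth (cst 0) ((fun=> c) :: X0 :: X) i.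
change (cumulant_fun Y = 0); have Y0 : Y ord0 = (fun=> c) by [].
have LY i : Lc (Y i).
  case: (unliftP ord0 i) => [j|] ->; last by rewrite Y0; apply: Lc_cst.
  by apply: LX; rewrite /Y lift0 /=; apply: (@mem_nth _ _ (X0 :: X)); exact: ltn_ord.
pose h (V : {set 'I_(size X).+2}) := EC (fun w => \prod_(i in V) Y i w).
pose phi (V : part 'I_(size X).+2) := \prod_(B in blocks V) cum h B.
pose g (V : part 'I_(size X).+2) := if lone ord0 V then phi V else 0.
have hE (U : part 'I_(size X).+2) : \prod_(B in blocks U) h B =
    c * \prod_(B in blocks U) h (B :\ ord0)%SET.
  have UB := pblock_part U ord0; set B := finset.pblock U ord0 in UB.
  have kB : ord0 \in B by apply: eqv_refl.
  rewrite (bigD1 B) //= [in RHS](bigD1 B) //= mulrA; congr (_ * _).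
    rewrite /h -ECZ; last by apply: Lc_prod.
    apply: EC_ext => w; rewrite (bigD1 ord0) //= Y0; congr (_ * _).
    by apply: eq_bigl => l; rewrite !inE andbC.
  apply: eq_bigr => D /andP[UD nD]; apply: EC_ext => w; apply: eq_bigl => l.
  rewrite !inE; have [->|//] := eqVneq l ord0; apply: contraNF nD => kD.
  by rewrite /B (def_pblock (part_triv U) UD kD).
have h0 : h finset.set0 = 1.
  by rewrite -[RHS](EC_cst P); apply: EC_ext => w; rewrite big_set0.
have phig : phi =1 g.
  apply: moebius_unique => U.
  have -> : \sum_(V : part _ | finer V U) g V =
      \sum_(V : part _ | finer V (pmeet U (isolate ord0))) phi V.
    rewrite big_mkcond [RHS]big_mkcond; apply: eq_bigr => V _.
    by rewrite finer_pmeet /g /lone; case: finer; case: finer.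
  by rewrite -!moment_cumulant !hE prod_blocks_cut.
(* At the one-block partition phi is the cumulant itself, and [ord0] is not lone there: there are at
   least two indices. *)
pose R1 := mkpart (fun _ _ : 'I_(size X).+2 => true).
have eR x y : eqv R1 x y by rewrite eqv_mkpart.
have eT : blocks R1 = [set [set: 'I_(size X).+2]]%SET.
  apply/setP => B; rewrite inE; apply/idP/eqP => [/part_block[x ->]|->].
    by apply/setP => y; rewrite inE; apply: eR.
  have -> : [set: 'I_(size X).+2]%SET = finset.pblock R1 ord0.
    by apply/setP => y; rewrite inE; symmetry; apply: eR.
  exact: pblock_part.
have nl : ~~ lone ord0 R1 by apply/negP => /loneP/(_ ord_max (eR _ _))/(congr1 val).
by have := phig R1; rewrite /phi eT big_set1 /g (negbTE nl).
Qed.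

End CumulantRules.

Section RescaledCumulantRules.
Context (R : realType) (d : measure_display) (T : measurableType d) (P : probability T R).
Variable N : nat.
Local Notation Lc := (Linfty_minus P).
Local Notation RM := (T -> 'M[R[i]]_N.+1).
Local Notation rc := (@rescaled_cumulant R d T P N).
Implicit Types (x y : RM) (s t : seq RM).

Definition all_Lmx s := forall x, x \in s -> Lmx P x.

Lemma Lc_trace x : Lmx P x -> Lc (fun w => \tr (x w)).
Proof. by move=> hx; apply: Lc_sum => i _; apply: hx. Qed.

Lemma rc_linear s1 s2 c x y : all_Lmx s1 -> all_Lmx s2 -> Lmx P x -> Lmx P y ->
  rc (s1 ++ (c *: x + y) :: s2) = c * rc (s1 ++ x :: s2) + rc (s1 ++ y :: s2).
Proof.
move=> h1 h2 hx hy; rewrite /rescaled_cumulant !size_cat /= mulrA -mulrDl.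
congr (_ * _); set m := (size s1 + (size s2).+1)%N.
pose tr (z : RM) : T -> R[i] := fun w => \tr (z w).
have sz z : size [seq tr X | X <- s1 ++ z :: s2] = m.
  by rewrite size_map size_cat.
rewrite !(cumulant_funE _ (sz _)).
have p1 : (size s1 < m)%N by rewrite /m -addSnnS leq_addr.
have Lz z : Lmx P z -> forall i : 'I_m, Lc (nth (cst 0) [seq tr X | X <- s1 ++ z :: s2] i).
  move=> hz i; rewrite (nth_map 0) ?size_cat //; apply: Lc_trace.
  have : nth 0 (s1 ++ z :: s2) i \in s1 ++ z :: s2 by rewrite mem_nth // size_cat.
  by rewrite mem_cat inE => /or3P[/h1|/eqP->|/h2].
apply: (@cumulant_fun_linear _ _ _ _ _ _ _ _ _ (Ordinal p1)); try exact: Lz.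
- move=> i ip; have ni : (i : nat) != size s1 by [].
  rewrite !map_cat !nth_cat !size_map /=; case: ltnP => // le.
  have : (0 < i - size s1)%N by rewrite subn_gt0 ltn_neqAle eq_sym ni.
  by case: (_ - _)%N.
- rewrite /= !map_cat !nth_cat !size_map ltnn subnn /=.
  by apply/boolp.funext => w; rewrite /tr linearD linearZ.
Qed.

Lemma rc_tracial s1 s2 x y : rc (s1 ++ (x * y) :: s2) = rc (s1 ++ (y * x) :: s2).
Proof.
rewrite /rescaled_cumulant !size_cat /= !map_cat /=; congr (cumulant P (_ ++ _ :: _) * _).
by apply/boolp.funext => w; exact: mxtrace_mulC.
Qed.

Lemma rc_perm s t : perm_eq s t -> rc s = rc t.
Proof.
move=> st; rewrite /rescaled_cumulant (perm_size st); congr (_ * _).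
by apply: cumulant_perm; apply: perm_map.
Qed.

Lemma rc_unit : rc [:: 1] = 1.
Proof.
rewrite /rescaled_cumulant /= cumulant1.
have -> : (fun w : T => \tr ((1 : RM) w)) = (fun=> N.+1%:R).
  by apply/boolp.funext => w; rewrite mxtrace1.
rewrite EC_cst (_ : 1%:Z - 2 = -1) //.
by rewrite -[_ ^ (-1)]/(_^-1) divff // pnatr_eq0.
Qed.

Lemma rc_unit0 s : s <> [::] -> all_Lmx s -> rc (1 :: s) = 0.
Proof.
move=> s0 hs; rewrite /rescaled_cumulant /=.
have -> : (fun w : T => \tr ((1 : RM) w)) = (fun=> N.+1%:R).
  by apply/boolp.funext => w; rewrite mxtrace1.
rewrite cumulant_cst ?mul0r //; first by case: s s0 {hs}.
by move=> Y /mapP[x xs ->]; apply/Lc_trace/hs.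
Qed.

Lemma Lmx1 : Lmx P (1 : RM). Proof. exact: Lmx_cst. Qed.

(* The cumulants of constants vanish, so that each block must be one cycle. *)
Lemma phi_pp_one n (z : pperm n) : phi_pp rc z (fun=> 1) = pp_zeta R[i] z.
Proof.
have prod1 (I : Type) (r : seq I) : \prod_(j <- r) (1 : RM) = 1 by rewrite big1_eq.
set s := pp_perm z; have sV := ppv_perm z.
pose r (B : {set 'I_n}) := #|[pred i in B | i \in froots s]|.
have rE (B : {set 'I_n}) : [seq (\prod_(j <- fingraph.orbit s i) 1 : RM)
    | i <- enum B & i \in froots s] = nseq (r B) 1.
  have -> : r B = size [seq i <- enum B | i \in froots s].
    rewrite /r cardE; apply: perm_size; apply: uniq_perm.
    - exact: enum_uniq.
    - by rewrite filter_uniq // enum_uniq.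
    - by move=> i; rewrite [RHS]mem_filter !mem_enum inE andbC.
  by elim: [seq i <- enum B | i \in froots s] => //= i l ->; rewrite prod1.
have r0 (B : {set 'I_n}) : B \in blocks (ppv z) -> (0 < r B)%N.
  move=> VB; have /set0Pn[x xB] : B != finset.set0 by exact: part_neq0 VB.
  apply/card_gt0P; exists (froot s x); rewrite inE.
  have fs : connect_sym (frel s) := fconnect_sym (@perm_inj _ s).
  rewrite -(fconnect_stable (finer_stable sV VB) (i := x)) ?connect_root // xB /=.
  exact: (roots_root fs).
have sumr := sum_roots sV.
rewrite /phi_pp -blocks_ppv -/s; under eq_bigr => B _ do rewrite rE.
have rc1 m : (0 < m)%N -> rc (nseq m 1) = (m == 1%N)%:R.
  case: m => [//|[|m]] _; first by rewrite rc_unit.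
  apply: rc_unit0 => // x; rewrite -[_ :: _]/(nseq m.+1 1).
  by move=> /nseqP[-> _]; exact: Lmx1.
transitivity (\prod_(B in blocks (ppv z)) (r B == 1%N)%:R : R[i]).
  by apply: eq_bigr => B VB; rewrite rc1 // r0.
rewrite pp_zetaE.
have [/forall_inP h|] := boolP [forall B in blocks (ppv z), r B == 1%N].
  rewrite big1 => [|B VB]; last by rewrite h.
  have e : pcyc s = ppv z.
    apply: finer_card_eq => //; rewrite -sumr /nblocks -sum1_card.
    by apply: eq_bigr => B VB; apply/eqP; exact: h.
  by rewrite (_ : z == _) //; apply/eqP/pp_inj; rewrite ?perm_mkpp // ppv_mkpp e.
rewrite negb_forall_in => /exists_inP[B VB nB].
rewrite (bigD1 B) //= (negbTE nB) mul0r.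
rewrite (_ : (z == _) = false) //; apply/negP => /eqP ez.
have ev : nblocks (ppv z) = nblocks (pcyc s).
  by rewrite {1}ez ppv_mkpp.
have := r0 _ VB; move: sumr; rewrite -ev /nblocks -sum1_card.
rewrite (bigD1 B) //= [in RHS](bigD1 B) //= => e.
have : (\sum_(i in blocks (ppv z) | i != B) 1 <=
        \sum_(i in blocks (ppv z) | i != B) r i)%N.
  by apply: leq_sum => D /andP[VD _]; apply: r0.
move: e nB; rewrite /r; move: (#|_|) (\sum_(_ in _ | _) _)%N (\sum_(_ in _ | _) _)%N.
by move=> a b c e nB le a0; case/eqP: nB; lia.
Qed.

End RescaledCumulantRules.

(** * Words as cycles of a permutation *)

Lemma uniq_of_flatten (T : eqType) (l : seq (seq T)) :
  uniq (flatten l) -> [::] \notin l -> uniq l.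
Proof.
elim: l => //= c l IH; rewrite cat_uniq inE negb_or => /and3P[_ h ul] /andP[c0 l0].
rewrite IH // andbT; apply: contra h => cl; case: c c0 cl => // x c _ cl.
apply/hasP; exists x; rewrite ?mem_head //.
by apply/flattenP; exists (x :: c); rewrite ?mem_head.
Qed.

Section CyclePerm.
Variables (K : finType) (ls : seq (seq K)).
Hypothesis ls_uniq : uniq (flatten ls).
Hypothesis ls_full : forall i, i \in flatten ls.

Definition cycle_of i := head [::] [seq c <- ls | i \in c].

Lemma cycle_ofE c i : c \in ls -> i \in c -> cycle_of i = c.
Proof.
rewrite /cycle_of; elim: ls ls_uniq => //= c0 l IH; rewrite cat_uniq => /and3P[_ h ul].
rewrite inE => /predU1P[->|cl] ic; first by rewrite ic.
have /negbTE-> : i \notin c0.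
  by apply: contra h => ?; apply/hasP; exists i => //; apply/flattenP; exists c.
exact: IH.
Qed.

Lemma cycle_of_mem i : cycle_of i \in ls /\ i \in cycle_of i.
Proof. by have /flattenP[c cl ic] := ls_full i; rewrite (cycle_ofE cl ic). Qed.

Lemma cycle_uniq c : c \in ls -> uniq c.
Proof.
elim: ls ls_uniq => //= c0 l IH; rewrite cat_uniq => /and3P[h _ ul].
by rewrite inE => /predU1P[->//|/IH->].
Qed.

Definition cycle_succ i := next (cycle_of i) i.

Lemma cycle_succ_inj : injective cycle_succ.
Proof.
move=> i j; have [il1 il2] := cycle_of_mem i; have [jl1 jl2] := cycle_of_mem j => e.
have e' : cycle_of i = cycle_of j.
  rewrite -(@cycle_ofE (cycle_of i) (cycle_succ i)) ?mem_next //.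
  by rewrite e; apply: cycle_ofE; rewrite ?mem_next.
by move: e; rewrite /cycle_succ e' => /(can_inj (prev_next (cycle_uniq jl1))).
Qed.

Definition cycle_perm : {perm K} := perm cycle_succ_inj.

Lemma orbit_cycle_perm c i : c \in ls -> i \in c ->
  fingraph.orbit cycle_perm i = rot (index i c) c.
Proof.
move=> cl ic; have uc := cycle_uniq cl.
rewrite (@fingraph.orbitE _ _ c) //; apply: cycle_from_next => //.
by move=> x xc; rewrite /= permE /cycle_succ (cycle_ofE cl xc).
Qed.

End CyclePerm.

Section TracialFunctionals.
Variables (C : comNzRingType) (A : algType C) (phi : seq A -> C).
Hypothesis phi_tracial : forall s1 s2 x y,
  phi (s1 ++ (x * y) :: s2) = phi (s1 ++ (y * x) :: s2).
Hypothesis phi_sym : forall s t, perm_eq s t -> phi s = phi t.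

Lemma tracial_map (K : eqType) (u v : K -> A) (s : seq K) :
  (forall k, k \in s -> exists x y, u k = x * y /\ v k = y * x) ->
  phi [seq u k | k <- s] = phi [seq v k | k <- s].
Proof.
suff h t : (forall k, k \in s -> exists x y, u k = x * y /\ v k = y * x) ->
    phi (t ++ [seq u k | k <- s]) = phi (t ++ [seq v k | k <- s]) by exact: (h [::]).
elim: s t => //= k s IH t hs.
have [x [y [eu ev]]] := hs k (mem_head _ _).
rewrite eu phi_tracial -ev -!cat_rcons; apply: IH => l ls.
by apply: hs; rewrite inE ls orbT.
Qed.

(** The orbit of a root is a rotation of the listed cycle: traciality takes care of the rotation,
    symmetry of the order of the cycles. *)
Lemma tracial_cycles (K : finType) (F : K -> A) (ls : seq (seq K))
    (lsu : uniq (flatten ls)) (lsf : forall i, i \in flatten ls) : [::] \notin ls ->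
  phi [seq \prod_(j <- c) F j | c <- ls] =
  phi [seq \prod_(j <- fingraph.orbit (cycle_perm lsu lsf) i) F j
      | i <- enum K & i \in froots (cycle_perm lsu lsf)].
Proof.
move=> ls0; set s := cycle_perm lsu lsf.
have orb i : fingraph.orbit s i = rot (index i (cycle_of ls i)) (cycle_of ls i).
  by have [h1 h2] := cycle_of_mem lsu lsf i; apply: orbit_cycle_perm.
have fs : connect_sym (frel s) := fconnect_sym (@perm_inj _ s).
have con i j : fconnect s i j = (j \in cycle_of ls i).
  by rewrite fconnect_orbit orb mem_rot.
have eqc i c : c \in ls -> i \in c -> cycle_of ls i = c := @cycle_ofE _ _ lsu c i.
set r := [seq i <- enum K | i \in froots s].
rewrite -/r.
transitivity (phi [seq \prod_(j <- c) F j | c <- [seq cycle_of ls i | i <- r]]).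
  apply/phi_sym/perm_map/uniq_perm.
  - exact: uniq_of_flatten.
  - rewrite map_inj_in_uniq ?(filter_uniq _ (enum_uniq _)) // => i j; rewrite !mem_filter.
    move=> /andP[/eqP ri _] /andP[/eqP rj _] e; rewrite -ri -rj.
    by apply/eqP; rewrite root_connect // con e; case: (cycle_of_mem lsu lsf j).
  move=> c; apply/idP/mapP => [cl|[i _ ->]]; last by case: (cycle_of_mem lsu lsf i).
  have [i ic] : exists i, i \in c.
    by case: c cl => [/(negP ls0)//|i c _]; exists i; rewrite mem_head.
  exists (froot s i); first by rewrite mem_filter mem_enum andbT; exact: (roots_root fs).
  by symmetry; apply: (eqc) => //; rewrite -(eqc i c cl ic) -con connect_root.
rewrite -map_comp.
apply: (@tracial_map _ (fun i => \prod_(j <- cycle_of ls i) F j)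
  (fun i => \prod_(j <- fingraph.orbit s i) F j)) => i _; rewrite orb.
set c := cycle_of ls i; set k := index i c.
exists (\prod_(j <- take k c) F j), (\prod_(j <- drop k c) F j).
by rewrite -!big_cat /= cat_take_drop.
Qed.

End TracialFunctionals.

(* The letters of all words are numbered consecutively, and s permutes cyclically
   the letters of each word. It does not depend on the algebra: below it is used
   for all matrix sizes at once. *)
Lemma words_phi_pp (L : Type) (ws : seq (seq L)) : ws <> [::] -> all (fun w => ~~ nilp w) ws ->
  exists n (s : 'S_n.+1) (x : 'I_n.+1 -> L),
  forall (C : comNzRingType) (A : algType C) (phi : seq A -> C),
  (forall s1 s2 x y, phi (s1 ++ (x * y) :: s2) = phi (s1 ++ (y * x) :: s2)) ->
  (forall s t, perm_eq s t -> phi s = phi t) ->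
  forall F : L -> A,
  phi [seq \prod_(i <- w) F i | w <- ws] = phi_pp phi (pp_full s) (fun k => F (x k)).
Proof.
move=> ws0 wsn.
have [n en] : exists n, size (flatten ws) = n.+1.
  case: ws ws0 wsn => // -[//|t w] ws _ _ /=; by eexists.
have t0 : L by case: (flatten ws) en.
pose x (k : 'I_n.+1) := nth t0 (flatten ws) k.
pose ls := reshape (shape ws) (enum 'I_n.+1).
have fe : flatten ls = enum 'I_n.+1.
  by rewrite reshapeKr // -size_flatten en size_enum_ord.
have lsu : uniq (flatten ls) by rewrite fe enum_uniq.
have lsf i : i \in flatten ls by rewrite fe mem_enum.
have lsx : [seq [seq x k | k <- c] | c <- ls] = ws.
  rewrite map_reshape -[RHS]flattenK; congr reshape.
  rewrite [LHS](map_comp (nth t0 (flatten ws)) val) val_enum_ord.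
  by rewrite -en map_nth_iota0 // take_size.
have ls0 : [::] \notin ls.
  apply/negP => h; move: wsn; rewrite -lsx all_map => /allP/(_ _ h).
  by [].
exists n, (cycle_perm lsu lsf), x => C A phi tr sy F.
rewrite /phi_pp /= big_set1 -lsx -map_comp.
rewrite [X in _ = phi (map _ X)](_ : _ =
    [seq i <- enum 'I_n.+1 | i \in froots (cycle_perm lsu lsf)]).
  rewrite -tracial_cycles //; congr phi; apply: eq_map => c /=; exact: big_map.
by rewrite enum_setT -enumT.
Qed.

(* A point where the letter of [fA] (resp. [fB]) is trivial is lone in the left
   (resp. right) factor, so that no product of two such factors joins points of
   the two kinds. *)
Lemma pp_conv_mixed (C : comNzRingType) n (kl fA fB mu : pperm n.+1 -> C)
    (m : pred 'I_n.+1) p q (s : 'S_n.+1) :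
  pp_conv mu (@pp_zeta C n.+1) = @pp_delta C n.+1 ->
  pp_conv (@pp_zeta C n.+1) mu = @pp_delta C n.+1 ->
  pp_conv kl (@pp_zeta C n.+1) =1 fA ->
  (forall k z, ~~ m k -> pp_perm z k = k -> ~~ lone k (ppv z) -> fA z = 0) ->
  (forall k z, ~~ m k -> pp_perm z k != k -> fA z = fA (cutpp k z)) ->
  (forall k z, m k -> pp_perm z k = k -> ~~ lone k (ppv z) -> fB z = 0) ->
  (forall k z, m k -> pp_perm z k != k -> fB z = fB (cutpp k z)) ->
  m p -> ~~ m q -> pp_conv (pp_conv kl fB) mu (pp_full s) = 0.
Proof.
move=> mz zm eA A1 A2 B1 B2 mp mq.
have ek : kl =1 pp_conv fA mu.
  move=> z; rewrite -[LHS]pp_conv_delta -zm pp_convA.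
  exact: (eq_pp_conv eA (frefl mu)).
rewrite -pp_convA pp_convE big1 // => x _; rewrite big1 // => y _.
rewrite pp_mulE; case: eqP => [e|_]; last by rewrite mul0r.
have [/existsP[k /andP[mk nk]]|/existsPn hA] := boolP [exists k, ~~ m k && ~~ lone k (ppv x)].
  rewrite ek (pp_conv_moebius_lone mz zm (k := k)) ?mul0r ?mulr0 //.
  - by move=> z; apply: A1.
  - by move=> z; apply: A2.
have [/existsP[k /andP[mk nk]]|/existsPn hB] := boolP [exists k, m k && ~~ lone k (ppv y)].
  rewrite (pp_conv_moebius_lone mz zm (k := k)) ?mulr0 //.
  - by move=> z; apply: B1.
  - by move=> z; apply: B2.
have eR : equivalence_rel (fun i j : 'I_n.+1 => m i == m j).
  by apply/equivalence_relP; split=> [i|i j /eqP h k]; rewrite /= ?h.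
pose U := mkpart (fun i j : 'I_n.+1 => m i == m j).
have sep V b : (forall k, m k = b -> lone k V) -> finer V (blocks U).
  move=> hV; apply/finerP => i j ij; rewrite eqv_mkpart //; apply/eqP.
  have [mi|ni] := eqVneq (m i) b; first by have /loneP/(_ j ij)-> := hV i mi.
  have [mj|nj] := eqVneq (m j) b.
    by rewrite eqv_sym in ij; have /loneP/(_ i ij)-> := hV j mj.
  by case: b ni nj {hV} => [/negbTE|/negPf]; case: (m i); case: (m j).
have fU : finer (blocks (pj (ppv x) (ppv y))) (blocks U).
  rewrite finer_pj (@sep _ false) ?(@sep _ true) // => k mk.
    by have := hB k; rewrite mk negbK.
  by have := hA k; rewrite mk negbK.
rewrite -ppv_prod -e in fU; have /finerP/(_ p q) := fU.
have full : [set: 'I_n.+1]%SET \in blocks (ppv (pp_full s)) by rewrite blocks_ppv inE.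
by rewrite (eqv_block _ full) ?inE // eqv_mkpart // mp (negbTE mq) => /(_ isT).
Qed.

(** The argument lists in [phi_pp] are thus nonempty, as [converges_to] requires. *)
Lemma block_root (n : nat) (z : pperm n) (B : {set 'I_n}) : B \in pp_part z ->
  exists i, i \in [seq i <- enum B | i \in froots (pp_perm z)].
Proof.
rewrite -blocks_ppv => VB; have /set0Pn[x xB] : B != finset.set0 by exact: part_neq0 VB.
set s := pp_perm z; have sV := ppv_perm z.
have fs : connect_sym (frel s) := fconnect_sym (@perm_inj _ s).
exists (froot s x); rewrite mem_filter mem_enum.
rewrite -(fconnect_stable (finer_stable sV VB) (i := x)) ?connect_root // xB andbT.
exact: (roots_root fs).
Qed.

(** * Limits on words and vanishing of mixed cumulants *)

Section WordLimits.
Context (R : realType) (d : measure_display) (T : measurableType d) (P : probability T R).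
Local Notation RM N := (T -> 'M[R[i]]_N.+1).
Local Notation rc := (@rescaled_cumulant R d T P _).
Variables (K : Type) (a : forall N, K -> RM N).
Variables (B : algType R[i]) (psi : seq B -> R[i]) (b : K -> B).
Hypothesis ab : converges_to (@rescaled_cumulant R d T P) a psi b.

(* The additional letter None stands for the unit. *)
Definition letter (A : algType R[i]) (f : K -> A) (o : option K) : A := oapp f 1 o.

Lemma cv_words (ws : seq (seq (option K))) : ws <> [::] ->
  cv (fun N => rc [seq \prod_(i <- w) letter (a N) i | w <- ws])
     (psi [seq \prod_(i <- w) letter b i | w <- ws]).
Proof.
(* [pmap id] drops the letters None, whose value is 1. *)
move=> ws0; pose ps : seq (ncpoly R[i] K) := [seq [:: (1, pmap id w)] | w <- ws].
have e (A : algType R[i]) (f : K -> A) :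
    [seq \prod_(i <- w) letter f i | w <- ws] = [seq nc_eval f p | p <- ps].
  rewrite -map_comp; apply: eq_map => w /=; rewrite /nc_eval big_seq1 scale1r /=.
  elim: w => [|[k|] w IH]; rewrite /= ?big_nil // !big_cons IH //=.
  by rewrite mul1r.
rewrite cvE e (_ : (fun N => _) = fun N => rc [seq nc_eval (a N) p | p <- ps]).
  by apply: ab; rewrite /ps; case: (ws) ws0.
by apply/boolp.funext => N; rewrite e.
Qed.

Lemma cv_phi_pp n (z : pperm n) (x : 'I_n -> option K) :
  cv (fun N => phi_pp rc z (fun k => letter (a N) (x k)))
     (phi_pp psi z (fun k => letter b (x k))).
Proof.
rewrite /phi_pp; apply: cv_prod => D zD.
have [i iD] := block_root zD.
pose ws := [seq [seq x j | j <- fingraph.orbit (pp_perm z) i]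
  | i <- enum D & i \in froots (pp_perm z)].
have e (A : algType R[i]) (f : K -> A) : [seq \prod_(j <- fingraph.orbit (pp_perm z) i)
    letter f (x j) | i <- enum D & i \in froots (pp_perm z)] =
    [seq \prod_(i <- w) letter f i | w <- ws].
  by rewrite -map_comp; apply: eq_map => j /=; rewrite big_map.
rewrite e (_ : (fun N => _) = fun N => rc [seq \prod_(i <- w) letter (a N) i | w <- ws]).
  by apply: cv_words; rewrite /ws; case: [seq _ <- _ | _] iD.
by apply/boolp.funext => N; rewrite e.
Qed.

Hypothesis La : forall N k, Lmx P (a N k).

Lemma Lmx_letter N o : Lmx P (letter (a N) o).
Proof. by case: o => [k|]; [exact: La|exact: Lmx1]. Qed.

(** Inherited from the finite sizes, where the rule is exact. *)
Lemma lim_unit_fix n (z : pperm n) (x : 'I_n -> option K) k : x k = None ->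
  pp_perm z k = k -> ~~ lone k (ppv z) -> phi_pp psi z (fun k => letter b (x k)) = 0.
Proof.
move=> xk zk nz; apply: cv_unique (cv_phi_pp z x) _.
rewrite (_ : (fun N => _) = fun=> 0); first exact: cv_cst.
apply/boolp.funext => N; apply: (phi_pp_unit_fix (k := k)) => //.
- by move=> l; exact: Lmx_letter.
- by rewrite xk.
Qed.

Lemma lim_unit_cut n (z : pperm n) (x : 'I_n -> option K) k : x k = None ->
  pp_perm z k != k ->
  phi_pp psi z (fun k => letter b (x k)) = phi_pp psi (cutpp k z) (fun k => letter b (x k)).
Proof.
move=> xk zk; apply: cv_unique (cv_phi_pp z x) _.
rewrite (_ : (fun N => _) = fun N => phi_pp rc (cutpp k z) (fun k => letter (a N) (x k))).
  exact: cv_phi_pp.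
apply/boolp.funext => N; apply: (phi_pp_unit_cut (k := k)) => //.
- by move=> l; exact: Lmx_letter.
- by rewrite xk.
Qed.

End WordLimits.

Section ProductLimit.
Context (R : realType) (d : measure_display) (T : measurableType d) (P : probability T R).
Local Notation RM N := (T -> 'M[R[i]]_N.+1).
Local Notation rc := (@rescaled_cumulant R d T P _).
Variables (SA SB : forall N : nat, set (RM N)) (I J : Type).
Arguments SA N : clear implicits.
Arguments SB N : clear implicits.
Variables (a : forall N, I -> RM N) (b : forall N, J -> RM N).
Hypothesis SA_alg : forall N, mx_subalgebra P (SA N).
Hypothesis SB_alg : forall N, mx_subalgebra P (SB N).
Hypothesis SA_inv : forall N, unitarily_invariant P (SA N).
Hypothesis SAB : forall N, independent_ensembles P (SA N) (SB N).
Hypothesis SAa : forall N i, SA N (a N i).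
Hypothesis SBb : forall N j, SB N (b N j).
Variables (A1 : algType R[i]) (psi1 : seq A1 -> R[i]) (a1 : I -> A1).
Variables (A2 : algType R[i]) (psi2 : seq A2 -> R[i]) (b2 : J -> A2).
Hypothesis aa1 : converges_to (@rescaled_cumulant R d T P) a psi1 a1.
Hypothesis bb2 : converges_to (@rescaled_cumulant R d T P) b psi2 b2.

Lemma subalgebra_letter N (S : set (RM N)) (L : Type) (f : L -> RM N) o :
  mx_subalgebra P S -> (forall l, S (f l)) -> S (letter f o).
Proof.
case=> _ [S1 _ _] Sf; case: o => [l|]; first exact: Sf.
by move: S1; rewrite inE.
Qed.

Lemma subalgebra_Lmx N (S : set (RM N)) x : mx_subalgebra P S -> S x -> Lmx P x.
Proof. by case=> sub _ /sub. Qed.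

Lemma product_limit n (xa : 'I_n -> option I) (xb : 'I_n -> option J) :
  exists kl : pperm n -> R[i],
  pp_conv kl (@pp_zeta R[i] n) =1 (fun z => phi_pp psi1 z (fun k => letter a1 (xa k))) /\
  forall z, cv (fun N => phi_pp rc z (fun k => letter (a N) (xa k) * letter (b N) (xb k)))
    (pp_conv kl (fun z => phi_pp psi2 z (fun k => letter b2 (xb k))) z).
Proof.
(* With the bound as a premise, a k can be chosen for every N, arbitrarily for the finitely many
   small ones. *)
pose good N (k : pperm n -> R[i]) := (n <= N.+1)%N ->
  forall X : 'I_n -> RM N, (forall l, SB N (X l)) -> forall z : pperm n,
    phi_pp rc z (fun l => letter (a N) (xa l) * X l) =
    \sum_x \sum_(y | ppmul x y == z)
      N.+1%:R ^ (pp_len z - pp_len x - pp_len y) * (k x * phi_pp rc y X).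
have /boolp.choice[k kP] N : exists k, good N k.
  have [nN|nN] := leqP n N.+1; last by exists (fun=> 0); rewrite /good leqNgt nN.
  have SAl l : SA N (letter (a N) (xa l)).
    exact: (@subalgebra_letter N (SA N) I (a N) (xa l) (@SA_alg N) (@SAa N)).
  have [k kP] := phi_pp_product (proj1 (@SA_alg N)) (proj1 (@SB_alg N)) (@SA_inv N) (@SAB N) nN SAl.
  by exists k => _ X SX z; apply: kP.
have nearN : (\forall N \near \oo, (n <= N.+1)%N)%classic.
  by exists n => // N /= nN; exact: leqW.
apply: (@limit_convolution _ _ (fun N z => phi_pp rc z (fun k => letter (a N) (xa k)))
  (fun N z => phi_pp rc z (fun k => letter (b N) (xb k))) _ k).
- by move=> z; exact: cv_phi_pp.
- by move=> z; exact: cv_phi_pp.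
- apply: filterS nearN => N nN z.
  transitivity (phi_pp rc z (fun k => letter (a N) (xa k) * 1)).
    by congr phi_pp; apply/boolp.funext => l; rewrite mulr1.
  rewrite (kP N nN (fun=> 1)); last first.
    by move=> l; exact: (@subalgebra_letter N (SB N) J (b N) None (@SB_alg N) (@SBb N)).
  by apply: eq_bigr => x _; apply: eq_bigr => y _; rewrite phi_pp_one.
- apply: filterS nearN => N nN z; rewrite (kP N nN) // => l.
  exact: (@subalgebra_letter N (SB N) J (b N) (xb l) (@SB_alg N) (@SBb N)).
Qed.

Definition left_letter (x : option (I + J)) : option I :=
  if x is Some (inl i) then Some i else None.
Definition right_letter (x : option (I + J)) : option J :=
  if x is Some (inr j) then Some j else None.

Definition union_family N (x : I + J) : RM N :=
  match x with inl i => a N i | inr j => b N j end.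

Lemma letter_union N o : letter (@union_family N) o =
  letter (a N) (left_letter o) * letter (b N) (right_letter o).
Proof. by case: o => [[i|j]|] /=; rewrite ?mulr1 ?mul1r. Qed.

Lemma cv_union_phi_pp n (x : 'I_n -> option (I + J)) : exists l : pperm n -> R[i],
  forall z, cv (fun N => phi_pp rc z (fun k => letter (@union_family N) (x k))) (l z).
Proof.
have [kl [_ h]] := product_limit (left_letter \o x) (right_letter \o x).
eexists => z; have := h z; rewrite (_ : (fun N => _) = 
  (fun N => phi_pp rc z (fun k => letter (@union_family N) (x k)))); first exact.
apply/boolp.funext => N; congr phi_pp; apply/boolp.funext => k /=.
by rewrite letter_union.
Qed.

(* An empty word is the trivial letter, so that every word has a cycle of its own. *)
Lemma cv_union_words (ws : seq (seq (I + J))) : ws <> [::] -> exists l,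
  cv (fun N => rc [seq \prod_(i <- w) @union_family N i | w <- ws]) l.
Proof.
move=> ws0; pose pad (w : seq (I + J)) := if w is [::] then [:: None] else map Some w.
have [||n [s [x sx]]] := @words_phi_pp (option (I + J)) (map pad ws).
- by case: (ws) ws0.
- by elim: (ws) => //= -[|? ?].
have [l hl] := cv_union_phi_pp x.
exists (l (pp_full s)); have := hl (pp_full s).
rewrite (_ : (fun N => _) =
  (fun N => rc [seq \prod_(i <- w) @union_family N i | w <- ws])); first exact.
apply/boolp.funext => N.
have tr : forall s1 s2 (y z : RM N), rc (s1 ++ (y * z) :: s2) = rc (s1 ++ (z * y) :: s2).
  exact: rc_tracial.
have pm : forall s t : seq (RM N), perm_eq s t -> rc s = rc t by exact: rc_perm.
rewrite -(sx _ _ _ tr pm (letter (@union_family N))) -map_comp; congr rc.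
apply: eq_map => -[|i w] /=; first by rewrite big_seq1 big_nil.
by rewrite -[Some i :: _]/(map Some (i :: w)) big_map.
Qed.

Lemma union_free n (s : 'S_n.+2) (x : 'I_n.+2 -> I + J) (side : 'I_n.+2 -> bool)
    (l : pperm n.+2 -> R[i]) p q :
  (forall k, side k = if x k is inl _ then true else false) -> side p -> ~~ side q ->
  (forall z, cv (fun N => phi_pp rc z (fun k => @union_family N (x k))) (l z)) ->
  pp_conv l (@pp_moebius R[i] n.+2) (pp_full s) = 0.
Proof.
move=> sE sp sq hl.
have [kl [e1 e2]] := product_limit (left_letter \o (Some \o x)) (right_letter \o (Some \o x)).
(* In the default case of [xget], [pp_moebius] is 0 and so is every term. *)
rewrite /pp_moebius; case: xgetP => [mu _ [zm mz]|_]; last first.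
  by rewrite pp_convE big1 // => y _; rewrite big1 // => z _; rewrite mulr0 mulr0.
pose fB z := phi_pp psi2 z (fun k => letter b2 ((right_letter \o (Some \o x)) k)).
have el : l =1 pp_conv kl fB.
  move=> z; apply: cv_unique (hl z) _; have := e2 z.
  rewrite (_ : (fun N => _) = (fun N => phi_pp rc z (fun k => @union_family N (x k)))); first exact.
  apply/boolp.funext => N; congr phi_pp; apply/boolp.funext => k /=.
  by rewrite -(letter_union N (Some (x k))).
rewrite (eq_pp_conv el (frefl mu)).
pose fA z := phi_pp psi1 z (fun k => letter a1 ((left_letter \o (Some \o x)) k)).
refine (@pp_conv_mixed _ n.+1 kl fA fB mu side p q s mz zm e1 _ _ _ _ sp sq);
  move=> k z; rewrite sE => hk.
- apply: (lim_unit_fix aa1) => [N i|/=]; first exact: (subalgebra_Lmx (@SA_alg N)).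
  by case: (x k) hk.
- apply: (lim_unit_cut aa1) => [N i|/=]; first exact: (subalgebra_Lmx (@SA_alg N)).
  by case: (x k) hk.
- apply: (lim_unit_fix bb2) => [N i|/=]; first exact: (subalgebra_Lmx (@SB_alg N)).
  by case: (x k) hk.
- apply: (lim_unit_cut bb2) => [N i|/=]; first exact: (subalgebra_Lmx (@SB_alg N)).
  by case: (x k) hk.
Qed.

End ProductLimit.

(** * The limit space *)

Section ProductAlgebra.
Variables (C : comNzRingType) (A : nat -> algType C).

(** On arbitrary sequences the functionals may have no limit; this algebra only lends its operations
    to the polynomial sequences. *)
Definition prod_alg := forall N, A N.

Implicit Types x y z : prod_alg.

HB.instance Definition _ := gen_eqMixin prod_alg.
HB.instance Definition _ := gen_choiceMixin prod_alg.

Lemma prod_algP x y : (forall N, x N = y N) -> x = y.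
Proof. exact: functional_extensionality_dep. Qed.

Definition prod_add x y : prod_alg := fun N => x N + y N.
Definition prod_zero : prod_alg := fun N => 0.
Definition prod_opp x : prod_alg := fun N => - x N.
Definition prod_one : prod_alg := fun N => 1.
Definition prod_mul x y : prod_alg := fun N => x N * y N.
Definition prod_scale (k : C) x : prod_alg := fun N => k *: x N.

Let addA : associative prod_add.
Proof. by move=> x y z; apply: prod_algP => N; apply: addrA. Qed.
Let addC : commutative prod_add.
Proof. by move=> x y; apply: prod_algP => N; apply: addrC. Qed.
Let add0 : left_id prod_zero prod_add.
Proof. by move=> x; apply: prod_algP => N; apply: add0r. Qed.
Let addN : left_inverse prod_zero prod_opp prod_add.
Proof. by move=> x; apply: prod_algP => N; apply: addNr. Qed.
HB.instance Definition _ := GRing.isZmodule.Build prod_alg addA addC add0 addN.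

Let mulA : associative prod_mul.
Proof. by move=> x y z; apply: prod_algP => N; apply: mulrA. Qed.
Let mul1 : left_id prod_one prod_mul.
Proof. by move=> x; apply: prod_algP => N; apply: mul1r. Qed.
Let mulr1' : right_id prod_one prod_mul.
Proof. by move=> x; apply: prod_algP => N; apply: mulr1. Qed.
Let mulDl : left_distributive prod_mul +%R.
Proof. by move=> x y z; apply: prod_algP => N; apply: mulrDl. Qed.
Let mulDr : right_distributive prod_mul +%R.
Proof. by move=> x y z; apply: prod_algP => N; apply: mulrDr. Qed.
Let one_neq0 : prod_one != 0.
Proof. by apply/eqP => /(congr1 (fun x : prod_alg => x 0%N))/eqP; rewrite oner_eq0. Qed.
HB.instance Definition _ :=
  GRing.Zmodule_isNzRing.Build prod_alg mulA mul1 mulr1' mulDl mulDr one_neq0.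

Let scaleA k l x : prod_scale k (prod_scale l x) = prod_scale (k * l) x.
Proof. by apply: prod_algP => N; apply: scalerA. Qed.
Let scale1 : left_id 1 prod_scale.
Proof. by move=> x; apply: prod_algP => N; apply: scale1r. Qed.
Let scaleDr : right_distributive prod_scale +%R.
Proof. by move=> k x y; apply: prod_algP => N; apply: scalerDr. Qed.
Let scaleDl x : {morph prod_scale^~ x : k l / k + l}.
Proof. by move=> k l; apply: prod_algP => N; apply: scalerDl. Qed.
HB.instance Definition _ :=
  GRing.Zmodule_isLmodule.Build C prod_alg scaleA scale1 scaleDr scaleDl.

Let scaleAl (k : C) x y : k *: (x * y) = (k *: x) * y.
Proof. by apply: prod_algP => N; apply: scalerAl. Qed.
HB.instance Definition _ := GRing.Lmodule_isLalgebra.Build C prod_alg scaleAl.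

Let scaleAr (k : C) x y : k *: (x * y) = x * (k *: y).
Proof. by apply: prod_algP => N; apply: scalerAr. Qed.
HB.instance Definition _ := GRing.Lalgebra_isAlgebra.Build C prod_alg scaleAr.

End ProductAlgebra.

Section NcEval.
Variables (C : comNzRingType) (A : algType C) (K : Type) (f : K -> A).
Implicit Types p q : ncpoly C K.

Lemma nc_eval_nil : nc_eval f [::] = 0.
Proof. exact: big_nil. Qed.

Lemma nc_eval_cons m p :
  nc_eval f (m :: p) = m.1 *: (\prod_(i <- m.2) f i) + nc_eval f p.
Proof. exact: big_cons. Qed.

Lemma nc_eval_cat p q : nc_eval f (p ++ q) = nc_eval f p + nc_eval f q.
Proof. exact: big_cat. Qed.

Lemma nc_eval_word (w : seq K) : nc_eval f [:: (1, w)] = \prod_(i <- w) f i.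
Proof. by rewrite /nc_eval big_seq1 scale1r. Qed.

Lemma nc_eval_scale (k : C) p : nc_eval f [seq (k * m.1, m.2) | m <- p] = k *: nc_eval f p.
Proof.
by rewrite /nc_eval big_map scaler_sumr; apply: eq_bigr => m _; rewrite scalerA.
Qed.

Lemma nc_eval_mul p q :
  nc_eval f [seq (m.1 * l.1, m.2 ++ l.2) | m <- p, l <- q] = nc_eval f p * nc_eval f q.
Proof.
rewrite /nc_eval big_allpairs_dep mulr_suml; apply: eq_bigr => m _; rewrite mulr_sumr.
apply: eq_bigr => l _; rewrite big_cat /=.
by rewrite -scalerAl -scalerAr scalerA.
Qed.

End NcEval.

Section PolynomialSequences.
Variables (C : comNzRingType) (A : nat -> algType C) (K : Type) (c : forall N, K -> A N).

Definition poly_seq : {pred prod_alg A} :=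
  fun x => `[< exists p : ncpoly C K, forall N, x N = nc_eval (c N) p >].

Lemma poly_seqP x : reflect (exists p : ncpoly C K, forall N, x N = nc_eval (c N) p)
  (x \in poly_seq).
Proof. exact: asboolP. Qed.

Lemma poly_seq_closed : GRing.subsemialg_closed poly_seq.
Proof.
split.
- by apply/poly_seqP; exists [:: (1, [::])] => N; rewrite nc_eval_word big_nil.
- split; first by apply/poly_seqP; exists [::] => N; rewrite nc_eval_nil.
  move=> x y /poly_seqP[p hp] /poly_seqP[q hq]; apply/poly_seqP; exists (p ++ q) => N.
  by rewrite nc_eval_cat -hp -hq.
- move=> k x /poly_seqP[p hp]; apply/poly_seqP.
  exists [seq (k * m.1, m.2) | m <- p] => N.
  by rewrite nc_eval_scale -hp.
- move=> x y /poly_seqP[p hp] /poly_seqP[q hq]; apply/poly_seqP.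
  exists [seq (m.1 * l.1, m.2 ++ l.2) | m <- p, l <- q] => N.
  by rewrite nc_eval_mul -hp -hq.
Qed.
HB.instance Definition _ :=
  GRing.isSubalgClosed.Build C (prod_alg A) poly_seq poly_seq_closed.

(** A quotient of the free algebra on K: polynomials are identified when they agree at every
    size. *)
Definition poly_seq_alg := {x : prod_alg A | x \in poly_seq}.
HB.instance Definition _ := SubChoice.on poly_seq_alg.
HB.instance Definition _ := [SubChoice_isSubAlgebra of poly_seq_alg by <:].

Definition component N (x : poly_seq_alg) : A N := val x N.

Lemma component_poly (x : poly_seq_alg) :
  exists p : ncpoly C K, forall N, component N x = nc_eval (c N) p.
Proof. by have /poly_seqP := valP x. Qed.

Lemma component1 N : component N 1 = 1.
Proof. by rewrite /component rmorph1. Qed.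

Lemma componentD N (k : C) x y : component N (k *: x + y) = k *: component N x + component N y.
Proof. by rewrite /component linearP. Qed.

Lemma componentM N x y : component N (x * y) = component N x * component N y.
Proof. by rewrite /component rmorphM. Qed.

Fact generator_subproof k : (fun N => c N k : A N) \in poly_seq.
Proof.
by apply/poly_seqP; exists [:: (1, [:: k])] => N; rewrite nc_eval_word big_seq1.
Qed.
Definition generator k : poly_seq_alg := Sub (fun N => c N k) (generator_subproof k).

Lemma component_generator N k : component N (generator k) = c N k.
Proof. by rewrite /component SubK. Qed.

Lemma component_nc_eval N p : component N (nc_eval generator p) = nc_eval (c N) p.
Proof.
elim: p => [|m p IH].
  by rewrite !nc_eval_nil /component rmorph0.
rewrite !nc_eval_cons componentD IH; congr (_ *: _ + _).
elim: m.2 => [|k w IHw]; first by rewrite !big_nil component1.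
by rewrite !big_cons componentM component_generator IHw.
Qed.

End PolynomialSequences.

Section LimitSpace.
Variables (R : realType) (A : nat -> algType R[i]) (phi : forall N, seq (A N) -> R[i]).
Variables (K : Type) (c : forall N, K -> A N).
Local Notation ev N := (nc_eval (c N)).
(** Restricted to polynomials in the family, like [phi_unit0]: for [rescaled_cumulant] both rules
    rest on entries with all moments. *)
Hypothesis phi_linear : forall N ps1 ps2 k p q,
  phi (map (ev N) ps1 ++ (k *: ev N p + ev N q) :: map (ev N) ps2) =
  k * phi (map (ev N) ps1 ++ ev N p :: map (ev N) ps2) +
  phi (map (ev N) ps1 ++ ev N q :: map (ev N) ps2).
Hypothesis phi_tracial : forall N s1 s2 (x y : A N),
  phi (s1 ++ (x * y) :: s2) = phi (s1 ++ (y * x) :: s2).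
Hypothesis phi_sym : forall N (s t : seq (A N)), perm_eq s t -> phi s = phi t.
Hypothesis phi_unit : forall N, phi [:: 1 : A N] = 1.
Hypothesis phi_unit0 : forall N ps, ps <> [::] -> phi (1 :: map (ev N) ps) = 0.
Hypothesis phi_words : forall ws : seq (seq K), ws <> [::] ->
  exists l, cv (fun N => phi [seq \prod_(i <- w) c N i | w <- ws]) l.

Let monomials (ws : seq (seq K)) : seq (ncpoly R[i] K) := [seq [:: (1, w)] | w <- ws].

(** Multilinear expansion: ws collects the arguments already reduced to monomials, and the next
    polynomial is split term by term. *)
Lemma cv_evals (ps : seq (ncpoly R[i] K)) : ps <> [::] ->
  exists l, cv (fun N => phi (map (ev N) ps)) l.
Proof.
suff h ws : monomials ws ++ ps <> [::] -> exists l,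
    cv (fun N => phi (map (ev N) (monomials ws) ++ map (ev N) ps)) l.
  by move=> ps0; apply: (h [::]).
elim: ps ws => [|p ps IH] ws.
  rewrite cats0 => ws0; have [|l hl] := @phi_words ws; first by case: (ws) ws0.
  exists l; congr (cv _ l): hl; apply/boolp.funext => N; rewrite cats0 -map_comp.
  by congr phi; apply: eq_map => w /=; rewrite nc_eval_word.
move=> _; elim: p => [|m p [l hl]] /=.
  exists 0; rewrite (_ : (fun N => _) = fun=> 0); first exact: cv_cst.
  apply/boolp.funext => N.
  (* With k = -1 and p = q the right side cancels, so that phi vanishes at an argument 0. *)
  have := @phi_linear N (monomials ws) ps (-1) [::] [::].
  by rewrite nc_eval_nil scaler0 addr0 mulN1r addNr.
have [|l' hl'] := IH (rcons ws m.2); first by case: (ws).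
exists (m.1 * l' + l).
rewrite (_ : (fun N => _) = fun N =>
  m.1 * phi (map (ev N) (monomials (rcons ws m.2)) ++ map (ev N) ps) +
  phi (map (ev N) (monomials ws) ++ map (ev N) (p :: ps))).
  by apply: cvD hl; apply: cvM hl'; exact: cv_cst.
apply/boolp.funext => N; rewrite nc_eval_cons -nc_eval_word phi_linear.
by rewrite /monomials !map_rcons cat_rcons.
Qed.

Local Notation B := (poly_seq_alg c).

Lemma components_poly : exists p : B -> ncpoly R[i] K,
  forall N s, [seq component N x | x <- s] = map (ev N) (map p s).
Proof.
have /boolp.choice[p hp] := @component_poly _ _ _ c.
by exists p => N s; rewrite -map_comp; apply: eq_map => x /=.
Qed.

Lemma cv_components (s : seq B) : s <> [::] ->
  exists l, cv (fun N => phi [seq component N x | x <- s]) l.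
Proof.
have [p hp] := components_poly.
move=> s0; have [|l hl] := @cv_evals (map p s); first by case: (s) s0.
by exists l; congr (cv _ l): hl; apply/boolp.funext => N; rewrite hp.
Qed.

Definition limit_functional (s : seq B) : R[i] :=
  xget 0 (cv (fun N => phi [seq component N x | x <- s])).

Lemma cv_limit (s : seq B) : s <> [::] ->
  cv (fun N => phi [seq component N x | x <- s]) (limit_functional s).
Proof. by move=> /cv_components[l hl]; rewrite /limit_functional; apply: xgetI hl. Qed.

Lemma limit_functionalE (s : seq B) l : s <> [::] ->
  cv (fun N => phi [seq component N x | x <- s]) l -> limit_functional s = l.
Proof. by move=> /cv_limit h1 h2; apply: cv_unique h1 h2. Qed.

Lemma is_hops_limit : is_hops limit_functional.
Proof.
have [p hp] := components_poly.
have cat0 (s1 s2 : seq B) x : s1 ++ x :: s2 <> [::] by case: s1.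
split.
- move=> s1 s2 k x y; apply: limit_functionalE => //.
  rewrite (_ : (fun N => _) = fun N => k * phi [seq component N x | x <- s1 ++ x :: s2] +
    phi [seq component N x | x <- s1 ++ y :: s2]).
    by apply: cvD; [apply: cvM; [exact: cv_cst|]|]; apply: cv_limit.
  apply/boolp.funext => N; rewrite !map_cat /= componentD !hp.
  by have [[q hq] [r hr]] := (component_poly x, component_poly y); rewrite hq hr.
- move=> s1 s2 x y; apply: limit_functionalE => //.
  rewrite (_ : (fun N => _) = fun N => phi [seq component N x | x <- s1 ++ y * x :: s2]).
    exact: cv_limit.
  by apply/boolp.funext => N; rewrite !map_cat /= !componentM phi_tracial.
(* [cv_limit] says nothing about the empty list, but this list is the only permutation of itself. *)
- move=> s t st; have [s0|s0] := pselect (s = [::]).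
    by move: st; rewrite s0 perm_sym => /perm_nilP->.
  apply: limit_functionalE => //.
  rewrite (_ : (fun N => _) = fun N => phi [seq component N x | x <- t]).
    by apply: cv_limit => t0; apply: s0; apply/perm_nilP; rewrite -t0.
  by apply/boolp.funext => N; apply/phi_sym/perm_map.
- apply: limit_functionalE => //; rewrite (_ : (fun N => _) = fun=> 1); first exact: cv_cst.
  by apply/boolp.funext => N; rewrite /= component1 phi_unit.
- move=> s s0; apply: limit_functionalE => //.
  rewrite (_ : (fun N => _) = fun=> 0); first exact: cv_cst.
  apply/boolp.funext => N; rewrite /= component1 hp phi_unit0 //.
  by case: (s) s0.
Qed.

Lemma has_limit_of_words : has_limit_distribution phi c.
Proof.
exists B, limit_functional, (generator c); split; first exact: is_hops_limit.
move=> ps ps0; rewrite -cvE.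
rewrite (_ : (fun N => _) = fun N =>
    phi [seq component N x | x <- [seq nc_eval (generator c) p | p <- ps]]).
  by apply: cv_limit; case: (ps) ps0.
apply/boolp.funext => N; congr phi; rewrite -map_comp; apply: eq_map => p /=.
by rewrite component_nc_eval.
Qed.

End LimitSpace.

Section UnionLimit.
Context (R : realType) (d : measure_display) (T : measurableType d) (P : probability T R).
Local Notation RM N := (T -> 'M[R[i]]_N.+1).
Local Notation rc := (@rescaled_cumulant R d T P _).

Lemma Lmx_nc_eval N (K : Type) (f : K -> RM N) p :
  (forall k, Lmx P (f k)) -> Lmx P (nc_eval f p).
Proof.
move=> hf; rewrite /nc_eval; elim/big_ind: _ => [|x y hx hy|m _].
- exact: Lmx_cst.
- by move=> i j; rewrite (_ : (fun w => _) = fun w => x w i j + y w i j);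
    [exact: LcD|apply/boolp.funext => w; rewrite mxE].
have hw : Lmx P (\prod_(i <- m.2) f i).
  by elim/big_ind: _ => [|x y hx hy|i _]; [exact: Lmx1|exact: Lmx_mul|exact: hf].
move=> i j; rewrite (_ : (fun w => _) = fun w => m.1 * (\prod_(i <- m.2) f i) w i j).
  exact: LcZ.
by apply/boolp.funext => w; rewrite mxE.
Qed.

Lemma has_limit_union (K : Type) (f : forall N, K -> RM N) :
  (forall N k, Lmx P (f N k)) ->
  (forall ws : seq (seq K), ws <> [::] ->
     exists l, cv (fun N => rc [seq \prod_(i <- w) f N i | w <- ws]) l) ->
  has_limit_distribution (@rescaled_cumulant R d T P) f.
Proof.
move=> Lf hws.
have Lps N ps : all_Lmx P (map (nc_eval (f N)) ps).
  by elim: ps => // p ps IH x; rewrite inE => /predU1P[->|/IH//]; exact: Lmx_nc_eval.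
apply: has_limit_of_words => //.
- by move=> N ps1 ps2 k p q; apply: rc_linear => //; exact: Lmx_nc_eval.
- by move=> N s1 s2 x y; exact: rc_tracial.
- by move=> N s t; exact: rc_perm.
- by move=> N; exact: rc_unit.
- by move=> N ps ps0; apply: rc_unit0 => //; case: (ps) ps0.
Qed.
End UnionLimit.

Theorem theorem8p2 (R : realType) (d : measure_display) (T : measurableType d)
    (P : probability T R)
    (SA SB : forall N : nat, set (T -> 'M[R[i]]_N.+1))
    (I J : Type)
    (a : forall N : nat, I -> T -> 'M[R[i]]_N.+1)
    (b : forall N : nat, J -> T -> 'M[R[i]]_N.+1) :
  (forall N, mx_subalgebra P (SA N)) ->
  (forall N, mx_subalgebra P (SB N)) ->
  (forall N, unitarily_invariant P (SA N)) ->
  (forall N, independent_ensembles P (SA N) (SB N)) ->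
  (forall N i, SA N (a N i)) ->
  (forall N j, SB N (b N j)) ->
  has_limit_distribution (@rescaled_cumulant R d T P) a ->
  has_limit_distribution (@rescaled_cumulant R d T P) b ->
  asymptotically_free (@rescaled_cumulant R d T P) a b.
Proof.
move=> hA hB hU hAB ha hb [A1 [psi1 [a1 [_ c1]]]] [A2 [psi2 [b2 [_ c2]]]].
have [|ws|B [psi [c [hops hc]]]] := @has_limit_union R d T P (I + J) (union_family a b).
- by move=> N [i|j]; [exact: (subalgebra_Lmx (hA N) (ha N i))|
    exact: (subalgebra_Lmx (hB N) (hb N j))].
- exact: (cv_union_words hA hB hU hAB ha hb c1 c2).
exists B, psi, c; split=> // n s x k hx [p [q pq]].
have hy i : exists y, c y = x i /\ k i = if y is inl _ then true else false.
  have := hx i; case: (k i) => -[y _ e]; first by exists (inl y).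
  by exists (inr y).
have /boolp.choice[y hy'] := hy.
have [p' [q' [kp kq]]] : exists p' q', k p' /\ ~~ k q'.
  case ep: (k p) pq; case eq: (k q) => // _; first by exists p, q; rewrite ep eq.
  by exists q, p; rewrite ep eq.
apply: (union_free hA hB hU hAB ha hb c1 c2 s (x := y) (side := k)
  _ kp kq).
  by move=> i; case: (hy' i).
(* The values at z converge to [phi_pp psi z x], since each [x i] is the image of the letter
   [y i]. *)
move=> z; have := cv_phi_pp hc z (fun i => Some (y i)).
rewrite (_ : phi_pp psi z _ = phi_pp psi z x); first exact.
by congr phi_pp; apply/boolp.funext => i /=; case: (hy' i).
Qed.
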